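(* For the general $L$-hop multicast network with hop-$\ell$ link delays $X^{(\ell)}$, under the earliest $\{k_\ell\}_{\ell=1}^{L}$ stopping scheme, the average age at an individual end node at hop $L$ is $$\Delta_{\{k_\ell\}_{\ell=1}^{L}} = \sum_{\ell=1}^L \frac{1}{k_\ell} \sum_{i=1}^{k_\ell} E[X_{i:n}^{(\ell)}] + \frac{2n-k_L}{2k_L}\left(E[{X}_{k_L:n}^{(L)}] + E[Z_L]\right) + \frac{\mathrm{Var}[{X}_{k_L:n}^{(L)}+Z_L]}{2\left(E[{X}_{k_L:n}^{(L)}] + E[Z_L]\right)}.$$
   Context: $X^{(\ell)}_{i:n}$ denotes the $i$-th smallest of $n$ i.i.d. copies of $X^{(\ell)}$. In the model the link delays are shifted exponential (a constant plus an exponential variable), with parameters that may depend on the hop; the two-hop version of the formula is remarked to be valid for any delay distributions. $L$-hop network: a rooted tree of depth $L$ in which the root (source) and every node at level $\ell<L$ has $n$ children; the $n^L$ level-$L$ nodes are the end nodes. Link delays on links from level $\ell-1$ to level $\ell$ (hop $\ell$) are i.i.d. copies of $X^{(\ell)}$. The source generates time-stamped updates at will: each update is sent to its $n$ children, and as soon as the earliest $k_1$ have received it the other transmissions are terminated and the next update is generated (so $Z_1=0$). For $\ell\ge2$, a hop-$\ell$ transmitter (level $\ell-1$ node) that receives an update while idle immediately sends it to its $n$ children until the earliest $k_\ell$ of them have received it; then it terminates the other transmissions and waits idle for the next arrival. Updates reaching a busy transmitter are discarded. $Z_\ell$ is the waiting time at a hop-$\ell$ transmitter from the completion of an update (its delivery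 to $k_\ell$ children) until the next update arrives there, and $Y_\ell=X^{(\ell)}_{k_\ell:n}+Z_\ell$ is the time between two consecutive updates that start service at that transmitter. $M_\ell$, geometric with parameter $k_\ell/n$, is the number of update cycles between two successive updates that arrive at a receiver in hop $\ell$. The time between two consecutive successful updates at a hop-$\ell$ receiver is written as $S_\ell=\sum_{i=1}^{M_\ell}(Y_\ell)_i$, and the interarrival time of updates at hop $\ell+1$ is $R_{\ell+1}=S_\ell$. The age at an end node at time $t$ is $\Delta(t)=t-u(t)$, where $u(t)$ is the time-stamp (generation time at the source) of the most recent update at that node, and the average age is $\lim_{\tau\to\infty}\frac1\tau\int_0^\tau\Delta(t)\,dt$; it is the same for every end node.
   Formalization: For L at least 2, R_{l+1}=S_l is taken in law: updates arrive at each intermediate node as a renewal process independent of all link delays, and time-stamps are receipt times minus link delays met. Without this independence the formula fails (n=1, L=2, Exp(1) delays: 3.5 against true age 4). *)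

(* Defs.v *)
From HB Require Import structures.
From mathcomp Require Import all_boot all_order all_algebra.
From mathcomp Require Import all_classical all_reals all_analysis.

Set Implicit Arguments.
Unset Strict Implicit.
Unset Printing Implicit Defensive.

Import Order.TTheory GRing.Theory Num.Theory.
Import numFieldNormedType.Exports.

Local Open Scope classical_set_scope.
Local Open Scope ring_scope.

(* A node of the n-ary tree is the list of child numbers met on the way from
   the node up to the root: [::] is the root and c :: p is the c-th child of p.
   A node v at level [size v] transmits on hop [(size v).+1]. *)
Definition node (n : nat) := seq 'I_n.

Definition hop (n : nat) (v : node n) : nat := (size v).+1.

Definition ancestor (n : nat) (e : node n) (l : nat) : node n :=
  drop (size e - l) e.

(* i-th smallest of the n values of x, for 1 <= i <= n *)
Definition order_stat (R : realType) (n i : nat) (x : 'I_n -> R) : R :=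
  nth 0 (sort <=%R (codom x)) i.-1.

(* the least index i >= j with p i, and j itself if there is none *)
Definition next_index (p : pred nat) (j : nat) : nat :=
  if pselect (exists i, (j <= i)%N && p i) is left h then ex_minn h else j.

(* increasing enumeration of the indices satisfying p *)
Fixpoint nth_index (p : pred nat) (m : nat) : nat :=
  if m is m'.+1 then next_index p (nth_index p m').+1 else next_index p 0.

Definition mutually_independent d (T : measurableType d) (R : realType)
    (P : probability T R) (I : eqType) (D : pred I) (F : I -> T -> R) : Prop :=
  forall (s : seq I) (A : I -> set R), uniq s -> all D s ->
    (forall i, measurable (A i)) ->
  P (\bigcap_(i in [set` s]) (F i @^-1` A i)) =
    (\prod_(i <- s) P (F i @^-1` A i))%E.

Definition shifted_exponential d (T : measurableType d) (R : realType)
    (P : probability T R) (shift rate : R) (X : T -> R) : Prop :=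
  forall A : set R, measurable A ->
    P (X @^-1` A) = exponential_prob rate ((fun x => shift + x) @^-1` A).

Section Network.
Context d (T : measurableType d) (R : realType) (P : probability T R).
Variables (n : nat) (k : nat -> nat).
(* X v j c : delay of the link from v to its c-th child in the j-th update
             cycle (service) of the transmitter v
   G v a   : time between the a-th and the (a+1)-st update reaching v, v not
             the root (the variable R_(hop v))
   Cycles and updates are numbered from 0. *)
Variable X : node n -> nat -> 'I_n -> {RV P >-> R}.
Variable G : node n -> nat -> {RV P >-> R}.

Definition delay_stat (v : node n) (j i : nat) (w : T) : R :=
  order_stat i (fun c => X v j c w).

Definition service (v : node n) (j : nat) : T -> R :=
  delay_stat v j (k (hop v)).

(* the child c is among the earliest k_(hop v) in cycle j *)
Definition delivered (v : node n) (c : 'I_n) (w : T) : pred nat :=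
  fun j => X v j c w <= service v j w.

(* the cycle of v that delivers to the child c its m-th update *)
Definition delivery_cycle (v : node n) (c : 'I_n) (m : nat) (w : T) : nat :=
  nth_index (delivered v c w) m.

(* arrival instant at v of its a-th update, counted from its first arrival *)
Definition arrival (v : node n) (a : nat) (w : T) : R := \sum_(i < a) G v i w.

(* the number, among the updates arriving at v, of the one served in cycle j:
   the first one to arrive after cycle j.-1 is completed *)
Fixpoint accepted (v : node n) (w : T) (j : nat) : nat :=
  if j is j'.+1 then
    let a := accepted v w j' in
    next_index (fun b => arrival v a w + service v j' w <= arrival v b w) a.+1
  else 0.

(* The source generates updates at will: its a-th update opens its cycle a. *)
Definition served (v : node n) (j : nat) (w : T) : nat :=
  if v is [::] then j else accepted v w j.

(* Z: from the completion of cycle j until the next arrival *)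
Definition waiting (v : node n) (j : nat) (w : T) : R :=
  if v is [::] then 0
  else arrival v (served v j.+1 w) w
       - (arrival v (served v j w) w + service v j w).

(* Y *)
Definition cycle_length (v : node n) (j : nat) (w : T) : R :=
  service v j w + waiting v j w.

(* S at the child c of v: the sum of the M successive Y's from one successful
   cycle to the next *)
Definition success_gap (v : node n) (c : 'I_n) (m : nat) (w : T) : R :=
  \sum_(delivery_cycle v c m w <= j < delivery_cycle v c m.+1 w)
    cycle_length v j w.

(* instant at which v gets its first update; the source starts at time 0 *)
Fixpoint first_arrival (v : node n) (w : T) : R :=
  if v is c :: p then
    let j := delivery_cycle p c 0 w in
    first_arrival p w + \sum_(i < j) cycle_length p i w + X p j c w
  else 0.

(* instant at which the end node v receives its m-th update *)
Definition receipt (v : node n) (m : nat) (w : T) : R :=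
  if v is c :: p then
    let j := delivery_cycle p c m w in
    first_arrival p w + \sum_(i < j) cycle_length p i w + X p j c w
  else 0.

(* Total of the link delays met, from the source on, by the m-th update
   received by v. As idle transmitters forward at once, this is the age of that
   update when it is received. *)
Fixpoint transit (v : node n) (m : nat) (w : T) : R :=
  if v is c :: p then
    let j := delivery_cycle p c m w in
    transit p (served p j w) w + X p j c w
  else 0.

Definition time_stamp (v : node n) (m : nat) (w : T) : R :=
  receipt v m w - transit v m w.

Definition last_update (v : node n) (t : R) (w : T) : nat :=
  xget 0%N [set m | receipt v m w <= t < receipt v m.+1 w].

(* Before the first receipt, the end node is taken to hold an update with
   time-stamp 0. *)
Definition age (v : node n) (t : R) (w : T) : R :=
  t - (if t < receipt v 0 w then 0 else time_stamp v (last_update v t w) w).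

Definition primitive (i : (node n * nat * 'I_n) + (node n * nat)) : T -> R :=
  match i with
  | inl (v, j, c) => X v j c
  | inr (v, a) => G v a
  end.

(* the link delays of the tree, and the interarrival times at the intermediate
   nodes on the way from the source to e *)
Definition primitive_along (L : nat) (e : node n) :
    pred ((node n * nat * 'I_n) + (node n * nat)) :=
  fun i => match i with
  | inl (v, _, _) => (size v < L)%N
  | inr (v, _) => (0 < size v < L)%N && suffix v e
  end.

(* R_(l+1) = S_l is an identity in law: the arrivals at an intermediate node
   form a renewal process whose interarrival times are distributed as S at that
   node. The G's on two different source-to-end-node paths need not be
   independent of each other. *)
Record multicast_network (L : nat) (shift rate : nat -> R) : Prop := {
  link_delay_law : forall (v : node n) (j : nat) (c : 'I_n), (size v < L)%N ->
    shifted_exponential P (shift (hop v)) (rate (hop v)) (X v j c) ;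
  interarrival_law : forall (p : node n) (c : 'I_n) (a m : nat) (A : set R),
    ((size p).+1 < L)%N -> measurable A ->
    P (G (c :: p) a @^-1` A) = P (success_gap p c m @^-1` A) ;
  independence : forall e : node n, size e = L ->
    mutually_independent P (primitive_along L e) primitive }.

End Network.

(* Main.v *)
(* Along the path from the source to e, the cycles of a transmitter p regenerate:
   what happens from the start of cycle j on is a copy of what happens from cycle
   0 on, independent of the past. By induction along the path, cycle lengths and
   success gaps have exponential moments, the k fastest children form a uniform
   k-subset, and the age of the updates served by p has constant mean and is
   uncorrelated between updates.
   At the last transmitter, let Y be the cycle lengths, D the delivery indicators
   for e, A the age of the update at the start of its cycle and x its last link
   delay. The age H at the start of a cycle satisfies H' = Y + D A + (1 - D) H, and
   its integral over the cycle is H Y + Y^2 / 2 + D (A - H) (Y - x). A strong law for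
   martingale increments replaces the cycle variables by their means given the
   past, so the averages of Y and of these integrals over the cycles converge.
   Their ratio is the average age. The argument is carried out for the coordinate
   process on the space of sample paths and transferred to P by pushforward. *)
Require Import Defs.
From HB Require Import structures.
From mathcomp Require Import all_boot all_order all_algebra.
From mathcomp Require Import all_classical all_reals all_analysis.
From mathcomp Require Import perm measurable_realfun ring lra zify.
Import Order.TTheory GRing.Theory Num.Theory.
Import numFieldNormedType.Exports.
Set Implicit Arguments.
Unset Strict Implicit.
Unset Printing Implicit Defensive.
Local Open Scope classical_set_scope.
Local Open Scope ring_scope.

(** * Path spaces and independence *)

Section PathSpaces.
Local Open Scope ereal_scope.

(** Regeneration and symmetry of the children are statements about relabelling the primitive
    variables. On an abstract sample space such a relabelling is not a map; on the space of paths it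
    is, and it preserves integrals as soon as it is injective and respects the marginal laws. A
    cycle starts at an arrival whose number is random, but this number is a stopping index: the past
    decides whether it equals a given value. The interarrival times at a transmitter are primitives
    independent of the hops above it; hence the numbers of the updates it serves are independent of
    the ages these carry, and substituting a random number changes no mean. Exponential rather than
    second moments are propagated because they survive both the overshoot of an arrival beyond a
    service and a random sum whose number of terms depends on its terms. With mu = E[Y], p0 = k/n,
    alpha = E[A] and xbar the mean delay of a delivery, H averages to mu/p0 + alpha and the area to
    mu (mu/p0 + alpha) + E[Y^2]/2 - mu (mu - xbar). Dividing by mu gives alpha + xbar + (1/p0 - 1/2)
    mu + Var[Y]/(2 mu). *)

Definition path_space (I : Type) (R : realType) : Type :=
  g_sigma_algebraType (\bigcup_(i in [set: I])
    preimage_set_system setT (fun x : I -> R => x i) measurable).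

HB.instance Definition _ I R := Measurable.on (path_space I R).

Section PathSpace.
Variables (I : eqType) (R : realType).
Local Notation Om := (path_space I R).
Implicit Types (s : seq I) (A : I -> set R) (J : pred I).

Lemma measurable_coord (i : I) : measurable_fun setT (fun x : Om => x i).
Proof.
move=> _ B mB; apply: sub_sigma_algebra; exists i => //.
by exists B.
Qed.

Lemma measurable_to_path d (T : measurableType d) (f : T -> Om) :
  (forall i, measurable_fun setT (fun t => f t i)) -> measurable_fun setT f.
Proof.
move=> mf; apply: (@measurability _ _ T Om setT f _ erefl).
move=> _ [_ [i _ [B mB <-]] <-].
rewrite !setTI -comp_preimage -[X in measurable X]setTI.
exact: mf.
Qed.

Definition box s A : set Om := [set x | forall i, i \in s -> A i (x i)].

Lemma measurable_box s A : (forall i, measurable (A i)) -> measurable (box s A).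
Proof.
move=> mA; elim: s => [|i s ih].
  by rewrite (_ : box _ _ = setT)//; apply/seteqP; split.
have -> : box (i :: s) A = (fun x : Om => x i) @^-1` A i `&` box s A.
  apply/seteqP; split=> x /=.
    by move=> h; split=> [|j sj]; apply: h; rewrite inE ?eqxx ?sj ?orbT.
  by move=> [hi h] j; rewrite inE => /predU1P[->//|]; exact: h.
apply: measurableI => //.
by rewrite -[X in measurable X]setTI; apply: measurable_coord.
Qed.

Let boxes : set (set Om) :=
  [set B | exists s A, [/\ uniq s, forall i, measurable (A i) & B = box s A]].

(** Boxes form a pi-system that generates the sigma-algebra of the path space: two boxes meet in a
    box over the union of their index lists, with [setT] as the condition on an index absent from
    one of the lists. *)
Lemma path_measure_unique (m1 m2 : {measure set Om -> \bar R}) :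
  m1 setT < +oo ->
  (forall s A, uniq s -> (forall i, measurable (A i)) -> m1 (box s A) = m2 (box s A)) ->
  forall B, measurable B -> m1 B = m2 B.
Proof.
move=> fin eq12 B mB; apply: (@measure_unique _ _ _ boxes (fun=> setT)) => //.
- apply/seteqP; split; last first.
    apply: smallest_sub; first exact: sigma_algebra_measurable.
    by move=> _ [s [A [us mA ->]]]; exact: measurable_box.
  apply: smallest_sub; first exact: smallest_sigma_algebra.
  move=> _ [i _ [C mC <-]]; apply: sub_sigma_algebra.
  exists [:: i], (fun=> C); split=> //.
  rewrite setTI; apply/seteqP; split=> x /=; first by move=> Cx j; rewrite inE => /eqP ->.
  by apply; rewrite inE.
- move=> _ _ [s [A [us mA ->]]] [s' [A' [us' mA' ->]]].
  exists (undup (s ++ s')), (fun i => (if i \in s then A i else setT) `&`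
    (if i \in s' then A' i else setT)); split; first exact: undup_uniq.
    by move=> i; apply: measurableI; case: ifP.
  apply/seteqP; split=> x /=.
    move=> [h h'] i; rewrite mem_undup mem_cat => _.
    by split; case: ifP => // /[dup] ? ; [move/h|move/h'].
  move=> h; split=> i si.
    by have [] := h i; rewrite ?mem_undup ?mem_cat ?si.
  by have [] := h i; rewrite ?mem_undup ?mem_cat ?si ?orbT.
- move=> _; exists [::], (fun=> setT); split=> //.
  by apply/seteqP; split.
- by apply/seteqP; split => // x _; exists 0%N.
- by move=> _ [s [A [us mA ->]]]; exact: eq12.
Qed.

Definition depends_on (U : Type) J (f : Om -> U) :=
  forall x y : Om, (forall i, J i -> x i = y i) -> f x = f y.

(** The default value outside J is 1 and not 0: arrivals at a node whose later interarrival times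
    are all replaced by 1 are still unbounded, which [unbounded_restrict] uses. *)
Definition restrict_path J (x : Om) : Om := fun i => if J i then x i else 1%R.

Lemma restrict_pathE (U : Type) J (f : Om -> U) x :
  depends_on J f -> f (restrict_path J x) = f x.
Proof. by apply => i Ji; rewrite /restrict_path Ji. Qed.

Lemma depends_on_restrict (U : Type) J (f : Om -> U) :
  depends_on J (fun x => f (restrict_path J x)).
Proof.
move=> x y xy; congr f; apply/funext => i; rewrite /restrict_path.
by case: ifP => // /xy.
Qed.

Lemma measurable_restrict_path J : measurable_fun setT (restrict_path J).
Proof.
apply: measurable_to_path => i; rewrite /restrict_path.
by case: (J i); [exact: measurable_coord|exact: measurable_cst].
Qed.

HB.instance Definition _ J := isMeasurableFun.Build _ _ _ _
  (restrict_path J) (measurable_restrict_path J).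

Lemma restrict_box J s A :
  restrict_path J @^-1` box s A =
    (if all (fun i => J i || `[< A i 1%R >]) s then box [seq i <- s | J i] A else set0).
Proof.
apply/seteqP; split=> x /=.
  move=> h; case: ifPn => [_|] i.
    rewrite mem_filter => /andP[Ji /h]; by rewrite /restrict_path Ji.
  apply: (negP i); apply/allP => j /h; rewrite /restrict_path; case: (J j) => //= ?.
  exact/asboolP.
case: ifP => // /allP a h i si; rewrite /restrict_path; case: ifP => Ji.
  by apply: h; rewrite mem_filter Ji.
by have := a _ si; rewrite Ji /= => /asboolP.
Qed.

End PathSpace.

Section Independence.
Variables (I : eqType) (R : realType).
Local Notation Om := (path_space I R).
Variables (P : probability Om R) (D : pred I).
Hypothesis ind : mutually_independent P D (fun i (x : Om) => x i).
Implicit Types (s : seq I) (A : I -> set R) (J : pred I).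

Lemma probability_box s A : uniq s -> all D s -> (forall i, measurable (A i)) ->
  P (box s A) = \prod_(i <- s) P ((fun x : Om => x i) @^-1` A i).
Proof.
move=> us Ds mA; rewrite -ind//; congr (P _).

Qed.

(** Each side is, for one fixed set, a finite measure in the other set, so uniqueness on boxes
    applies to the two sets in turn. For two boxes over disjoint index lists the claim is the
    product formula of mutual independence. *)
Lemma independent_restrict J1 J2 : {subset J1 <= D} -> {subset J2 <= D} ->
  (forall i, J1 i -> ~~ J2 i) ->
  forall A B : set Om, measurable A -> measurable B ->
  P (restrict_path J1 @^-1` A `&` restrict_path J2 @^-1` B) =
  P (restrict_path J1 @^-1` A) * P (restrict_path J2 @^-1` B).
Proof.
move=> J1D J2D J12 A B mA mB.
have mr J C : measurable C -> measurable (restrict_path J @^-1` C : set Om).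
  by move=> mC; rewrite -[X in measurable X]setTI; exact: measurable_restrict_path.
have finP C : measurable C -> P C \is a fin_num by move=> mC; exact: fin_num_measure.
pose nnP C : {nonneg R} :=
  NngNum (fine_ge0 (measure_ge0 P C)).
have key J J' : {subset J <= D} -> {subset J' <= D} -> (forall i, J i -> ~~ J' i) ->
    forall C, measurable C ->
    (forall s A0, uniq s -> (forall i, measurable (A0 i)) ->
     P (restrict_path J @^-1` box s A0 `&` restrict_path J' @^-1` C) =
     P (restrict_path J @^-1` box s A0) * P (restrict_path J' @^-1` C)) ->
    forall E, measurable E ->
     P (restrict_path J @^-1` E `&` restrict_path J' @^-1` C) =
     P (restrict_path J @^-1` E) * P (restrict_path J' @^-1` C).
  move=> JD JD' JJ' C mC h E mE.
  have mC' := mr J' C mC.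
  pose rJ : {mfun Om >-> Om} := restrict_path J.
  pose m2 := mscale (nnP (restrict_path J' @^-1` C)) (distribution P rJ).
  suff : pushforward (mrestr P mC') rJ E = m2 E.
    rewrite /m2 /pushforward /mrestr /mscale/= fineK; last exact: finP.
    by move=> ->; exact: muleC.
  apply: path_measure_unique => //.
    change (P (rJ @^-1` setT `&` restrict_path J' @^-1` C) < +oo).
    rewrite preimage_setT setTI.
    by rewrite (le_lt_trans (probability_le1 P _))// ltry.
  move=> s A0 us mA0.
  change (P (rJ @^-1` box s A0 `&` restrict_path J' @^-1` C) = m2 (box s A0)).
  rewrite /m2 /pushforward /mrestr /mscale/= fineK; last exact: finP.
  by rewrite /distribution /pushforward/= h//; exact: muleC.
apply: (key) => // s A0 us mA0.
rewrite setIC muleC; apply: (key) => //.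
  by move=> i J2i; apply: contraPN J2i => /J12/negP.
  exact: measurable_box.
move=> s' A' us' mA'.
rewrite !restrict_box; case: ifP => a1; last by rewrite set0I measure0 mul0e.
case: ifP => a2; last by rewrite setI0 measure0 mule0.
set s2 := [seq i <- s' | J2 i]; set s1 := [seq i <- s | J1 i].
have us1 : uniq s1 by exact: filter_uniq.
have us2 : uniq s2 by exact: filter_uniq.
have s1D : all D s1 by apply/allP => i; rewrite mem_filter => /andP[/J1D].
have s2D : all D s2 by apply/allP => i; rewrite mem_filter => /andP[/J2D].
have s1J i : i \in s1 -> ~~ J2 i by rewrite mem_filter => /andP[/J12].
have s2J i : i \in s2 -> J2 i by rewrite mem_filter => /andP[].
pose A2 i := if J2 i then A' i else A0 i.
have -> : box s2 A' `&` box s1 A0 = box (s2 ++ s1) A2 :> set Om.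
  apply/seteqP; split=> x /=.
    move=> [h1 h2] i; rewrite mem_cat /A2 => /orP[si|si].
      by rewrite s2J//; exact: h1.
    by rewrite (negbTE (s1J _ si)); exact: h2.
  move=> h; split=> i si; have := h i; rewrite mem_cat si ?orbT => /(_ isT).
    by rewrite /A2 s2J.
  by rewrite /A2 (negbTE (s1J _ si)).
rewrite !probability_box//.
- rewrite big_cat/=; congr (_ * _); apply: eq_big_seq => i si.
    by rewrite /A2 s2J.
  by rewrite /A2 (negbTE (s1J _ si)).
- rewrite cat_uniq us1 us2 andbT/=; apply/hasPn => i si.
  by apply/negP => /s2J; apply/negP/s1J.
- by rewrite all_cat s1D s2D.
- by rewrite /A2 => i; case: ifP.
Qed.

(** The pair of restrictions to J1 and J2 has the product of its marginals as law, so the diagonal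
    integral becomes an iterated one by Tonelli: the J1 part can be frozen while the J2 part is
    integrated. *)
Lemma independent_integral J1 J2 (f : Om * Om -> \bar R) :
  {subset J1 <= D} -> {subset J2 <= D} -> (forall i, J1 i -> ~~ J2 i) ->
  measurable_fun setT f -> (forall x, 0 <= f x) ->
  (forall y, depends_on J1 (fun x => f (x, y))) ->
  (forall x, depends_on J2 (fun y => f (x, y))) ->
  \int[P]_x f (x, x) = \int[P]_x \int[P]_y f (x, y).
Proof.
move=> J1D J2D J12 mf f0 f1 f2.
pose r1 : {mfun Om >-> Om} := restrict_path J1.
pose r2 : {mfun Om >-> Om} := restrict_path J2.
pose P1 := distribution P r1.
pose P2 := distribution P r2.
have mr12 : measurable_fun setT (fun x : Om => (r1 x, r2 x)).
  exact: measurable_fun_pair.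
pose r12 : {mfun Om >-> (Om * Om)%type} := HB.pack (fun x : Om => (r1 x, r2 x))
  (isMeasurableFun.Build _ _ _ _ _ mr12).
have fE : (fun x => f (x, x)) = f \o r12.
  apply/funext => x /=.
  by rewrite (restrict_pathE _ (f2 _)) (restrict_pathE x (f1 _)).
have fE2 y : (fun z => f (y, z)) = (fun z => f (r1 y, z)) \o r2.
  apply/funext => x /=.
  by rewrite (restrict_pathE _ (f2 _)) (restrict_pathE y (f1 _)).
transitivity (\int[distribution P r12]_z f z).
  by rewrite ge0_integral_distribution// -fE.
have mf1 y : measurable_fun setT (fun z => f (y, z)).
  exact: measurableT_comp.
transitivity (\int[P1]_x \int[P2]_y f (x, y)); last first.
  rewrite ge0_integral_distribution//=; last 2 first.
    exact: measurable_fun_fubini_tonelli_F.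
    by move=> y; exact: integral_ge0.
  apply: eq_integral => y _.
  by rewrite /= [LHS]ge0_integral_distribution// fE2.
rewrite -fubini_tonelli1//.
apply: eq_measure_integral => A mA _.
apply/esym/product_measure_unique => // B C mB mC.
exact: independent_restrict.
Qed.

Lemma independent_integralM J1 J2 (f g : Om -> \bar R) :
  {subset J1 <= D} -> {subset J2 <= D} -> (forall i, J1 i -> ~~ J2 i) ->
  measurable_fun setT f -> measurable_fun setT g ->
  (forall x, 0 <= f x) -> (forall x, 0 <= g x) ->
  depends_on J1 f -> depends_on J2 g ->
  \int[P]_x (f x * g x) = (\int[P]_x f x) * (\int[P]_x g x).
Proof.
move=> J1D J2D J12 mf mg f0 g0 f1 g2.
rewrite (@independent_integral J1 J2 (fun z => f z.1 * g z.2))//=; last 4 first.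
- by apply: emeasurable_funM; exact: measurableT_comp.
- by move=> x; exact: mule_ge0.
- by move=> y x x' xx'; rewrite (f1 _ _ xx').
- by move=> y x x' xx'; rewrite (g2 _ _ xx').
under eq_integral do rewrite ge0_integralZl//.
by rewrite ge0_integralZr//; exact: integral_ge0.
Qed.

(** Independence makes the joint law of the coordinates in J a product of marginals, so relabelling
    them injectively by variables of equal marginal laws leaves that joint law unchanged. The cycle
    shift and the exchange of two children are both instances. *)
Lemma reindex_integral (s : I -> I) J (f : Om -> \bar R) :
  {subset J <= D} -> (forall i, J i -> D (s i)) -> {in J &, injective s} ->
  (forall i (A : set R), J i -> measurable A ->
    P ((fun x : Om => x (s i)) @^-1` A) = P ((fun x : Om => x i) @^-1` A)) ->
  measurable_fun setT f -> (forall x, 0 <= f x) -> depends_on J f ->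
  \int[P]_x f (fun i => x (s i)) = \int[P]_x f x.
Proof.
move=> JD JsD sinj sP mf f0 fJ.
have ms : measurable_fun setT (fun x : Om => (fun i => x (s i)) : Om).
  by apply: measurable_to_path => i; exact: measurable_coord.
pose r : {mfun Om >-> Om} := restrict_path J.
have mrs : measurable_fun setT (fun x : Om => r (fun i => x (s i))).
  exact: (measurableT_comp (measurable_restrict_path J) ms).
pose rs : {mfun Om >-> Om} := HB.pack (fun x : Om => r (fun i => x (s i)))
  (isMeasurableFun.Build _ _ _ _ _ mrs).
under eq_integral => x _ do rewrite -(restrict_pathE _ fJ).
under [RHS]eq_integral => x _ do rewrite -(restrict_pathE _ fJ).
transitivity (\int[distribution P rs]_x f x).
  by rewrite ge0_integral_distribution.
transitivity (\int[distribution P r]_x f x); last first.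
  by rewrite ge0_integral_distribution.
apply: eq_measure_integral => A mA _.
apply: path_measure_unique => //.
  by rewrite (le_lt_trans (probability_le1 _ _))// ltry.
move=> t B ut mB.
change (P ((fun x i => x (s i)) @^-1` (restrict_path J @^-1` box t B)) =
  P (restrict_path J @^-1` box t B)).
rewrite restrict_box; case: ifP => _; last by rewrite preimage_set0.
set u := [seq i <- t | J i].
have uu : uniq u by exact: filter_uniq.
have uJ i : i \in u -> J i by rewrite mem_filter => /andP[].
rewrite probability_box//; last by apply/allP => i /uJ; exact: JD.
(* [inv] needs a default index, hence the separate case of an empty list. *)
have [->|u0] := eqVneq u [::].
  rewrite big_nil -(@probability_setT _ _ _ P); congr (P _).
  by apply/seteqP; split.
have [i0 _] : exists i0, i0 \in u by case: u u0 {uu uJ} => // i ? _; exists i; rewrite inE eqxx.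
pose inv k := nth i0 u (index k (map s u)).
have invK i : i \in u -> inv (s i) = i.
  move=> ui; rewrite /inv nth_index_map// => j k uj uk.
  by apply: sinj; exact: uJ.
have -> : (fun x i => x (s i)) @^-1` box u B = box (map s u) (fun k => B (inv k)) :> set Om.
  apply/seteqP; split=> x /= h.
    by move=> _ /mapP[i ui ->]; rewrite invK//; exact: h.
  by move=> i ui; rewrite -{1}(invK _ ui); apply: h; exact: map_f.
rewrite probability_box//.
- rewrite big_map; apply: eq_big_seq => i ui; rewrite invK// sP//.
  exact: uJ.
- rewrite map_inj_in_uniq// => j k uj uk.
  by apply: sinj; exact: uJ.
- by apply/allP => _ /mapP[i ui ->]; exact/JsD/uJ.
Qed.

End Independence.

End PathSpaces.

(** * A strong law for orthogonal variables *)

Section SquareIntegrable.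
Context d (T : measurableType d) (R : realType) (P : probability T R).
Implicit Types (f g : T -> R).

Definition L1 f := P.-integrable setT (EFin \o f).
Definition Ex f : R := (\int[P]_x f x)%R.

Lemma L1_measurable f : L1 f -> measurable_fun setT f.
Proof. by move/measurable_int/measurable_EFinP. Qed.

Lemma ge0_L1 f : measurable_fun setT f -> (forall x, 0 <= f x) ->
  (\int[P]_x (f x)%:E < +oo)%E -> L1 f.
Proof.
move=> mf f0 fy; apply/integrableP; split; first exact/measurable_EFinP.
by under eq_integral => x _ do rewrite /= ger0_norm//.
Qed.

Lemma ExE f : L1 f -> (\int[P]_x (f x)%:E)%E = (Ex f)%:E.
Proof. by move=> f1; rewrite /Ex /Rintegral fineK//; exact: integrable_fin_num. Qed.

Lemma le_L1 f g : measurable_fun setT f -> (forall x, `|f x| <= `|g x|) ->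
  L1 g -> L1 f.
Proof.
move=> mf fg; apply: le_integrable => //; first exact/measurable_EFinP.
by move=> x _ /=; rewrite lee_fin.
Qed.

Lemma eq_Ex f g : f =1 g -> Ex f = Ex g.
Proof. by move=> /funext ->. Qed.

Lemma ae_eq_Ex f g : measurable_fun setT f -> measurable_fun setT g ->
  {ae P, forall x, f x = g x} -> Ex f = Ex g.
Proof.
move=> mf mg fg; rewrite /Ex /Rintegral; congr fine.
apply: ae_eq_integral => //; [exact/measurable_EFinP..|].
by apply: filterS fg => x -> _.
Qed.

Lemma L1D f g : L1 f -> L1 g -> L1 (fun x => f x + g x).
Proof. exact: integrableD. Qed.

Lemma L1B f g : L1 f -> L1 g -> L1 (fun x => f x - g x).
Proof. exact: integrableB. Qed.

Lemma L1Z c f : L1 f -> L1 (fun x => c * f x).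
Proof. exact: integrableZl. Qed.

Lemma L1_cst c : L1 (fun=> c).
Proof. exact: finite_measure_integrable_cst. Qed.

Lemma L1_sum (n : nat) (F : nat -> T -> R) : (forall i, (i < n)%N -> L1 (F i)) ->
  L1 (fun x => \sum_(i < n) F i x).
Proof.
elim: n => [|n ih] h; first by under eq_fun do rewrite big_ord0; exact: L1_cst.
under eq_fun do rewrite big_ord_recr/=.
by apply: L1D; [apply: ih => i /ltnW ?; apply: h|exact: h].
Qed.

Lemma ExD f g : L1 f -> L1 g -> Ex (fun x => f x + g x) = Ex f + Ex g.
Proof. by move=> f1 g1; rewrite /Ex RintegralD. Qed.

Lemma ExB f g : L1 f -> L1 g -> Ex (fun x => f x - g x) = Ex f - Ex g.
Proof. by move=> f1 g1; rewrite /Ex RintegralB. Qed.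

Lemma ExZ c f : L1 f -> Ex (fun x => c * f x) = c * Ex f.
Proof. by move=> f1; rewrite /Ex RintegralZl. Qed.

Lemma Ex_cst c : Ex (fun=> c) = c.
Proof. rewrite /Ex Rintegral_cst//; have -> : fine (P setT) = 1 by rewrite probability_setT.
by rewrite mulr1. Qed.

Lemma Ex_sum (n : nat) (F : nat -> T -> R) : (forall i, (i < n)%N -> L1 (F i)) ->
  Ex (fun x => \sum_(i < n) F i x) = \sum_(i < n) Ex (F i).
Proof.
elim: n => [|n ih] h.
  by rewrite big_ord0; under eq_fun do rewrite big_ord0; exact: Ex_cst.
under eq_fun do rewrite big_ord_recr/=.
have h' i : (i < n)%N -> L1 (F i) by move=> /ltnW ?; exact: h.
by rewrite ExD ?ih ?big_ord_recr//; [exact: L1_sum|exact: h].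
Qed.

Lemma L1_sum_seq (I : Type) (s : seq I) (F : I -> T -> R) : (forall i, L1 (F i)) ->
  L1 (fun x => \sum_(i <- s) F i x).
Proof.
move=> F1; elim: s => [|i s ih].
  by under eq_fun do rewrite big_nil; exact: L1_cst.
by under eq_fun do rewrite big_cons; exact: L1D.
Qed.

Lemma Ex_sum_seq (I : Type) (s : seq I) (F : I -> T -> R) : (forall i, L1 (F i)) ->
  Ex (fun x => \sum_(i <- s) F i x) = \sum_(i <- s) Ex (F i).
Proof.
move=> F1; elim: s => [|i s ih].
  by under eq_fun do rewrite big_nil; rewrite big_nil Ex_cst.
under eq_fun do rewrite big_cons.
by rewrite ExD ?big_cons ?ih//; exact: L1_sum_seq.
Qed.

Lemma le_Ex f g : L1 f -> L1 g -> (forall x, f x <= g x) -> Ex f <= Ex g.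
Proof. by move=> f1 g1 fg; apply: le_Rintegral. Qed.

Lemma Ex_ge0 f : (forall x, 0 <= f x) -> 0 <= Ex f.
Proof. by move=> f0; apply: Rintegral_ge0. Qed.

Definition L2 f := measurable_fun setT f /\ L1 (fun x => f x ^+ 2).

Lemma L2_measurable f : L2 f -> measurable_fun setT f. Proof. by case. Qed.

Lemma L2M f g : L2 f -> L2 g -> L1 (fun x => f x * g x).
Proof.
move=> [mf f2] [mg g2]; apply: le_L1 (L1D f2 g2).
  exact: measurable_funM.
move=> x; rewrite normrM [leRHS]ger0_norm ?addr_ge0 ?sqr_ge0//.
rewrite -(real_normK (num_real (f x))) -(real_normK (num_real (g x))).
by have := sqr_ge0 (`|f x| - `|g x|); have := normr_ge0 (f x);
  have := normr_ge0 (g x); nra.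
Qed.

Lemma L2_cst c : L2 (fun=> c).
Proof. by split; [exact: measurable_cst|exact: L1_cst]. Qed.

Lemma L2_L1 f : L2 f -> L1 f.
Proof.
move=> f2; have := L2M f2 (L2_cst 1).
by under eq_fun do rewrite mulr1.
Qed.

Lemma L2D f g : L2 f -> L2 g -> L2 (fun x => f x + g x).
Proof.
move=> f2 g2; split; first by apply: measurable_funD; apply: L2_measurable.
have -> : (fun x => (f x + g x) ^+ 2) =
    (fun x => (f x ^+ 2 + 2 * (f x * g x)) + g x ^+ 2).
  by apply/funext => x; ring.
apply: L1D; last exact: f2.2 || exact: g2.2.
by apply: L1D; [exact: f2.2|apply: L1Z; exact: L2M].
Qed.

Lemma L2Z c f : L2 f -> L2 (fun x => c * f x).
Proof.
move=> [mf f2]; split; first exact: measurable_funM.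
under eq_fun do rewrite exprMn.
exact: L1Z.
Qed.

Lemma L2B f g : L2 f -> L2 g -> L2 (fun x => f x - g x).
Proof.
move=> f2 g2; have := L2D f2 (L2Z (-1) g2).
by under eq_fun do rewrite mulN1r.
Qed.

Lemma L2_sum (n : nat) (F : nat -> T -> R) : (forall i, (i < n)%N -> L2 (F i)) ->
  L2 (fun x => \sum_(i < n) F i x).
Proof.
elim: n => [|n ih] h; first by under eq_fun do rewrite big_ord0; exact: L2_cst.
under eq_fun do rewrite big_ord_recr/=.
by apply: L2D; [apply: ih => i /ltnW ?; apply: h|exact: h].
Qed.

Lemma le_L2 f g : measurable_fun setT f -> (forall x, `|f x| <= `|g x|) ->
  L2 g -> L2 f.
Proof.
move=> mf fg [mg g2]; split=> //.
apply: le_L1 g2; first exact: measurable_funX.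
by move=> x; rewrite !normrX lerXn2r ?nnegrE.
Qed.

Lemma L2_norm f : L2 f -> L2 (fun x => `|f x|).
Proof.
move=> f2; apply: (le_L2 _ _ f2); last by move=> x; rewrite normr_id.
by apply: measurableT_comp => //; exact: L2_measurable.
Qed.

(** The sum of the squares has a finite integral by monotone convergence, hence is finite almost
    surely, and the terms of a convergent series tend to 0. This plays the part of the
    Borel-Cantelli lemma. *)
Lemma ae_cvg0_of_sum_squares (f : nat -> T -> R) (u : nat -> R) K :
  (forall n, L2 (f n)) -> (forall n, Ex (fun x => f n x ^+ 2) <= u n) ->
  (forall N, \sum_(n < N) u n <= K) ->
  {ae P, forall x, (fun n => f n x) @ \oo --> 0}.
Proof.
move=> f2 fu uK.
pose F n x := ((f n x) ^+ 2)%:E.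
have mF n : measurable_fun setT (F n).
  by apply/measurable_EFinP/measurable_funX/L2_measurable.
have F0 n x : (0 <= F n x)%E by rewrite lee_fin sqr_ge0.
have FK : (\int[P]_x (\sum_(n <oo) F n x) <= K%:E)%E.
  rewrite integral_nneseries//; apply: lime_le.
    by apply: is_cvg_nneseries => n _ _; exact: integral_ge0.
  apply: nearW => N; rewrite big_mkord.
  rewrite (eq_bigr (fun n : 'I_N => (Ex (fun x => f n x ^+ 2))%:E)); last first.
    by move=> n _; rewrite -ExE//; exact: (f2 n).2.
  by rewrite sumEFin lee_fin (le_trans _ (uK N))// ler_sum.
have iF : P.-integrable setT (fun x => \sum_(n <oo) F n x)%E.
  apply/integrableP; split; first by apply: ge0_emeasurable_sum => // n x _ _.
  under eq_integral => x _ do rewrite gee0_abs ?nneseries_ge0//.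
  by rewrite (le_lt_trans FK)// ltry.
apply: filterS (integrable_ae measurableT iF) => x /(_ Logic.I) Fx.
have sF : cvgn (series (fun n => f n x ^+ 2)).
  apply: nondecreasing_is_cvgn.
    by apply/nondecreasing_seqP => n; rewrite /series/= big_nat_recr//= lerDl sqr_ge0.
  exists (fine (\sum_(n <oo) F n x)%E) => _ [N _ <-].
  rewrite -lee_fin fineK// /series/= -sumEFin.
  by apply: (@nneseries_lim_ge R (fun n => F n x) xpredT 0 N) => n _ _; exact: F0.
have := cvg_series_cvg_0 sF.
move=> /cvgrPdist_lt h; apply/cvgrPdist_lt => e e0.
have := h _ (exprn_gt0 2 e0); apply: filterS => n.
rewrite !sub0r !normrN normrX => h2.
by rewrite -(ltr_pXn2r (n := 2))// nnegrE// ltW.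
Qed.

Lemma sum_inv_squares_le2 N : \sum_(n < N) (n.+1%:R ^- 2 : R) <= 2.
Proof.
(* The sharper bound 2 - 1/(N+1) is the one that telescopes in the induction. *)
have h : \sum_(n < N.+1) (n.+1%:R ^- 2 : R) <= 2 - N.+1%:R^-1.
  elim: N => [|N ih]; first by rewrite big_ord_recl big_ord0 expr1n invr1; lra.
  rewrite big_ord_recr/=; apply: le_trans (lerD ih (lexx _)) _.
  rewrite -addrA lerD2l.
  have a0 : 0 < N.+1%:R :> R by rewrite ltr0n.
  rewrite -[N.+2]addn1 natrD; set a := N.+1%:R in a0 *.
  have -> : - a^-1 + (a + 1) ^- 2 = - ((a + 1)^-1) - (a * (a + 1) ^+ 2)^-1.
    by field; rewrite gt_eqF//= gt_eqF// addr_gt0.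
  by rewrite gerDl oppr_le0 invr_ge0 mulr_ge0 ?exprn_ge0 ?addr_ge0// ltW.
apply: le_trans (le_trans h _); last by rewrite gerBl invr_ge0.
by rewrite [leRHS]big_ord_recr/= lerDl invr_ge0 exprn_ge0.
Qed.

Lemma sqr_sum_le (k : nat) (a : nat -> R) :
  (\sum_(i < k) a i) ^+ 2 <= k%:R * \sum_(i < k) a i ^+ 2.
Proof.
elim: k => [|k ih]; first by rewrite !big_ord0 mul0r expr0n.
rewrite !big_ord_recr/=.
set s := \sum_(i < k) a i in ih *; set q := \sum_(i < k) a i ^+ 2 in ih *.
have [k0|k0] := posnP k.
  by rewrite /s /q k0 !big_ord0 !add0r mul1r.
have {k0} k0 : 0 < k%:R :> R by rewrite ltr0n.
rewrite -(natr1 k) -(ler_pM2l k0).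
have := sqr_ge0 (s - k%:R * a k).
nra.
Qed.

Lemma exists_sqrtn (n : nat) : (0 < n)%N ->
  exists2 m, (m.+1 ^ 2 <= n)%N & (n < m.+2 ^ 2)%N.
Proof.
move=> n0; have ex : exists m, (m.+1 ^ 2 <= n)%N by exists 0%N.
have bd m : (m.+1 ^ 2 <= n)%N -> (m <= n)%N.
  by rewrite expnS expn1 mulSn; lia.
case: (ex_maxnP ex bd) => m h1 h2; exists m => //.
by rewrite ltnNge; apply/negP => /h2; rewrite ltnn.
Qed.

(** Pythagoras one term at a time: each term is orthogonal to the sum of the earlier ones. This is
    the form in which martingale increments provide orthogonality. *)
Lemma Ex_sqr_sum (f : nat -> T -> R) C : (forall n, L2 (f n)) ->
  (forall n, Ex (fun x => f n x ^+ 2) <= C) ->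
  (forall n, Ex (fun x => (\sum_(i < n) f i x) * f n x) = 0) ->
  forall n, Ex (fun x => (\sum_(i < n) f i x) ^+ 2) <= n%:R * C.
Proof.
move=> f2 fC f0; elim=> [|n ih].
  under eq_Ex do rewrite big_ord0 expr0n.
  by rewrite Ex_cst mul0r.
have S2 : L2 (fun x => \sum_(i < n) f i x) by exact: L2_sum.
rewrite (@eq_Ex _ (fun x => ((\sum_(i < n) f i x) ^+ 2 +
  2 * ((\sum_(i < n) f i x) * f n x)) + f n x ^+ 2)); last first.
  by move=> x; rewrite big_ord_recr/=; ring.
rewrite ExD; [|apply: L1D; [exact: S2.2|apply: L1Z; exact: L2M]|exact: (f2 n).2].
rewrite ExD; [|exact: S2.2|apply: L1Z; exact: L2M].
rewrite ExZ; last exact: L2M.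
by rewrite f0 mulr0 addr0 -natr1 mulrDl mul1r lerD.
Qed.

(* Along the squares the averages have summable second moments, and so do the
   bounds on the increments between two consecutive squares. *)
Theorem orthogonal_slln (f : nat -> T -> R) C : (forall n, L2 (f n)) ->
  (forall n, Ex (fun x => f n x ^+ 2) <= C) ->
  (forall n, Ex (fun x => (\sum_(i < n) f i x) * f n x) = 0) ->
  {ae P, forall x, (fun n => n%:R^-1 * \sum_(i < n) f i x) @ \oo --> 0}.
Proof.
move=> f2 fC f0.
have C0 : 0 <= C by apply: le_trans (fC 0%N); apply: Ex_ge0 => x; exact: sqr_ge0.
pose q m := (m.+1 ^ 2)%N.
have qE m : (q m)%:R = m.+1%:R ^+ 2 :> R by rewrite /q natrX.
have m0 m : 0 < m.+1%:R :> R by rewrite ltr0n.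
pose a m x := m.+1%:R ^- 2 * \sum_(i < q m) f i x.
(* Consecutive squares differ by (m+2)^2 - (m+1)^2 = 2m+3, so [b m] bounds the change of the sums
   over all n between them. *)
pose b m x := m.+1%:R ^- 2 * \sum_(i < 2 * m + 3) `|f (q m + i)%N x|.
have a2 m : L2 (a m) by apply/L2Z/L2_sum.
have b2 m : L2 (b m).
  by apply/L2Z/(@L2_sum _ (fun i x => `|f (q m + i)%N x|)) => i _; exact: L2_norm.
have K1 N : \sum_(n < N) (C * n.+1%:R ^- 2) <= C * 2.
  by rewrite -mulr_sumr ler_wpM2l// sum_inv_squares_le2.
(* The factor 9 comes from (2m+3)^2 <= 9 (m+1)^2, where (2m+3)^2 is the Cauchy-Schwarz factor of a
   gap of length 2m+3. *)
have K2 N : \sum_(n < N) ((9 * C) * n.+1%:R ^- 2) <= (9 * C) * 2.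
  by rewrite -mulr_sumr ler_wpM2l ?mulr_ge0// sum_inv_squares_le2.
have ha := @ae_cvg0_of_sum_squares _ (fun n => C * n.+1%:R ^- 2) _ a2 ^~ K1.
have hb := @ae_cvg0_of_sum_squares _ (fun n => (9 * C) * n.+1%:R ^- 2) _ b2 ^~ K2.
have {}ha : {ae P, forall x, (fun n => a n x) @ \oo --> 0}.
  apply: ha => m; rewrite /a; under eq_Ex do rewrite exprMn.
  rewrite ExZ; last by have := L2_sum (n := q m) (fun i _ => f2 i); case.
  have := Ex_sqr_sum f2 fC f0 (q m); rewrite qE => h.
  apply: le_trans (ler_wpM2l _ h) _; first by rewrite exprn_ge0 ?invr_ge0 ?exprn_ge0.
  rewrite le_eqVlt; apply/orP; left; apply/eqP.
  by field; rewrite gt_eqF.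
have {}hb : {ae P, forall x, (fun n => b n x) @ \oo --> 0}.
  apply: hb => m; rewrite /b; under eq_Ex do rewrite exprMn.
  have S2 : L2 (fun x => \sum_(i < 2 * m + 3) `|f (q m + i)%N x|).
    by apply: (@L2_sum _ (fun i x => `|f (q m + i)%N x|)) => i _; exact: L2_norm.
  rewrite ExZ; last exact: S2.2.
  have h : Ex (fun x => (\sum_(i < 2 * m + 3) `|f (q m + i)%N x|) ^+ 2) <=
      (2 * m + 3)%:R * ((2 * m + 3)%:R * C).
    have L1f i : L1 (fun x => `|f (q m + i)%N x| ^+ 2) by case: (L2_norm (f2 (q m + i)%N)).
    apply: (@le_trans _ _ (Ex (fun x => (2 * m + 3)%:R *
        \sum_(i < 2 * m + 3) `|f (q m + i)%N x| ^+ 2))).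
      apply: le_Ex; [exact: S2.2| |].
        apply: L1Z; exact: (@L1_sum _ (fun i x => `|f (q m + i)%N x| ^+ 2)).
      by move=> x; exact: (sqr_sum_le _ (fun i => `|f (q m + i)%N x|)).
    rewrite ExZ; last exact: (@L1_sum _ (fun i x => `|f (q m + i)%N x| ^+ 2)).
    rewrite ler_wpM2l// (@Ex_sum _ (fun i x => `|f (q m + i)%N x| ^+ 2))//.
    rewrite -[in leRHS](card_ord (2 * m + 3)) mulr_natl -sumr_const ler_sum// => i _.
    under eq_Ex do rewrite real_normK ?num_real//.
    exact: fC.
  apply: le_trans (ler_wpM2l _ h) _; first by rewrite exprn_ge0 ?invr_ge0 ?exprn_ge0.
  have -> : (2 * m + 3)%:R = 2 * m.+1%:R + 1 :> R.
    by rewrite -natrM natr1; congr (_%:R); lia.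
  have := m0 m; have : 1 <= m.+1%:R :> R by rewrite ler1n.
  move: (m.+1%:R) => t t1 t0.
  rewrite -subr_ge0.
  have -> : 9 * C * t ^- 2 - (t ^- 2) ^+ 2 * ((2 * t + 1) * ((2 * t + 1) * C)) =
    C * (t ^- 2) ^+ 2 * ((9 * t ^+ 2) - (2 * t + 1) ^+ 2) by field; rewrite gt_eqF.
  apply: mulr_ge0; last by nra.
  by apply: mulr_ge0 => //; exact: sqr_ge0.
apply: filterS2 ha hb => x /cvgrPdist_lt ha /cvgrPdist_lt hb.
apply/cvgrPdist_lt => e e0.
have e2 : 0 < e / 2 by rewrite divr_gt0.
have [N1 _ h1] := ha _ e2; have [N2 _ h2] := hb _ e2.
exists ((maxn N1 N2).+2 ^ 2)%N => // n /= Nn.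
have n0 : (0 < n)%N by apply: leq_trans Nn; rewrite expn_gt0.
have [m mn nm] := exists_sqrtn n0.
have Nm : (maxn N1 N2 <= m)%N.
  have : ((maxn N1 N2).+2 ^ 2 < m.+2 ^ 2)%N by exact: leq_ltn_trans nm.
  by rewrite ltn_exp2r//; lia.
have {h1} := h1 m (leq_trans (leq_maxl _ _) Nm).
have {h2} := h2 m (leq_trans (leq_maxr _ _) Nm).
rewrite !sub0r !normrN => h2 h1.
rewrite normrM ger0_norm ?invr_ge0//.
have Sn : `|\sum_(i < n) f i x| <= `|\sum_(i < q m) f i x| +
    \sum_(i < 2 * m + 3) `|f (q m + i)%N x|.
  have -> : n = (q m + (n - q m))%N by rewrite subnKC.
  rewrite big_split_ord/=; apply: le_trans (ler_normD _ _) _; rewrite lerD2l.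
  apply: le_trans (ler_norm_sum _ _ _) _.
  have nq : (n - q m <= 2 * m + 3)%N.
    by move: mn nm; rewrite /q !expnS !expn0; lia.
  rewrite -(subnKC nq) [leRHS]big_split_ord/= lerDl.
  by apply: sumr_ge0.
apply: (@le_lt_trans _ _ (`|a m x| + `|b m x|)); last by lra.
rewrite /a /b !normrM !(@ger0_norm _ (_ ^- 2)) ?invr_ge0 ?exprn_ge0//.
rewrite (@ger0_norm _ (\sum_(i < 2 * m + 3) _)); last by apply: sumr_ge0.
rewrite -mulrDr ler_pM// ?invr_ge0//.
rewrite lef_pV2 ?posrE ?exprn_gt0 ?ltr0n// -qE ler_nat//.
Qed.

End SquareIntegrable.

(** * Exponential moments *)

Section ExponentialMoments.
Context d (T : measurableType d) (R : realType) (P : probability T R).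
Implicit Types (f g : T -> R).

(** The exponent is left existential, since the constructions below lower it. *)
Definition exp_moment f :=
  measurable_fun setT f /\ exists2 th : R, 0 < th & L1 P (fun x => expR (th * f x)).

Lemma measurable_expRM (th : R) f : measurable_fun setT f ->
  measurable_fun setT (fun x => expR (th * f x)).
Proof. by move=> mf; apply: measurableT_comp => //; exact: measurable_funM. Qed.

Lemma exp_moment_le_theta (th th' : R) f : measurable_fun setT f ->
  (forall x, 0 <= f x) -> th' <= th ->
  L1 P (fun x => expR (th * f x)) -> L1 P (fun x => expR (th' * f x)).
Proof.
move=> mf f0 th'th; apply: le_L1; first exact: measurable_expRM.
by move=> x; rewrite !ger0_norm ?expR_ge0// ler_expR ler_wpM2r.
Qed.

Lemma le_exp_moment f g : measurable_fun setT f -> (forall x, f x <= g x) ->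
  exp_moment g -> exp_moment f.
Proof.
move=> mf fg [mg [th th0 h]]; split=> //; exists th => //.
apply: le_L1 h; first exact: measurable_expRM.
by move=> x; rewrite !ger0_norm ?expR_ge0// ler_expR ler_wpM2l// ltW.
Qed.

(** No independence is assumed: exp(t(f+g)) is at most exp(2tf) + exp(2tg), by comparing f with g.
    This costs half of the exponent. *)
Lemma exp_momentD f g : (forall x, 0 <= f x) -> (forall x, 0 <= g x) ->
  exp_moment f -> exp_moment g -> exp_moment (fun x => f x + g x).
Proof.
move=> f0 g0 [mf [th th0 hf]] [mg [th' th'0 hg]].
split; first exact: measurable_funD.
pose t := Num.min th th' / 2.
have t0 : 0 < t by rewrite divr_gt0// lt_min th0.
exists t => //.
have hf' : L1 P (fun x => expR (2 * t * f x)).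
  apply: exp_moment_le_theta hf => //.
  by rewrite /t mulrC divfK// ge_min lexx.
have hg' : L1 P (fun x => expR (2 * t * g x)).
  apply: exp_moment_le_theta hg => //.
  by rewrite /t mulrC divfK// ge_min lexx orbT.
apply: le_L1 (L1D hf' hg'); first by apply: measurable_expRM; exact: measurable_funD.
move=> x; rewrite !ger0_norm ?addr_ge0 ?expR_ge0//.
have [fg|gf] := leP (f x) (g x).
  rewrite ler_wpDl ?expR_ge0// ler_expR -mulrA mulrCA ler_wpM2l ?(ltW t0)//; lra.
rewrite ler_wpDr ?expR_ge0// ler_expR -mulrA mulrCA ler_wpM2l ?(ltW t0)//; lra.
Qed.

(** From 1 + y <= exp(y) at y = th f/4 one gets f <= (4/th) exp(th f/4); raise this to the fourth
    power. The fourth moment is what puts the squares of the cycle lengths in [L2]. *)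
Lemma exp_moment_pow4 f : (forall x, 0 <= f x) -> exp_moment f ->
  L1 P (fun x => f x ^+ 4).
Proof.
move=> f0 [mf [th th0 h]].
apply: le_L1 (L1Z ((4 / th) ^+ 4) h); first exact: measurable_funX.
move=> x; rewrite normrX normrM !ger0_norm ?f0 ?expR_ge0 ?exprn_ge0 ?divr_ge0 ?(ltW th0)//.
have -> : th * f x = 4%:R * (th * f x / 4) by field.
rewrite expRM_natl -exprMn lerXn2r ?nnegrE ?f0 ?mulr_ge0 ?expR_ge0 ?invr_ge0 ?(ltW th0)//.
have h1 := expR_ge1Dx (th * f x / 4).
apply: (@le_trans _ _ (4 / th * (1 + th * f x / 4))); last by rewrite ler_wpM2l// divr_ge0// ltW.
rewrite mulrDr mulr1.
have -> : 4 / th * (th * f x / 4) = f x by field; rewrite gt_eqF.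
by rewrite lerDr divr_ge0// ltW.
Qed.

Lemma exp_moment_L2_sqr f : (forall x, 0 <= f x) -> exp_moment f ->
  L2 P (fun x => f x ^+ 2).
Proof.
move=> f0 ef; split; first by apply: measurable_funX; case: ef.
under eq_fun do rewrite -exprM.
exact: exp_moment_pow4.
Qed.

Lemma exp_moment_L2 f : (forall x, 0 <= f x) -> exp_moment f -> L2 P f.
Proof.
move=> f0 ef; split; first by case: ef.
exact/L2_L1/exp_moment_L2_sqr.
Qed.

Lemma geometric_sum_le (q : R) N : 0 <= q < 1 ->
  \sum_(i < N) q ^+ i <= (1 - q)^-1.
Proof.
move=> /andP[q0 q1]; have q1' : 0 < 1 - q by rewrite subr_gt0.
rewrite -(ler_pM2l q1') mulfV ?gt_eqF//.
have -> : (1 - q) * \sum_(i < N) q ^+ i = 1 - q ^+ N.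
  elim: N => [|N ih]; first by rewrite big_ord0 mulr0 expr0 subrr.
  by rewrite big_ord_recr/= mulrDr ih exprS; ring.
by rewrite gerBl exprn_ge0.
Qed.

(** A quantity governed by a random index N is bounded by a term of a series of nonnegative
    variables with summable expectations, whatever the law of N. The exponential moments of delays,
    cycle lengths and success gaps are obtained in this way. *)
Lemma L1_le_series (f : T -> R) (F : nat -> T -> R) (u : nat -> R) K :
  measurable_fun setT f -> (forall x, 0 <= f x) ->
  (forall n, L1 P (F n)) -> (forall n x, 0 <= F n x) ->
  (forall n, Ex P (F n) <= u n) -> (forall N, \sum_(n < N) u n <= K) ->
  {ae P, forall x, exists N, f x <= \sum_(n < N) F n x} ->
  L1 P f.
Proof.
move=> mf f0 F1 F0 Fu uK fF; apply: ge0_L1 => //.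
have mF n : measurable_fun setT (EFin \o F n) by exact/measurable_EFinP/L1_measurable.
apply: (@le_lt_trans _ _ (\int[P]_x (\sum_(n <oo) (F n x)%:E))%E); last first.
  rewrite integral_nneseries//; last by move=> n x _; rewrite lee_fin.
  apply: (@le_lt_trans _ _ K%:E); last exact: ltry.
  apply: lime_le.
    by apply: is_cvg_nneseries => n _ _; apply: integral_ge0 => x _; rewrite lee_fin.
  apply: nearW => N; rewrite big_mkord.
  rewrite (eq_bigr (fun n : 'I_N => (Ex P (F n))%:E)); last first.
    by move=> n _; rewrite -ExE.
  by rewrite sumEFin lee_fin (le_trans _ (uK N))// ler_sum.
apply: ae_ge0_le_integral => //.
- by move=> x _; rewrite lee_fin.
- exact/measurable_EFinP.
- by move=> x _; apply: nneseries_ge0 => n _ _; rewrite lee_fin.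
- by apply: ge0_emeasurable_sum => [n x _ _|n _]; [rewrite lee_fin|exact: mF].
apply: filterS fF => x [N fN] _.
apply: (@le_trans _ _ (\sum_(n < N) F n x)%:E); first by rewrite lee_fin.
rewrite -sumEFin -(big_mkord xpredT (fun n => (F n x)%:E)).
by apply: (@nneseries_lim_ge R (fun n => (F n x)%:E) xpredT 0 N) => n _ _; rewrite lee_fin.
Qed.

End ExponentialMoments.

Section ShiftedExponential.
Context d (T : measurableType d) (R : realType) (P : probability T R).
Variables (shift rate : R) (X : {RV P >-> R}).
Hypotheses (shift0 : 0 <= shift) (rate0 : 0 < rate).
Hypothesis lawX : shifted_exponential P shift rate X.

Lemma shifted_exponential_eq0 (y : R) : P (X @^-1` [set y]) = 0%E.
Proof.
rewrite lawX// /exponential_prob.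
have -> : (fun x => shift + x) @^-1` [set y] = [set y - shift].
  by apply/seteqP; split=> x /= => [<-|->]; ring.
exact: integral_set1.
Qed.

Lemma shifted_exponential_gt_shift : {ae P, forall x, shift < X x}.
Proof.
exists (X @^-1` `]-oo, shift]); split.
- by rewrite -[X in measurable X]setTI; exact: measurable_funPT.
- rewrite lawX// /exponential_prob.
  rewrite (_ : (_ @^-1` _) = `]-oo, 0%R]%classic); last first.
    by apply/seteqP; split=> x /=; rewrite !in_itv/=; lra.
  rewrite -integral_itv_bndo_bndc; last first.
    by apply: measurable_funTS; apply/measurable_EFinP; exact: measurable_exponential_pdf.
  apply: integral0_eq => x /=; rewrite in_itv/= => xs.
  by rewrite lt0_exponential_pdf//; lra.
- by move=> x /= /negP; rewrite -leNgt in_itv.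
Qed.

Lemma shifted_exponential_gt0 : {ae P, forall x, 0 < X x}.
Proof.
by apply: filterS shifted_exponential_gt_shift => x; exact: le_lt_trans.
Qed.

Lemma shifted_exponential_tail (x : R) : 0 <= x ->
  (P (X @^-1` `](shift + x)%R, +oo[) <= (expR (- rate * x))%:E)%E.
Proof.
rewrite le_eqVlt => /predU1P[<-|x0].
  by rewrite mulr0 expR0 probability_le1// -[X in measurable X]setTI; exact: measurable_funPT.
rewrite lawX//.
rewrite (_ : (_ @^-1` _) = `]x, +oo[%classic); last first.
  by apply/seteqP; split=> z /=; rewrite !in_itv/= !andbT ltrD2l.
rewrite /exponential_prob.
have pdf0 z : (0 <= (exponential_pdf rate z)%:E)%E.
  by rewrite lee_fin exponential_pdf_ge0// ltW.
have mpdf (A : set R) : measurable_fun A (fun z => (exponential_pdf rate z)%:E).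
  by apply: measurable_funTS; apply/measurable_EFinP; exact: measurable_exponential_pdf.
have : (\int[lebesgue_measure]_(z in `[0%R, x] `|` `]x, +oo[) (exponential_pdf rate z)%:E <= 1)%E.
  by rewrite -(integral_exponential_pdf rate0); apply: ge0_subset_integral => //;
    (exact: mpdf || exact: measurableU).
rewrite ge0_integral_setU//; last 2 first.
- exact: mpdf.
- apply/disj_setPS => z [/=]; rewrite !in_itv/= andbT => /andP[_ zx] xz.
  by move: (lt_le_trans xz zx); rewrite ltxx.
have := @exponential_prob_itv0c _ rate x x0.
rewrite /exponential_prob => ->.
rewrite [in X in _ -> X](_ : expR (- rate * x) = 1 - (1 - expR (- rate * x))); last by ring.
by rewrite EFinB leeBrDl // EFinB.
Qed.

(** Slice by integer distance from the shift: on the slice above n the exponential is at most exp(th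
    (shift + n + 1)), the tail is at most exp(-rate n), and th = rate/2 leaves a geometric series of
    ratio exp(-th). *)
Lemma shifted_exponential_exp_moment :
  exp_moment P (X : T -> R).
Proof.
split; first exact: measurable_funPT.
pose th := rate / 2; have th0 : 0 < th by rewrite divr_gt0.
exists th => //.
pose q := expR (- th).
have q1 : 0 <= q < 1 by rewrite expR_ge0 -expR0 ltr_expR oppr_lt0.
pose F (n : nat) x := expR (th * (shift + n.+1%:R)) * \1_(X @^-1` `]shift + n%:R, +oo[) x.
have mX n : measurable (X @^-1` `]shift + n%:R, +oo[).
  by rewrite -[X in measurable X]setTI; exact: measurable_funPT.
have F1 n : L1 P (F n).
  by apply: L1Z; apply: integrable_indic => //; rewrite (le_lt_trans (probability_le1 _ _)) ?ltry.
apply: (@L1_le_series _ _ _ _ _ F (fun n => expR (th * (shift + 1)) * q ^+ n)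
   (expR (th * (shift + 1)) * (1 - q)^-1)) => //.
- apply: measurable_expRM; exact: measurable_funPT.
- by move=> n x; rewrite mulr_ge0 ?expR_ge0// indicE ler0n.
- move=> n; rewrite /F ExZ; last first.
    by apply: integrable_indic => //; rewrite (le_lt_trans (probability_le1 _ _)) ?ltry.
  have : Ex P (\1_(X @^-1` `]shift + n%:R, +oo[)) <= expR (- rate * n%:R).
    rewrite -lee_fin -ExE; last first.
      by apply: integrable_indic => //; rewrite (le_lt_trans (probability_le1 _ _)) ?ltry.
    by rewrite integral_indic// setIT shifted_exponential_tail.
  move/(ler_wpM2l (expR_ge0 (th * (shift + n.+1%:R)))) => /le_trans; apply.
  rewrite /q -expRM_natl -!expRD ler_expR -natr1 /th le_eqVlt; apply/orP; left.
  by apply/eqP; field.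
- by move=> N; rewrite -mulr_sumr ler_wpM2l ?expR_ge0// geometric_sum_le.
apply: filterS shifted_exponential_gt_shift => x Xs.
pose m := Num.truncn (X x - shift).
have /andP[Xm Xm1] : m%:R <= X x - shift < m.+1%:R.
  by apply: truncn_itv; rewrite subr_ge0 ltW.
(* The events in [F] are open on the left, so when [X x - shift] is itself an integer the slice
   below is used. *)
pose m' := if m%:R < X x - shift then m else m.-1.
have [m'1 m'2] : m'%:R < X x - shift /\ X x - shift <= m'.+1%:R.
  rewrite /m'; case: ifPn => [h|]; first by split => //; exact: ltW.
  rewrite -leNgt => h; have {h} Xe : X x - shift = m%:R by apply/eqP; rewrite eq_le h.
  case: m Xe {Xm Xm1 m'} => [|m] Xe /=; first by move: Xs; lra.
  by rewrite Xe ltr_nat; split.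
exists m'.+1; rewrite big_ord_recr/=.
apply: (@le_trans _ _ (F m' x)); last by rewrite lerDr sumr_ge0// => i _;
  rewrite mulr_ge0 ?expR_ge0// indicE ler0n.
rewrite /F indicE mem_set ?mulr1 /=; last by rewrite in_itv/= andbT; lra.
by rewrite ler_expR ler_wpM2l ?(ltW th0)// -lerBlDl.
Qed.

End ShiftedExponential.

(** * Order statistics and index enumerations *)

Section OrderStatistics.
Context (R : realType) (n : nat).
Implicit Types (x : 'I_n -> R) (i k : nat).

Lemma size_sort_codom x : size (sort <=%R (codom x)) = n.
Proof. by rewrite size_sort size_codom card_ord. Qed.

Lemma sorted_sort_codom x : sorted <=%R (sort <=%R (codom x)).
Proof. by apply: sort_sorted; exact: le_total. Qed.

Lemma order_stat_mem i x : (0 < i <= n)%N -> exists c, order_stat i x = x c.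
Proof.
case: i => // i /= ilen.
have : nth 0 (sort <=%R (codom x)) i \in codom x.
  by rewrite -(mem_sort <=%R) mem_nth// size_sort_codom.
by move=> /codomP[c h]; exists c.
Qed.

Lemma order_stat_ge0 i x : (forall c, 0 <= x c) -> 0 <= order_stat i x.
Proof.
move=> x0; rewrite /order_stat; have [h|h] := ltnP i.-1 n; last first.
  by rewrite nth_default// size_sort_codom.
have : nth 0 (sort <=%R (codom x)) i.-1 \in codom x.
  by rewrite -(mem_sort <=%R) mem_nth// size_sort_codom.
by move=> /codomP[c ->].
Qed.

Lemma order_stat_le_sum i x : (forall c, 0 <= x c) ->
  order_stat i x <= \sum_(c < n) x c.
Proof.
move=> x0; rewrite /order_stat; have [h|h] := ltnP i.-1 n; last first.
  by rewrite nth_default ?size_sort_codom// sumr_ge0.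
have : nth 0 (sort <=%R (codom x)) i.-1 \in codom x.
  by rewrite -(mem_sort <=%R) mem_nth// size_sort_codom.
by move=> /codomP[c ->]; rewrite (bigD1 c)//= lerDl sumr_ge0.
Qed.

Lemma order_stat_perm i x (s : 'I_n -> 'I_n) : bijective s ->
  order_stat i (x \o s) = order_stat i x.
Proof.
move=> [t st ts]; rewrite /order_stat; congr nth.
apply/perm_sortP; [exact: le_total|exact: le_trans|exact: le_anti|].
rewrite /codom /image_mem map_comp; apply: perm_map.
have sinj : injective s := can_inj st.
have ue : uniq (enum 'I_n) by exact: enum_uniq.
apply: uniq_perm; [by rewrite map_inj_uniq|by []|move=> c].
rewrite mem_enum; apply/mapP; exists (t c); first by rewrite mem_enum.
by rewrite ts.
Qed.

Lemma sorted_nth_le_count (s : seq R) i (t : R) : sorted <=%R s -> (i < size s)%N ->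
  (nth 0 s i <= t) = (i < count (fun y => (y <= t)%R) s)%N.
Proof.
elim: s i => // y s ih [|i] /= ys.
  move=> _.
  case: (boolP (y <= t)) => //= yt; apply/esym/negbTE; rewrite -eqn0Ngt.
  rewrite add0n -leqn0 leqNgt -has_count; apply/hasPn => z zs.
  rewrite -ltNge; rewrite -ltNge in yt; apply: lt_le_trans yt _.
  by move: ys; rewrite (path_sortedE le_trans) => /andP[/allP/(_ _ zs)].
rewrite ltnS => ilt; rewrite ih//; last exact: path_sorted ys.
case: (boolP (y <= t)) => [_|yt]; first by rewrite add1n.
have -> : count (fun y => (y <= t)%R) s = 0%N.
  apply/eqP; rewrite -leqn0 leqNgt -has_count; apply/hasPn => z zs.
  rewrite -ltNge; rewrite -ltNge in yt; apply: lt_le_trans yt _.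
  by move: ys; rewrite (path_sortedE le_trans) => /andP[/allP/(_ _ zs)].
by rewrite !ltn0.
Qed.

(** Turns a statement about sorting into one about counting; the count is a finite sum of
    indicators, from which measurability follows. *)
Lemma order_stat_le i x t : (0 < i <= n)%N ->
  (order_stat i x <= t) = (i <= #|[pred c | (x c <= t)%R]|)%N.
Proof.
case: i => // i /= ilen.
rewrite /order_stat/= sorted_nth_le_count ?sorted_sort_codom ?size_sort_codom//.
rewrite count_sort /codom /image_mem count_map -sum1_count -sum1_card.
by rewrite big_enum_cond.
Qed.

Lemma filter_sorted_take (s : seq R) k : sorted <=%R s -> uniq s -> (0 < k <= size s)%N ->
  [seq y <- s | y <= nth 0 s k.-1] = take k s.
Proof.
case: k => // k; elim: s k => // y s ih k /= ys /andP[ynots us].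
rewrite ltnS => ks.
have yle z : z \in s -> y < z.
  move=> zs; rewrite lt_neqAle; apply/andP; split.
    by apply: contraNneq ynots => ->.
  by move: ys; rewrite (path_sortedE le_trans) => /andP[/allP/(_ _ zs)].
case: k ks => [|k] ks /=.
  rewrite lexx take0; congr cons; apply/eqP; rewrite -size_eq0 size_filter.
  rewrite -leqn0 leqNgt -has_count; apply/hasPn => z zs.
  by rewrite -ltNge; exact: yle.
rewrite ih//; last exact: path_sorted ys.
by rewrite ifT//; apply/ltW/yle/mem_nth.
Qed.

(** Injectivity of x excludes ties at the k-th smallest value, which would give the left-hand side
    extra terms. *)
Lemma sum_le_order_stat (f : R -> R) k x : injective x -> (0 < k <= n)%N ->
  \sum_(c < n | x c <= order_stat k x) f (x c) = \sum_(1 <= i < k.+1) f (order_stat i x).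
Proof.
move=> injx kn; pose s := sort <=%R (codom x).
have us : uniq s by rewrite sort_uniq; apply/injectiveP.
transitivity (\sum_(y <- s | y <= order_stat k x) f y).
  rewrite (perm_big _ (permEl (perm_sort _ _)))/= /codom /image_mem big_map.
  by rewrite big_enum_cond.
rewrite -big_filter /order_stat filter_sorted_take ?sorted_sort_codom ?size_sort_codom//.
rewrite (big_nth 0) size_takel ?size_sort_codom; last by case/andP: kn.
rewrite big_add1/= big_nat [RHS]big_nat; apply: eq_bigr => i /andP[_ ik].
by rewrite nth_take.
Qed.

Lemma measurable_order_stat d (T : measurableType d) i (x : 'I_n -> T -> R) :
  (forall c, measurable_fun setT (x c)) ->
  measurable_fun setT (fun w => order_stat i (fun c => x c w)).
Proof.
(* Indices beyond n read the default 0 of [nth]. *)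
move=> mx; have [ni|ilen] := leqP n i.-1.
  rewrite (_ : (fun w => _) = fun=> 0); last first.
    by apply/funext => w; rewrite /order_stat nth_default// size_sort_codom.
  exact: measurable_cst.
rewrite (_ : (fun w => _) = (fun w => order_stat i.-1.+1 (fun c => x c w)))//.
move: i.-1 ilen => {}i ilen; pose N t w := \sum_(c < n) (if x c w <= t then 1 else 0 : R).
have mN t : measurable_fun setT (N t).
  apply: measurable_sum => c; apply: measurable_fun_ifT => //.
  by apply: measurable_fun_ler.
apply: (@measurability _ _ T R setT _ _ (RGenOInfty.measurableE R)) => _ [_ [t ->] <-].
have NE w : (i.+1%:R <= N t w) = (order_stat i.+1 (x ^~ w) <= t).
  have -> : N t w = #|[pred c | x c w <= t]|%:R.
    by rewrite /N -big_mkcond/= -sum1_card natr_sum.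
  by rewrite ler_nat order_stat_le.
have -> : [set: T] `&` (fun w => order_stat i.+1 (x ^~ w)) @^-1` `]t, +oo[ =
    (fun w => N t w < i.+1%:R) @^-1` [set true].
  apply/seteqP; split=> w /=; rewrite in_itv/= andbT [(t < _)%R]ltNge -NE -ltNge.
    by case.
  by [].
rewrite -[X in measurable X]setTI.
by apply: (@measurable_fun_ltr _ _ R setT (N t) (fun=> i.+1%:R)).
Qed.

End OrderStatistics.

Section Indices.
Implicit Types (p q : pred nat) (i j m : nat).

Lemma next_index_ge p j : (j <= next_index p j)%N.
Proof.
rewrite /next_index; case: pselect => //= h.
by case: ex_minnP => i /andP[].
Qed.

Lemma next_index_eq p j i : (j <= i)%N -> p i ->
  (forall l, (j <= l < i)%N -> ~~ p l) -> next_index p j = i.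
Proof.
move=> ji pi pl; rewrite /next_index; case: pselect => [h|[]]; last first.
  by exists i; rewrite ji.
case: ex_minnP => l /andP[jl pl'] /(_ i); rewrite ji pi => /(_ isT) li.
apply/eqP; rewrite eqn_leq li leqNgt; apply/negP => li'.
by have := pl l; rewrite jl li' pl' => /(_ isT).
Qed.

Lemma next_indexP p j : (exists i, (j <= i)%N && p i) ->
  [/\ (j <= next_index p j)%N, p (next_index p j) &
      forall l, (j <= l < next_index p j)%N -> ~~ p l].
Proof.
move=> h; rewrite /next_index; case: pselect => //= h'.
case: ex_minnP => i /andP[ji pi] le; split=> // l /andP[jl li].
by apply/negP => pl; have := le l; rewrite jl pl leqNgt li => /(_ isT).
Qed.

Lemma next_index_none p j : ~ (exists i, (j <= i)%N && p i) -> next_index p j = j.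
Proof. by move=> h; rewrite /next_index; case: pselect. Qed.

(** Translation invariance of the search, including the case where nothing is found and both sides
    fall back to their starting index. It is what makes the accepted updates regenerate. *)
Lemma next_index_shift p a j :
  next_index p (a + j) = (a + next_index (fun i => p (a + i)%N) j)%N.
Proof.
have [h|h] := pselect (exists i, (j <= i)%N && p (a + i)%N).
  have [h1 h2 h3] := next_indexP h.
  apply: next_index_eq => //; first by rewrite leq_add2l.
  move=> l /andP[l1 l2]; have al : (a <= l)%N by apply: leq_trans l1; rewrite leq_addr.
  rewrite -(subnKC al); apply: h3; rewrite -(leq_add2l a) subnKC// l1/=.
  by rewrite -(ltn_add2l a) subnKC.
rewrite next_index_none ?next_index_none// => -[i /andP[ai pi]]; apply: h.
have al : (a <= i)%N by apply: leq_trans ai; rewrite leq_addr.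
by exists (i - a)%N; rewrite subnKC// pi andbT -(leq_add2l a) subnKC.
Qed.

Lemma eq_next_index p q j : p =1 q -> next_index p j = next_index q j.
Proof. by move=> /funext ->. Qed.

Definition count_before p j := (\sum_(i < j) p i)%N.

Lemma count_beforeS p j : count_before p j.+1 = (count_before p j + p j)%N.
Proof. by rewrite /count_before big_ord_recr. Qed.

Lemma count_before_mono p i j : (i <= j)%N -> (count_before p i <= count_before p j)%N.
Proof.
move=> ij; rewrite -(subnKC ij) /count_before big_split_ord/=.
exact: leq_addr.
Qed.

Lemma count_before_const p i j : (i <= j)%N -> (forall l, (i <= l < j)%N -> ~~ p l) ->
  count_before p j = count_before p i.
Proof.
move=> ij h; rewrite -(subnKC ij) /count_before big_split_ord/=.
rewrite [X in (_ + X)%N]big1 ?addn0// => l _.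
apply/eqP; rewrite eqb0; apply: h; rewrite leq_addr/= -ltn_subRL.
by rewrite ltn_ord.
Qed.

Lemma nth_indexP p m : (forall j, exists2 i, (j <= i)%N & p i) ->
  p (Defs.nth_index p m) /\ count_before p (Defs.nth_index p m) = m.
Proof.
move=> h; have ex j : exists i, (j <= i)%N && p i.
  by have [i ji pi] := h j; exists i; rewrite ji.
elim: m => [|m [ih1 ih2]] /=.
  have [_ h2 h3] := next_indexP (ex 0%N); split=> //.
  by rewrite (count_before_const (leq0n _) h3) /count_before big_ord0.
have [h1 h2 h3] := next_indexP (ex (Defs.nth_index p m).+1); split=> //.
by rewrite (count_before_const h1 h3) count_beforeS ih1 ih2 addn1.
Qed.

(** Splits the event that the m-th success occurs at j into a success at j and m successes before j;
    the second condition is decided by the earlier indices alone. *)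
Lemma nth_index_eq p m j : (forall j, exists2 i, (j <= i)%N & p i) ->
  (Defs.nth_index p m == j) = p j && (count_before p j == m).
Proof.
move=> h; have [h1 h2] := nth_indexP m h.
apply/eqP/andP => [<-|[pj /eqP cj]]; first by rewrite h1 h2.
case: (ltngtP (Defs.nth_index p m) j) => // lt.
  have := count_before_mono p lt; rewrite count_beforeS h1 h2 cj addn1.
  by rewrite ltnn.
have := count_before_mono p lt; rewrite count_beforeS pj h2 cj addn1.
by rewrite ltnn.
Qed.

Lemma nth_index_ltS p m : (Defs.nth_index p m < Defs.nth_index p m.+1)%N.
Proof. exact: next_index_ge. Qed.

Lemma nth_index_lt p m m' : (m < m')%N -> (Defs.nth_index p m < Defs.nth_index p m')%N.
Proof.
elim: m' => // m' ih; rewrite ltnS leq_eqVlt => /predU1P[->|/ih h].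
  exact: nth_index_ltS.
exact: ltn_trans h (nth_index_ltS p m').
Qed.

Section Measurability.
Context d (T : measurableType d).

Lemma measurable_fun_nat (N : T -> nat) :
  (forall m, measurable (N @^-1` [set m])) -> measurable_fun setT N.
Proof.
move=> h _ B _; rewrite setTI.
have -> : N @^-1` B = \bigcup_(m in B) N @^-1` [set m].
  by apply/seteqP; split=> x /=; [move=> Bx; exists (N x)|move=> [m Bm /= ->]].
by apply: bigcup_measurable => m _; exact: h.
Qed.

Lemma measurable_preimage_nat (N : T -> nat) m :
  measurable_fun setT N -> measurable (N @^-1` [set m]).
Proof. by move=> mN; rewrite -[X in measurable X]setTI; exact: mN. Qed.

Lemma measurable_preimage_bool (b : T -> bool) :
  measurable_fun setT b -> measurable [set x | b x].
Proof.
move=> mb; have -> : [set x | b x] = b @^-1` [set true] by [].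
by rewrite -[X in measurable X]setTI; exact: mb.
Qed.

Lemma measurable_countable_case d' (U : measurableType d') (N : T -> nat)
    (f : nat -> T -> U) :
  measurable_fun setT N -> (forall m, measurable_fun setT (f m)) ->
  measurable_fun setT (fun x => f (N x) x).
Proof.
move=> mN mf _ B mB; rewrite setTI.
have -> : (fun x => f (N x) x) @^-1` B =
    \bigcup_m (N @^-1` [set m] `&` f m @^-1` B).
  apply/seteqP; split=> x /=; first by move=> Bx; exists (N x).
  by move=> [m _ /= [-> ]].
apply: bigcup_measurable => m _; apply: measurableI.
  exact: measurable_preimage_nat.
by rewrite -[X in measurable X]setTI; exact: mf.
Qed.

Lemma measurable_next_index (p : T -> pred nat) j :
  (forall i, measurable_fun setT (fun x => p x i)) ->
  measurable_fun setT (fun x => next_index (p x) j).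
Proof.
move=> mp.
have mlt m : m != j -> measurable ((fun x => next_index (p x) j) @^-1` [set m]).
  move=> mj; have [jm|mj'] := leqP j m; last first.
    rewrite (_ : _ @^-1` _ = set0)//; apply/seteqP; split=> // x /= h.
    by have := next_index_ge (p x) j; rewrite h leqNgt mj'.
  rewrite (_ : _ @^-1` _ = [set x | p x m] `&`
      \bigcap_(l in [set l | (j <= l < m)%N]) ~` [set x | p x l]).
    apply: measurableI; first exact: measurable_preimage_bool.
    by apply: bigcap_measurableType => l _; apply: measurableC; exact: measurable_preimage_bool.
  apply/seteqP; split=> x /=.
    move=> hx; have [h|/next_index_none] := pselect (exists i, (j <= i)%N && p x i).
      have [_ h2 h3] := next_indexP h; rewrite hx in h2 h3.
      by split=> // l /= /h3 /negP.
    by rewrite hx => mj''; rewrite mj'' eqxx in mj.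
  by move=> [h1 h2]; apply: next_index_eq => // l /h2 /negP.
apply: measurable_fun_nat => m; have [->|] := eqVneq m j; last exact: mlt.
(* The value j is ambiguous, being also the default of a failed search; its preimage is obtained as
   the complement of those of all other values. *)
have -> : (fun x => next_index (p x) j) @^-1` [set j] =
   ~` \bigcup_(m in [set m | m != j]) (fun x => next_index (p x) j) @^-1` [set m].
  apply/seteqP; split=> x /=; first by move=> hx [m' /= m'j]; rewrite hx => /esym/eqP; apply/negP.
  by move=> h; apply: contrapT => hj; apply: h; exists (next_index (p x) j) => //=; exact/eqP.
apply: measurableC; apply: bigcup_measurable => m' /= m'j; exact: mlt.
Qed.

Lemma measurable_next_index_comp (p : T -> pred nat) (J : T -> nat) :
  (forall i, measurable_fun setT (fun x => p x i)) -> measurable_fun setT J ->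
  measurable_fun setT (fun x => next_index (p x) (J x)).
Proof.
move=> mp mJ.
by apply: (measurable_countable_case (f := fun j x => next_index (p x) j)) => // m;
  exact: measurable_next_index.
Qed.

Lemma measurable_nth_index (p : T -> pred nat) m :
  (forall i, measurable_fun setT (fun x => p x i)) ->
  measurable_fun setT (fun x => Defs.nth_index (p x) m).
Proof.
move=> mp; elim: m => [|m ih] /=; first exact: measurable_next_index.
apply: (measurable_next_index_comp (J := fun x => (Defs.nth_index (p x) m).+1)) => //.
exact: (measurableT_comp (f := S) _ ih).
Qed.

Lemma measurable_count_before (p : T -> pred nat) j :
  (forall i, measurable_fun setT (fun x => p x i)) ->
  measurable_fun setT (fun x => count_before (p x) j).
Proof.
move=> mp; elim: j => [|j ih].
  by under eq_fun do rewrite /count_before big_ord0; exact: measurable_cst.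
under eq_fun do rewrite count_beforeS.
apply: (measurable_countable_case (f := fun c x => (c + p x j)%N)) => // c.
by apply: (measurableT_comp (f := fun b : bool => (c + b)%N) _ (mp j)).
Qed.

End Measurability.

End Indices.

(** * Service cycles *)

Section Sample.
Context d (T : measurableType d) (R : realType) (P : probability T R).
Variables (n : nat) (k : nat -> nat).
Variable X : node n -> nat -> 'I_n -> {RV P >-> R}.
Variable G : node n -> nat -> {RV P >-> R}.
Implicit Types (v p : node n) (w : T) (j a b : nat).

Local Notation service := (service k X).
Local Notation arrival := (arrival G).
Local Notation accepted := (accepted k X G).
Local Notation served := (served k X G).
Local Notation waiting := (waiting k X G).
Local Notation cycle_length := (cycle_length k X G).

Lemma service_ge0 v j w : (forall c, 0 <= X v j c w) -> 0 <= service v j w.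
Proof. by move=> X0; exact: order_stat_ge0. Qed.

Lemma arrivalS v a w : arrival v a.+1 w = arrival v a w + G v a w.
Proof. by rewrite /Defs.arrival big_ord_recr. Qed.

Lemma le_arrival v a b w : (forall i, 0 <= G v i w) -> (a <= b)%N ->
  arrival v a w <= arrival v b w.
Proof.
move=> G0 ab; rewrite -(subnKC ab) /Defs.arrival big_split_ord/= lerDl.
by apply: sumr_ge0.
Qed.

Lemma accepted_ltS v w j : (accepted v w j < accepted v w j.+1)%N.
Proof. exact: next_index_ge. Qed.

Lemma served_ltS v w j : (served v j w < served v j.+1 w)%N.
Proof. by case: v => [|c v] /=; [|exact: (accepted_ltS (c :: v))]. Qed.

Lemma served_lt v w i j : (i < j)%N -> (served v i w < served v j w)%N.
Proof.
elim: j => // j ih; rewrite ltnS leq_eqVlt => /predU1P[->|/ih h].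
  exact: served_ltS.
exact: ltn_trans h (served_ltS v w j).
Qed.

Lemma cycle_length_root j w : cycle_length [::] j w = service [::] j w.
Proof. by rewrite /Defs.cycle_length /= addr0. Qed.

Lemma cycle_lengthE v j w : v != [::] ->
  cycle_length v j w = arrival v (served v j.+1 w) w - arrival v (served v j w) w.
Proof. by case: v => // c v _; rewrite /Defs.cycle_length /Defs.waiting; ring. Qed.

Lemma cycle_length_ge0 v j w : (forall j c, 0 <= X v j c w) ->
  (forall i, 0 <= G v i w) -> 0 <= cycle_length v j w.
Proof.
move=> X0 G0; have [v0|v0] := eqVneq v [::].
  by rewrite v0 cycle_length_root -v0 service_ge0.
rewrite cycle_lengthE// subr_ge0 le_arrival//.
exact/ltnW/served_ltS.
Qed.

(** Ensures that the search defining [accepted] succeeds, so that the default value of [next_index]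
    does not occur. It is vacuous at the root, which has no arrivals. *)
Definition unbounded_arrivals v w :=
  v != [::] -> forall K : R, exists b, K <= arrival v b w.

Lemma acceptedP v j w : v != [::] -> (forall i, 0 <= G v i w) ->
  unbounded_arrivals v w ->
  arrival v (accepted v w j) w + service v j w <= arrival v (accepted v w j.+1) w /\
  (forall b, (accepted v w j < b < accepted v w j.+1)%N ->
    arrival v b w < arrival v (accepted v w j) w + service v j w).
Proof.
move=> v0 G0 /(_ v0) unb.
have ex : exists b, (accepted v w j < b)%N &&
    (arrival v (accepted v w j) w + service v j w <= arrival v b w).
  have [b bK] := unb (arrival v (accepted v w j) w + service v j w).
  exists (maxn b (accepted v w j).+1); rewrite leq_maxr/=.
  by apply: le_trans bK _; apply: le_arrival => //; rewrite leq_maxl.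
have [h1 h2 h3] := next_indexP ex; split=> // b bb.
by rewrite ltNge; exact: h3.
Qed.

Lemma waiting_ge0 v j w : (forall i, 0 <= G v i w) ->
  unbounded_arrivals v w -> 0 <= waiting v j w.
Proof.
move=> G0 unb; case: v G0 unb => // c v G0 unb.
by rewrite /Defs.waiting subr_ge0; have [] := @acceptedP (c :: v) j w isT G0 unb.
Qed.

Lemma service_le_cycle_length v j w : (forall i, 0 <= G v i w) ->
  unbounded_arrivals v w -> service v j w <= cycle_length v j w.
Proof. by move=> G0 unb; rewrite /Defs.cycle_length lerDl waiting_ge0. Qed.

Definition same_history v j a w w' :=
  (forall i c, (i < j)%N -> X v i c w = X v i c w') /\
  (v != [::] -> forall b, (b < a)%N -> G v b w = G v b w').

Lemma same_historyW v j a j' a' w w' : (j' <= j)%N -> (a' <= a)%N ->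
  same_history v j a w w' -> same_history v j' a' w w'.
Proof.
move=> jj aa [h1 h2]; split=> [i c ij|v0 b ba]; first exact/h1/(leq_trans ij).
exact/h2/(leq_trans ba).
Qed.

Lemma eq_delay_stat v j j' i w w' : (forall c, X v j c w = X v j' c w') ->
  delay_stat X v j i w = delay_stat X v j' i w'.
Proof. by rewrite /Defs.delay_stat => /funext ->. Qed.

Lemma eq_arrival v a w w' : (forall b, (b < a)%N -> G v b w = G v b w') ->
  arrival v a w = arrival v a w'.
Proof. by move=> h; apply: eq_bigr => i _; exact: h. Qed.

(** Stopping property: whether update a is served in cycle j is decided by the link delays of the
    earlier cycles and the first a interarrival times. Only w is assumed to have unbounded arrivals;
    the index found for w is then exhibited for w'. *)
Lemma accepted_history v j w w' : v != [::] -> (forall i, 0 <= G v i w) ->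
  unbounded_arrivals v w ->
  same_history v j (accepted v w j) w w' -> accepted v w' j = accepted v w j.
Proof.
move=> v0 G0 unb; elim: j => // j ih h.
have ihj : accepted v w' j = accepted v w j.
  by apply: ih; apply: same_historyW h => //; exact/ltnW/accepted_ltS.
have [h1 h2] := acceptedP j v0 G0 unb.
have sE : service v j w' = service v j w.
  by apply/esym/eq_delay_stat => c; exact: h.1.
have aE b : (b <= accepted v w j.+1)%N -> arrival v b w' = arrival v b w.
  by move=> ba; apply/esym/eq_arrival => i ib; apply: h.2 => //; exact: leq_trans ba.
rewrite [LHS]/= ihj; apply: next_index_eq.
- exact: accepted_ltS.
- by rewrite sE !aE// ltnW// accepted_ltS.
move=> b /andP[b1 b2]; rewrite -ltNge sE !aE; [|by rewrite ltnW// accepted_ltS|by rewrite ltnW].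
by apply: h2; rewrite b1.
Qed.

Lemma served_history v j w w' : (forall i, 0 <= G v i w) ->
  unbounded_arrivals v w ->
  same_history v j (served v j w) w w' -> served v j w' = served v j w.
Proof. by case: v => // c v G0 unb h; exact: accepted_history. Qed.

Lemma cycle_length_history v j w w' : (forall i, 0 <= G v i w) ->
  unbounded_arrivals v w ->
  same_history v j.+1 (served v j.+1 w) w w' ->
  cycle_length v j w' = cycle_length v j w.
Proof.
move=> G0 unb h; have sE : service v j w' = service v j w.
  by apply/esym/eq_delay_stat => c; exact: h.1.
have [v0|v0] := eqVneq v [::]; first by rewrite v0 !cycle_length_root -v0.
have h' : same_history v j (served v j w) w w'.
  by apply: same_historyW h => //; exact/ltnW/served_ltS.
rewrite !cycle_lengthE// !(@served_history v _ w w')//.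
have aE b : (b <= served v j.+1 w)%N -> arrival v b w' = arrival v b w.
  by move=> ba; apply/esym/eq_arrival => i ib; apply: h.2 => //; exact: leq_trans ba.
by rewrite !aE//; exact/ltnW/served_ltS.
Qed.

(** Waiting times see arrivals only through differences, so moving the origin to the update served
    in cycle j turns cycle j into cycle 0. This is the pathwise form of regeneration. *)
Lemma cycle_length_shift v j w w' :
  service v 0%N w' = service v j w ->
  (v != [::] -> forall b, G v b w' = G v (served v j w + b)%N w) ->
  cycle_length v 0%N w' = cycle_length v j w.
Proof.
move=> sE hG.
have [v0|v0] := eqVneq v [::]; first by rewrite v0 !cycle_length_root -v0.
move: (hG v0) => {}hG.
have aE b : arrival v b w' = arrival v (served v j w + b) w - arrival v (served v j w) w.
  rewrite /Defs.arrival big_split_ord/= addrAC subrr add0r.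
  by apply: eq_bigr => i _; rewrite hG.
have servedE : (served v j w + served v 1 w')%N = served v j.+1 w.
  case: v v0 sE hG aE => // c v _ sE hG aE /=.
  rewrite sE -[in RHS]addn1 next_index_shift; congr addn.
  apply: eq_next_index => b; rewrite !aE addn0 subrr add0r.
  by rewrite lerBrDl.
rewrite !cycle_lengthE// !aE -servedE.
have -> : served v 0 w' = 0%N by case: v v0 {sE hG aE servedE}.
by rewrite addn0 subrr subr0.
Qed.

End Sample.

Section SampleMeasurability.
Context d (T : measurableType d) (R : realType) (P : probability T R).
Variables (n : nat) (k : nat -> nat).
Variable X : node n -> nat -> 'I_n -> {RV P >-> R}.
Variable G : node n -> nat -> {RV P >-> R}.
Implicit Types (v p : node n) (w : T) (j a b : nat).

Lemma measurable_delay v j c : measurable_fun setT (X v j c : T -> R).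
Proof. exact: measurable_funPT. Qed.

Lemma measurable_delay_stat v j i : measurable_fun setT (delay_stat X v j i).
Proof. by apply: measurable_order_stat => c; exact: measurable_delay. Qed.

Lemma measurable_arrival v a : measurable_fun setT (arrival G v a).
Proof. by apply: measurable_sum => i; exact: measurable_funPT. Qed.

Lemma measurable_accepted v j : measurable_fun setT (fun w => accepted k X G v w j).
Proof.
elim: j => [|j ih] /=; first exact: measurable_cst.
pose p a w b := arrival G v a w + service k X v j w <= arrival G v b w.
apply: (measurable_countable_case (f := fun a w => next_index (p a w) a.+1)) => // a.
apply: measurable_next_index => b; apply: measurable_fun_ler.
  by apply: measurable_funD; [exact: measurable_arrival|exact: measurable_delay_stat].
exact: measurable_arrival.
Qed.

Lemma measurable_served v j : measurable_fun setT (served k X G v j).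
Proof. by case: v => [|c v]; [exact: measurable_cst|exact: measurable_accepted]. Qed.

Lemma measurable_waiting v j : measurable_fun setT (waiting k X G v j).
Proof.
case: v => [|c v]; first exact: measurable_cst.
have marr i : measurable_fun setT
    (fun w => arrival G (c :: v) (served k X G (c :: v) i w) w).
  apply: (measurable_countable_case (f := arrival G (c :: v))).
    exact: measurable_served.
  by move=> m; exact: measurable_arrival.
apply: measurable_funB => //; apply: measurable_funD => //.
exact: measurable_delay_stat.
Qed.

Lemma measurable_cycle_length v j : measurable_fun setT (cycle_length k X G v j).
Proof.
by apply: measurable_funD; [exact: measurable_delay_stat|exact: measurable_waiting].
Qed.

Lemma measurable_delivered v c j : measurable_fun setT (fun w => delivered k X v c w j).
Proof.
by apply: measurable_fun_ler; [exact: measurable_delay|exact: measurable_delay_stat].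
Qed.

Lemma measurable_delivery_cycle v c m : measurable_fun setT (delivery_cycle k X v c m).
Proof. by apply: measurable_nth_index => j; exact: measurable_delivered. Qed.

Lemma measurable_success_gap v c m : measurable_fun setT (success_gap k X G v c m).
Proof.
apply: (measurable_countable_case (f := fun a w =>
  \sum_(a <= j < delivery_cycle k X v c m.+1 w) cycle_length k X G v j w)).
  exact: measurable_delivery_cycle.
move=> a.
apply: (measurable_countable_case (f := fun b w =>
  \sum_(a <= j < b) cycle_length k X G v j w)).
  exact: measurable_delivery_cycle.
by move=> b; apply: measurable_sum => j; exact: measurable_cycle_length.
Qed.

Lemma measurable_transit v m : measurable_fun setT (transit k X G v m).
Proof.
elim: v m => [|c v ih] m; first exact: measurable_cst.
apply: (measurable_countable_case (f := fun j w =>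
  transit k X G v (served k X G v j w) w + X v j c w)).
  exact: measurable_delivery_cycle.
move=> j; apply: measurable_funD; last exact: measurable_delay.
by apply: (measurable_countable_case (f := transit k X G v)) => //; exact: measurable_served.
Qed.

End SampleMeasurability.

(** * Coordinate process on the space of sample paths *)

Section CanonicalNetwork.
Variables (n : nat) (R : realType).
Definition primitive_index := ((node n * nat * 'I_n) + (node n * nat))%type.
Local Notation Om := (path_space primitive_index R).

Definition coordinate (i : primitive_index) (x : Om) : R := x i.

HB.instance Definition _ i := isMeasurableFun.Build _ _ _ _
  (coordinate i) (measurable_coord i).

(* Absolute values make the delays nonnegative at every sample path, at the
   price of a change on a null set. *)
Definition abs_coordinate (i : primitive_index) (x : Om) : R := `|x i|.

Lemma measurable_abs_coordinate i : measurable_fun setT (abs_coordinate i).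
Proof. by apply: measurableT_comp => //; exact: measurable_coord. Qed.

HB.instance Definition _ i := isMeasurableFun.Build _ _ _ _
  (abs_coordinate i) (measurable_abs_coordinate i).

Definition abs_delay (P : probability Om R) (v : node n) (j : nat) (c : 'I_n) :
  {RV P >-> R} := abs_coordinate (inl (v, j, c)).

Definition abs_interarrival (P : probability Om R) (v : node n) (a : nat) :
  {RV P >-> R} := abs_coordinate (inr (v, a)).

End CanonicalNetwork.

Lemma integral_partition d (T : measurableType d) (R : realType)
    (mu : {measure set T -> \bar R}) (N : T -> nat) (f : T -> \bar R) :
  measurable_fun setT N -> measurable_fun setT f -> (forall x, 0 <= f x)%E ->
  (\int[mu]_x f x = \sum_(a <oo) \int[mu]_(x in N @^-1` [set a]) f x)%E.
Proof.
move=> mN mf f0; rewrite -ge0_integral_bigcup//.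
- congr (integral _ _ _); apply/seteqP; split=> // x _; exists (N x) => //.
- by move=> a; exact: measurable_preimage_nat.
- by apply: measurable_funTS.
- by apply/trivIsetP => i j _ _ ij; apply/seteqP; split=> // x [/= -> /eqP]; exact/negP.
Qed.

(** * Regeneration at the start of a cycle *)

Section Hop.
Variables (n : nat) (k : nat -> nat) (R : realType).
Local Notation Om := (path_space (primitive_index n) R).
Variable P : probability Om R.
Variables (L : nat) (e v : node n).
Local Notation D := (primitive_along L e).
Hypothesis ind : mutually_independent P D (fun i (x : Om) => x i).
Hypotheses (ve : suffix v e) (vL : (size v < L)%N).

Local Notation X := (abs_delay P).
Local Notation G := (abs_interarrival P).
Local Notation service := (service k X).
Local Notation arrival := (arrival G).
Local Notation served := (served k X G).
Local Notation cycle_length := (cycle_length k X G).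
Local Notation unbounded_arrivals := (unbounded_arrivals G).

Hypothesis idX : forall j c j' c' (A : set R), measurable A ->
  P ((fun x : Om => x (inl (v, j, c))) @^-1` A) =
  P ((fun x : Om => x (inl (v, j', c'))) @^-1` A).
Hypothesis idG : v != [::] -> forall a a' (A : set R), measurable A ->
  P ((fun x : Om => x (inr (v, a))) @^-1` A) =
  P ((fun x : Om => x (inr (v, a'))) @^-1` A).

(** Everything at the other nodes counts as past; only the cycles before j and the interarrival
    times before a are taken from v. Thus the transit times to v of its updates belong to the past
    of each of its cycles. *)
Definition history j a : pred (primitive_index n) := fun i =>
  D i && match i with
  | inl (u, j', _) => (u != v) || (j' < j)%N
  | inr (u, b) => (u != v) || (b < a)%N
  end.

Definition future j a : pred (primitive_index n) := fun i =>
  D i && match i with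
  | inl (u, j', _) => (u == v) && (j <= j')%N
  | inr (u, b) => (u == v) && (a <= b)%N
  end.

Lemma history_future j a i : history j a i -> ~~ future j a i.
Proof.
rewrite /history /future; case: i => [[[u j'] c]|[u b]] /andP[-> /=].
  by case: eqP => //= _; rewrite -ltnNge.
by case: eqP => //= _; rewrite -ltnNge.
Qed.

Definition shift_index j a (i : primitive_index n) : primitive_index n :=
  match i with
  | inl (u, j', c) => if u == v then inl (u, (j + j')%N, c) else i
  | inr (u, b) => if u == v then inr (u, (a + b)%N) else i
  end.

Definition shift_path j a (x : Om) : Om := fun i => x (shift_index j a i).

Lemma measurable_shift_path j a : measurable_fun setT (shift_path j a).
Proof. by apply: measurable_to_path => i; exact: measurable_coord. Qed.

Lemma depends_on_shift (U : Type) (phi : Om -> U) j a :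
  depends_on (future 0 0) phi -> depends_on (future j a) (phi \o shift_path j a).
Proof.
move=> dphi x y xy; apply: dphi => i; rewrite /shift_path /future/=.
case: i => [[[u j'] c]|[u b]] /andP[Di /andP[/eqP uv _]]; rewrite /= uv eqxx in Di *;
  by apply: xy; rewrite /future /= Di eqxx leq_addr.
Qed.

Lemma integral_shift (phi : Om -> \bar R) j a : measurable_fun setT phi ->
  (forall x, 0 <= phi x)%E -> depends_on (future 0 0) phi ->
  (\int[P]_x phi (shift_path j a x) = \int[P]_x phi x)%E.
Proof.
move=> mphi phi0 dphi.
apply: (@reindex_integral _ _ _ _ ind (shift_index j a) (future 0 0)) => //.
- by move=> i /andP[].
- case=> [[[u j'] c]|[u b]] /andP[Di /andP[/eqP uv _]];
  by rewrite /= uv eqxx in Di *.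
- move=> i1 i2 /andP[D1 h1] /andP[D2 h2].
  case: i1 D1 h1 => [[[u1 j1] c1]|[u1 b1]] D1 /andP[/eqP u1v _];
  case: i2 D2 h2 => [[[u2 j2] c2]|[u2 b2]] D2 /andP[/eqP u2v _];
  rewrite /= u1v u2v eqxx // => -[].
    by move=> /addnI -> ->.
  by move=> /addnI ->.
- move=> i A /andP[Di]; case: i Di => [[[u j'] c]|[u b]] /= Di /andP[/eqP uv _] mA.
    by rewrite uv eqxx; exact: idX.
  rewrite uv eqxx; apply: idG => //; move: Di => /andP[/andP[]].
  by rewrite -uv; case: u {uv}.
Qed.

Lemma abs_ge0 i (x : Om) : 0 <= abs_coordinate i x.
Proof. exact: normr_ge0. Qed.

Lemma unbounded_restrict j a (x : Om) :
  unbounded_arrivals v (restrict_path (history j a) x).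
Proof.
move=> v0 K; pose N := `|Num.ceil K|%N.
exists (a + N)%N; rewrite /Defs.arrival big_split_ord/= ler_wpDl//.
  by apply: sumr_ge0 => i _; exact: abs_ge0.
(* Interarrival times from number a on lie outside the history, so the restricted path reads the
   default 1 for each of them. *)
rewrite (eq_bigr (fun=> 1)); last first.
  move=> i _; rewrite /abs_interarrival /abs_coordinate/= /restrict_path /history/=.
  case: ifPn => [/andP[_]|_]; last by rewrite normr1.
  by rewrite eqxx ltnNge leq_addr.
rewrite sumr_const card_ord.
apply: (le_trans (ceil_ge K)); apply: (le_trans (ler_norm _)).
by rewrite -intr_norm -pmulrn natr_absz.
Qed.

(* f is known when cycle j starts at v. *)
Definition past (U : Type) j (f : Om -> U) := forall x y : Om,
  unbounded_arrivals v x ->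
  (forall i, history j (served v j x) i -> x i = y i) -> f x = f y.

Lemma same_history_of j a x y :
  (forall i, history j a i -> x i = y i) -> same_history X G v j a x y.
Proof.
move=> h; split=> [i c ij|v0 b ba].
  by rewrite /= /abs_coordinate h// /history /= vL ij orbT.
rewrite /= /abs_coordinate h// /history /= vL ve ba orbT !andbT.
by rewrite lt0n size_eq0.
Qed.

Lemma served_past j : past j (served v j).
Proof.
move=> x y unb h; apply/esym/(@served_history _ _ _ P) => //.
  by move=> i; exact: abs_ge0.
exact: same_history_of.
Qed.

Lemma pastS (U : Type) j (f : Om -> U) : past j f -> past j.+1 f.
Proof.
move=> pf x y unb h; apply: pf => // i hi; apply: h.
move: hi; rewrite /history => /andP[-> /=].
case: i => [[[u j'] c]|[u b]] /orP[->//|lt].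
  by rewrite (leqW lt) orbT.
by rewrite (ltn_trans lt) ?orbT//; exact: served_ltS.
Qed.

Lemma past_le (U : Type) i j (f : Om -> U) : (i <= j)%N -> past i f -> past j f.
Proof.
move=> ij pf; rewrite -(subnKC ij); elim: (j - i)%N => [|m ih].
  by rewrite addn0.
by rewrite addnS; exact: pastS.
Qed.

Lemma cycle_length_past j : past j.+1 (cycle_length v j).
Proof.
move=> x y unb h; apply/esym/(@cycle_length_history _ _ _ P) => //.
  by move=> i; exact: abs_ge0.
exact: same_history_of.
Qed.

Lemma delay_past j c : past j.+1 (X v j c : Om -> R).
Proof.
move=> x y unb h; rewrite /= /abs_coordinate h// /history /= vL.
by rewrite ltnS leqnn orbT.
Qed.

Lemma service_past j : past j.+1 (service v j).
Proof. by move=> x y unb h; apply: eq_delay_stat => c; exact: (@delay_past j c x y unb h). Qed.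

Lemma past_comp (U V : Type) j (f : Om -> U) (g : U -> V) :
  past j f -> past j (fun x => g (f x)).
Proof. by move=> pf x y unb h; rewrite (pf _ _ unb h). Qed.

Lemma past_comp2 (U V W : Type) j (f : Om -> U) (g : Om -> V) (h : U -> V -> W) :
  past j f -> past j g -> past j (fun x => h (f x) (g x)).
Proof. by move=> pf pg x y unb hi; rewrite (pf _ _ unb hi) (pg _ _ unb hi). Qed.

Lemma delivered_past j c : past j.+1 (fun x => delivered k X v c x j).
Proof.
exact: (@past_comp2 _ _ _ _ (X v j c : Om -> R) _ (fun a b => a <= b)
  (@delay_past j c) (@service_past j)).
Qed.

Lemma depends_on_future0 (U : Type) (phi : Om -> U) :
  (forall x y : Om, (forall j c, X v j c x = X v j c y) ->
    (v != [::] -> forall a, G v a x = G v a y) -> phi x = phi y) ->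
  depends_on (future 0 0) phi.
Proof.
move=> h x y xy; apply: h.
  by move=> j c; rewrite /= /abs_coordinate xy// /future /= vL eqxx.
move=> v0 a; rewrite /= /abs_coordinate xy// /future /= vL eqxx ve.
by rewrite lt0n size_eq0 v0.
Qed.

Lemma cycle_length_shift_path j x :
  cycle_length v 0 (shift_path j (served v j x) x) = cycle_length v j x.
Proof.
apply: cycle_length_shift => [|v0 b].
  apply: eq_delay_stat => c.
  by rewrite /= /abs_coordinate /shift_path/= eqxx addn0.
by rewrite /= /abs_coordinate /shift_path/= eqxx.
Qed.

Lemma delay_shift_path j a x c : X v 0%N c (shift_path j a x) = X v j c x.
Proof. by rewrite /= /abs_coordinate /shift_path/= eqxx addn0. Qed.

Hypothesis unb : {ae P, forall x, unbounded_arrivals v x}.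

(* Split according to the number a of the update served in cycle j: on that event
   U depends on the past of (j, a) only, and the shifted phi on the future. *)
Theorem regeneration j (U phi : Om -> \bar R) :
  measurable_fun setT U -> (forall x, 0 <= U x)%E -> past j U ->
  measurable_fun setT phi -> (forall x, 0 <= phi x)%E -> depends_on (future 0 0) phi ->
  (\int[P]_x phi x)%E \is a fin_num ->
  (\int[P]_x (U x * phi (shift_path j (served v j x) x)) =
   (\int[P]_x U x) * (\int[P]_x phi x))%E.
Proof.
move=> mU U0 pU mphi phi0 dphi phifin.
have mserved : measurable_fun setT (served v j) by exact: measurable_served.
have mF a : measurable (served v j @^-1` [set a]) by exact: measurable_preimage_nat.
have mphis a : measurable_fun setT (fun x => phi (shift_path j a x)).
  by apply: measurableT_comp => //; exact: measurable_shift_path.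
rewrite (integral_partition P mserved)//; last 2 first.
- apply: emeasurable_funM => //.
  exact: (measurable_countable_case (f := fun a x => phi (shift_path j a x))).
- by move=> x; exact: mule_ge0.
rewrite [X in _ = (X * _)%E](integral_partition P mserved)// muleC.
have pF a : past j (fun x => served v j x == a).
  by apply: (@past_comp _ _ _ _ (fun b => b == a)); exact: served_past.
have key a : (\int[P]_(x in served v j @^-1` [set a])
      (U x * phi (shift_path j (served v j x) x)) =
    (\int[P]_x phi x) * \int[P]_(x in served v j @^-1` [set a]) U x)%E.
  rewrite muleC; pose r := restrict_path (history j a) : Om -> Om.
  pose Ua := U \_ (served v j @^-1` [set a]).
  have mUa : measurable_fun setT Ua.
    exact: (iffLR (measurable_restrictT _ (mF a)) (measurable_funTS mU)).
  have Ua0 x : (0 <= Ua x)%E by rewrite /Ua patchE; case: ifP.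
  (* Up to a null set, restricting the path to the history of (j, a) changes neither the event that
     update a is served in cycle j nor U on this event. *)
  have UaE : {ae P, forall x, Ua x = Ua (r x)}.
    apply: filterS unb => x unbx.
    rewrite /Ua !patchE.
    have [sx|sx] := eqVneq (served v j x) a.
      have rE i : history j (served v j x) i -> x i = r x i.
        by rewrite sx => hi; rewrite /r /restrict_path hi.
      have srx := served_past unbx rE.
      by rewrite !mem_set//= -?srx// (pU _ _ unbx rE).
    rewrite memNset; last exact/eqP.
    (* Conversely, if the restricted path serves a in cycle j then so does x: the stopping property
       is applied from the restricted path, whose arrivals are unbounded by the choice of its
       default. *)
    rewrite memNset//= => srx; move/eqP: sx; apply; rewrite -srx.
    apply: esym; apply: served_past; first exact: unbounded_restrict.
    by move=> i; rewrite srx => hi; rewrite /r /restrict_path hi.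
  have mr : measurable_fun setT (fun x => Ua (r x)).
    by apply: measurableT_comp => //; exact: measurable_restrict_path.
  have -> : (\int[P]_(x in served v j @^-1` [set a]) U x = \int[P]_x Ua (r x))%E.
    rewrite integral_mkcond.
    apply: (@ge0_ae_eq_integral _ _ _ _ setT Ua (fun x => Ua (r x))) => //.
    by apply: filterS UaE => x h _; exact: h.
  rewrite -(integral_shift j a mphi phi0 dphi).
  rewrite -(independent_integralM (J1 := history j a) (J2 := future j a) ind)//.
  - rewrite integral_mkcond.
    apply: (@ge0_ae_eq_integral _ _ _ _ setT _
      (fun x => Ua (r x) * phi (shift_path j a x))%E) => //.
    + apply: (iffLR (measurable_restrictT _ (mF a))); apply: measurable_funTS.
      apply: emeasurable_funM => //.
      exact: (measurable_countable_case (f := fun a x => phi (shift_path j a x))).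
    + exact: emeasurable_funM.
    + by move=> x _; rewrite patchE; case: ifP => // _; exact: mule_ge0.
    + by move=> x _; exact: mule_ge0.
    apply: filterS UaE => x h _; rewrite -h /Ua !patchE; case: ifPn => [|_]; last by rewrite mul0e.
    by rewrite inE => /= ->.
  - by move=> i /andP[].
  - by move=> i /andP[].
  - by move=> i /history_future.
  - exact: depends_on_restrict.
  - exact: depends_on_shift.
under eq_eseriesr do rewrite key.
rewrite -(fineK phifin).
by rewrite nneseriesZl// => a _; exact: integral_ge0.
Qed.

End Hop.

Section RegularNode.
Variables (n : nat) (k : nat -> nat) (R : realType).
Local Notation Om := (path_space (primitive_index n) R).
Variable P : probability Om R.
Variables (L : nat) (e v : node n).
Local Notation D := (primitive_along L e).
Local Notation X := (abs_delay P).
Local Notation G := (abs_interarrival P).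
Local Notation served := (served k X G v).
Local Notation cycle_length := (cycle_length k X G v).

(** What regeneration at v requires. It is established by induction along the path to e, because at
    a node other than the root the last two fields come from the success gaps of the parent. *)
Record regular_node : Prop := RegularNode {
  regular_independent : mutually_independent P D (fun i (x : Om) => x i) ;
  regular_suffix : suffix v e ;
  regular_size : (size v < L)%N ;
  regular_delay : forall j c j' c' (A : set R), measurable A ->
    P ((fun x : Om => x (inl (v, j, c))) @^-1` A) =
    P ((fun x : Om => x (inl (v, j', c'))) @^-1` A) ;
  regular_interarrival : v != [::] -> forall a a' (A : set R), measurable A ->
    P ((fun x : Om => x (inr (v, a))) @^-1` A) =
    P ((fun x : Om => x (inr (v, a'))) @^-1` A) ;
  regular_unbounded : {ae P, forall x, unbounded_arrivals G v x} }.

Hypothesis reg : regular_node.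

Definition cycle_shift j (x : Om) : Om := shift_path v j (served j x) x.

Lemma measurable_cycle_shift j : measurable_fun setT (cycle_shift j).
Proof.
apply: (measurable_countable_case (f := fun a x => shift_path v j a x)).
  exact: measurable_served.
by move=> a; exact: measurable_shift_path.
Qed.

(** One-cycle observables: apart from the age of the served update, all that the age at c uses of a
    cycle is the delay to c, whether c is among the earliest, and the length. Being functions of the
    shifted path, they inherit regeneration. *)
Definition cycle_fun (U : Type) (c : 'I_n) (F : R -> bool -> R -> U) j (x : Om) : U :=
  F (X v j c x) (delivered k X v c x j) (cycle_length j x).

Lemma cycle_fun_shift (U : Type) c (F : R -> bool -> R -> U) j x :
  cycle_fun c F 0 (cycle_shift j x) = cycle_fun c F j x.
Proof.
rewrite /cycle_fun /cycle_shift cycle_length_shift_path delay_shift_path.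
rewrite /delivered delay_shift_path; congr (F _ (_ <= _) _).
by apply: eq_delay_stat => c'; rewrite delay_shift_path.
Qed.

Lemma measurable_cycle_fun d (U : measurableType d) c (F : R -> bool -> R -> U) j :
  measurable_fun setT (cycle_fun c F 0) -> measurable_fun setT (cycle_fun c F j).
Proof.
move=> mF; have -> : cycle_fun c F j = cycle_fun c F 0 \o cycle_shift j.
  by apply/funext => x /=; rewrite cycle_fun_shift.
by apply: measurableT_comp => //; exact: measurable_cycle_shift.
Qed.

Local Notation past := (past k P L e v).

Lemma cycle_fun_past (U : Type) c (F : R -> bool -> R -> U) j :
  past j.+1 (cycle_fun c F j).
Proof.
have [ind ve vL _ _ _] := reg.
move=> x y unb h; rewrite /cycle_fun.
rewrite (@delay_past _ _ _ P _ _ _ vL j c x y unb h).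
rewrite (@delivered_past _ k _ P _ _ _ vL j c x y unb h).
by rewrite (@cycle_length_past _ k _ P _ _ _ ve vL j x y unb h).
Qed.

Lemma depends_on_cycle_fun (U : Type) c (F : R -> bool -> R -> U) :
  depends_on (future L e v 0 0) (cycle_fun c F 0).
Proof.
have [ind ve vL _ _ _] := reg.
apply: (@depends_on_future0 _ _ P) => // x y xyX xyG.
rewrite /cycle_fun /delivered xyX.
have -> : service k X v 0 x = service k X v 0 y.
  by apply: eq_delay_stat => c'; exact: xyX.
have -> // : cycle_length 0 x = cycle_length 0 y.
apply: cycle_length_shift => [|v0 b]; first by apply: eq_delay_stat => c'; exact: xyX.
by rewrite xyG//; case: (v) v0.
Qed.

(** [regeneration] concerns nonnegative U; the signed case follows from positive and negative parts,
    each of which is known when cycle j starts. *)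
Lemma regeneration_Ex j (U : Om -> R) c F :
  L1 P U -> past j U -> L1 P (cycle_fun c F 0) -> (forall x, 0 <= cycle_fun c F 0 x) ->
  L1 P (fun x => U x * cycle_fun c F j x) /\
  Ex P (fun x => U x * cycle_fun c F j x) = Ex P U * Ex P (cycle_fun c F 0).
Proof.
have [ind ve vL idX idG unb] := reg.
move=> U1 pU F1 F0.
have mF j' : measurable_fun setT (cycle_fun c F j').
  by apply: measurable_cycle_fun; exact: L1_measurable F1.
have key V : L1 P V -> past j V -> (forall x, 0 <= V x) ->
    L1 P (fun x => V x * cycle_fun c F j x) /\
    Ex P (fun x => V x * cycle_fun c F j x) = Ex P V * Ex P (cycle_fun c F 0).
  move=> V1 pV V0.
  have h : (\int[P]_x (V x * cycle_fun c F j x)%:E)%E =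
      (Ex P V * Ex P (cycle_fun c F 0))%:E.
    transitivity (\int[P]_x ((EFin \o V) x *
        (EFin \o cycle_fun c F 0) (shift_path v j (served j x) x)))%E.
      by apply: eq_integral => x _; rewrite /= -cycle_fun_shift.
    rewrite (@regeneration _ k _ P L e v ind ve vL idX idG unb)//.
    - by rewrite /= !ExE// -EFinM.
    - by apply/measurable_EFinP; exact: L1_measurable V1.
    - exact: past_comp.
    - by apply/measurable_EFinP; exact: mF.
    - by move=> x y xy; rewrite /= (depends_on_cycle_fun _ _ xy).
    - by rewrite /= ExE.
  have VF1 : L1 P (fun x => V x * cycle_fun c F j x).
    apply: ge0_L1; last by rewrite h ltry.
      by apply: measurable_funM => //; exact: L1_measurable V1.
    by move=> x; rewrite mulr_ge0// -cycle_fun_shift.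
  by split=> //; apply: EFin_inj; rewrite -ExE.
pose U1' x := Num.max (U x) 0.
pose U2' x := Num.max (- U x) 0.
have U12 x : U x = U1' x - U2' x.
  rewrite /U1' /U2'; case: (leP (U x) 0) => U0.
    by rewrite max_l ?oppr_ge0// opprK add0r.
  by rewrite max_r ?subr0// oppr_le0 ltW.
have mU : measurable_fun setT U := L1_measurable U1.
have V1 : L1 P U1'.
  apply: le_L1 U1; first exact: measurable_maxr.
  by move=> x; rewrite /U1'; case: (leP (U x) 0) => // _; rewrite normr0.
have V2 : L1 P U2'.
  apply: le_L1 U1; first by apply: measurable_maxr => //; exact: measurable_funN.
  by move=> x; rewrite /U2'; case: (leP (- U x) 0) => // _; rewrite ?normr0// normrN.
have [V1F e1] : L1 P (fun x => U1' x * cycle_fun c F j x) /\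
    Ex P (fun x => U1' x * cycle_fun c F j x) = Ex P U1' * Ex P (cycle_fun c F 0).
  apply: key => //; first by move=> x y unbx h; rewrite /U1' (pU _ _ unbx h).
  by move=> x; rewrite le_max lexx orbT.
have [V2F e2] : L1 P (fun x => U2' x * cycle_fun c F j x) /\
    Ex P (fun x => U2' x * cycle_fun c F j x) = Ex P U2' * Ex P (cycle_fun c F 0).
  apply: key => //; first by move=> x y unbx h; rewrite /U2' (pU _ _ unbx h).
  by move=> x; rewrite le_max lexx orbT.
have UE : (fun x => U x * cycle_fun c F j x) =
    (fun x => U1' x * cycle_fun c F j x - U2' x * cycle_fun c F j x).
  by apply/funext => x; rewrite U12 mulrBl.
rewrite UE ExB// e1 e2 -mulrBl -ExB//; split; first exact: L1B.
by under eq_Ex do rewrite -U12.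
Qed.

Lemma Ex_cycle_fun j c F : L1 P (cycle_fun c F 0) -> (forall x, 0 <= cycle_fun c F 0 x) ->
  L1 P (cycle_fun c F j) /\ Ex P (cycle_fun c F j) = Ex P (cycle_fun c F 0).
Proof.
move=> F1 F0; have [] := @regeneration_Ex j (fun=> 1) c F (L1_cst _ _) _ F1 F0 => //.
rewrite Ex_cst mul1r; have -> // : (fun x => 1 * cycle_fun c F j x) = cycle_fun c F j.
by apply/funext => x; rewrite mul1r.
Qed.

Lemma regeneration_prod J c F : L1 P (cycle_fun c F 0) ->
  (forall x, 0 <= cycle_fun c F 0 x) ->
  L1 P (fun x => \prod_(j < J) cycle_fun c F j x) /\
  Ex P (fun x => \prod_(j < J) cycle_fun c F j x) = Ex P (cycle_fun c F 0) ^+ J.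
Proof.
move=> F1 F0; suff [h1 [h2 h3]] : L1 P (fun x => \prod_(j < J) cycle_fun c F j x) /\
   (Ex P (fun x => \prod_(j < J) cycle_fun c F j x) = Ex P (cycle_fun c F 0) ^+ J /\
    past J (fun x => \prod_(j < J) cycle_fun c F j x)) by [].
elim: J => [|J [ih1 [ih2 ih3]]].
  have -> : (fun x => \prod_(j < 0) cycle_fun c F j x) = fun=> 1.
    by apply/funext => x; rewrite big_ord0.
  by rewrite Ex_cst; split; [exact: L1_cst|].
have -> : (fun x => \prod_(j < J.+1) cycle_fun c F j x) =
    (fun x => (\prod_(j < J) cycle_fun c F j x) * cycle_fun c F J x).
  by apply/funext => x; rewrite big_ord_recr.
have [h1 h2] := regeneration_Ex ih1 ih3 F1 F0.
split=> //; rewrite h2 ih2 exprSr; split=> //.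
move=> x y unb h; congr (_ * _); last exact: cycle_fun_past unb h.
by apply: (pastS ih3) unb h.
Qed.

(** The increment F_j - E[F_0] has mean 0 given the start of cycle j, and U_j and the earlier terms
    are known then. The terms are therefore orthogonal to their partial sums, with second moments at
    most C Var[F_0]. *)
Theorem martingale_average c F (U : nat -> Om -> R) C :
  (forall j, L2 P (U j)) -> (forall j, Ex P (fun x => U j x ^+ 2) <= C) ->
  (forall j, past j (U j)) ->
  L2 P (cycle_fun c F 0) -> (forall x, 0 <= cycle_fun c F 0 x) ->
  {ae P, forall x, (fun N => N%:R^-1 *
    \sum_(j < N) U j x * (cycle_fun c F j x - Ex P (cycle_fun c F 0))) @ \oo --> 0}.
Proof.
move=> U2 UC pU F2 F0; set m := Ex P (cycle_fun c F 0).
pose F' a b y := (F a b y - m) ^+ 2.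
have F'2 : L2 P (fun x => cycle_fun c F 0 x - m).
  by apply: L2B => //; exact: L2_cst.
have F'1 : L1 P (cycle_fun c F' 0) by exact: F'2.2.
have mF j : measurable_fun setT (cycle_fun c F j).
  by apply: measurable_cycle_fun; exact: L2_measurable F2.
have UF j : L1 P (fun x => (U j x * (cycle_fun c F j x - m)) ^+ 2) /\
    Ex P (fun x => (U j x * (cycle_fun c F j x - m)) ^+ 2) =
    Ex P (fun x => U j x ^+ 2) * Ex P (cycle_fun c F' 0).
  have -> : (fun x => (U j x * (cycle_fun c F j x - m)) ^+ 2) =
    (fun x => U j x ^+ 2 * cycle_fun c F' j x).
    by apply/funext => x; rewrite exprMn.
  apply: regeneration_Ex => //; first exact: (U2 j).2.
    by move=> x y unbx h; rewrite (pU _ _ _ unbx h).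
  by move=> x; exact: sqr_ge0.
have C0 : 0 <= C by apply: le_trans (UC 0%N); apply: Ex_ge0 => x; exact: sqr_ge0.
have f2 j : L2 P (fun x => U j x * (cycle_fun c F j x - m)).
  split; last exact: (UF j).1.
  by apply: measurable_funM; [exact: L2_measurable|exact: measurable_funB].
apply: (@orthogonal_slln _ _ _ _ (fun j x => U j x * (cycle_fun c F j x - m))
  (C * Ex P (cycle_fun c F' 0))) => // N.
  rewrite (UF N).2 ler_wpM2r//; apply: Ex_ge0 => x; exact: sqr_ge0.
have S2 : L2 P (fun x => \sum_(j < N) U j x * (cycle_fun c F j x - m)).
  exact: (@L2_sum _ _ _ _ _ (fun j x => U j x * (cycle_fun c F j x - m))).
have SU1 : L1 P (fun x => (\sum_(j < N) U j x * (cycle_fun c F j x - m)) * U N x).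
  exact: L2M.
have -> : (fun x => (\sum_(j < N) U j x * (cycle_fun c F j x - m)) *
       (U N x * (cycle_fun c F N x - m))) =
    (fun x => (\sum_(j < N) U j x * (cycle_fun c F j x - m)) * U N x * cycle_fun c F N x -
      m * ((\sum_(j < N) U j x * (cycle_fun c F j x - m)) * U N x)).
  by apply/funext => x; ring.
have pS : past N (fun x => (\sum_(j < N) U j x * (cycle_fun c F j x - m)) * U N x).
  move=> x y unb h; rewrite (pU _ _ _ unb h); congr (_ * _).
  apply: eq_bigr => j _.
  have jN := ltn_ord j.
  rewrite (past_le (ltnW jN) (pU j) unb h).
  by rewrite (past_le jN (@cycle_fun_past _ c F j) unb h).
have [h1 h2] := regeneration_Ex SU1 pS (L2_L1 F2) F0.
rewrite ExB//; last exact: L1Z.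
by rewrite h2 ExZ// mulrC subrr.
Qed.

End RegularNode.

(** * Symmetry of the children *)

Section Exchangeability.
Variables (n : nat) (k : nat -> nat) (R : realType).
Local Notation Om := (path_space (primitive_index n) R).
Variable P : probability Om R.
Variables (L : nat) (e v : node n).
Local Notation D := (primitive_along L e).
Local Notation X := (abs_delay P).
Local Notation G := (abs_interarrival P).
Hypothesis reg : regular_node P L e v.
Hypothesis atomless : forall j c (y : R), P [set x | x (inl (v, j, c)) = y] = 0%E.
Hypothesis kv : (0 < k (hop v) <= n)%N.
Local Notation cfun := (cycle_fun k P v).

(** Exchanges two children in cycle 0 only. The service time of that cycle, a symmetric function of
    the delays, is unchanged, and so is its length. *)
Definition swap_index (c c' : 'I_n) (i : primitive_index n) : primitive_index n :=
  match i with
  | inl (u, j, d) => if (u == v) && (j == 0%N) then inl (u, j, tperm c c' d) else i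
  | inr _ => i
  end.

Lemma integral_cycle_fun_exchange c c' (F : R -> bool -> R -> R) :
  measurable_fun setT (cfun c F 0) -> (forall x, 0 <= cfun c F 0 x) ->
  (\int[P]_x (cfun c F 0 x)%:E = \int[P]_x (cfun c' F 0 x)%:E)%E.
Proof.
have [ind ve vL idX idG unb] := reg.
move=> mF F0; pose s := swap_index c c'.
have sX d (x : Om) : X v 0%N d (fun i => x (s i)) = X v 0%N (tperm c c' d) x.
  by rewrite /= /abs_coordinate /s /= eqxx.
have sS (x : Om) : service k X v 0 (fun i => x (s i)) = service k X v 0 x.
  rewrite /service /delay_stat -[RHS](order_stat_perm _ _ (Bijective (tpermK c c') (tpermK c c'))).
  by congr order_stat; apply/funext => d; exact: sX.
have sF (x : Om) : cfun c F 0 (fun i => x (s i)) = cfun c' F 0 x.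
  rewrite /cycle_fun /delivered sX tpermL sS.
  congr (F _ _ _); apply: (@cycle_length_shift _ _ _ P); first exact: sS.
  by move=> v0 b; rewrite /= /abs_coordinate /s /=; case: (v) v0.
transitivity (\int[P]_x (EFin \o cfun c F 0) (fun i => x (s i)))%E; last first.
  by apply: eq_integral => x _ /=; rewrite sF.
apply/esym; apply: (@reindex_integral _ _ _ _ ind s (future L e v 0 0)).
- by move=> i /andP[].
- move=> i /andP[Di _]; case: i Di => [[[u j] d]|[u a]] //= Di.
  by case: ifP.
- move=> [[[u j] d]|[u a]] [[[u' j'] d']|[u' a']] _ _ //=.
  + case: ifP => [/andP[/eqP -> /eqP ->]|h]; case: ifP => [/andP[/eqP -> /eqP ->]|h'].
    * by move=> [/perm_inj ->].
    * by move=> [uu jj _]; rewrite -uu -jj !eqxx in h'.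
    * by move=> [uu jj _]; rewrite uu jj !eqxx in h.
    * by [].
  + by case: ifP.
  + by case: ifP.
- move=> [[[u j] d]|[u a]] A /andP[_ /andP[/eqP -> _]] mA //=.
  by rewrite eqxx/=; case: ifP => _; exact: idX.
- exact/measurable_EFinP.
- by move=> x; rewrite lee_fin.
- move=> x y xy /=; congr EFin; exact: depends_on_cycle_fun xy.
Qed.

Lemma L1_cycle_fun_exchange c c' (F : R -> bool -> R -> R) : L1 P (cfun c F 0) ->
  (forall x, 0 <= cfun c F 0 x) -> (forall x, 0 <= cfun c' F 0 x) ->
  measurable_fun setT (cfun c' F 0) ->
  L1 P (cfun c' F 0) /\ Ex P (cfun c' F 0) = Ex P (cfun c F 0).
Proof.
move=> F1 F0 F0' mF'; have h := integral_cycle_fun_exchange c' (L1_measurable F1) F0.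
have F1' : L1 P (cfun c' F 0).
  by apply: ge0_L1 => //; rewrite -h ExE// ltry.
by split => //; apply: EFin_inj; rewrite -!ExE// h.
Qed.

(** By Tonelli the probability of a tie is an average over one delay of the probability that the
    other takes a prescribed value; this is 0 as the delay laws have no atoms. *)
Lemma delays_distinct : {ae P, forall x, injective (fun c => X v 0%N c x)}.
Proof.
have [ind ve vL idX idG unb] := reg.
have h c c' : c != c' -> {ae P, forall x, X v 0%N c x != X v 0%N c' x}.
  move=> cc'; pose tie := [set x | X v 0%N c x == X v 0%N c' x].
  have tieE : tie = [set x | X v 0%N c x <= X v 0%N c' x] `&` [set x | X v 0%N c' x <= X v 0%N c x].
    by apply/seteqP; split=> x /=; rewrite /tie/= eq_le; [move=> /andP[]|move=> [-> ->]].
  have mtie : measurable tie.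
    by rewrite tieE; apply: measurableI; apply: measurable_preimage_bool;
      apply: measurable_fun_ler; exact: measurable_delay.
  exists tie; split => //; last by move=> x /= /negP; rewrite negbK.
  pose i : primitive_index n := inl (v, 0%N, c); pose i' : primitive_index n := inl (v, 0%N, c').
  pose E : set (Om * Om) := [set z | (`|z.1 i| <= `|z.2 i'|) && (`|z.2 i'| <= `|z.1 i|)].
  have mE1 : measurable_fun setT (fun z : Om * Om => `|z.1 i|).
    apply: measurableT_comp => //.
    exact: (measurableT_comp (measurable_coord i) measurable_fst).
  have mE2 : measurable_fun setT (fun z : Om * Om => `|z.2 i'|).
    apply: measurableT_comp => //.
    exact: (measurableT_comp (measurable_coord i') measurable_snd).
  have mE : measurable E.
    apply: measurable_preimage_bool; apply: measurable_and; exact: measurable_fun_ler.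
  have Di j : future L e v 0 0 (inl (v, 0%N, j)) by rewrite /future /= vL eqxx.
  have -> : P tie = (\int[P]_x (\1_E (x, x))%:E)%E.
    rewrite -[in LHS](setIT tie) -integral_indic//; apply: eq_integral => x _.
    rewrite !indicE; congr (_%:R%:E); congr nat_of_bool.
    by apply/idP/idP; rewrite !inE /tie /E/= eq_le.
  rewrite (@independent_integral _ _ _ _ ind (pred1 i) (pred1 i') (fun z => (\1_E z)%:E))//.
  - apply: integral0_eq => x _ /=.
    (* Delays are absolute values of coordinates, so a tie with [|x i|] leaves two possible values
       of the other coordinate. *)
    pose B := [set y : Om | y i' = `|x i| ] `|` [set y : Om | y i' = - `|x i| ].
    have mB z : measurable [set y : Om | y i' = z].
      rewrite -[X in measurable X]setTI.
      exact: (@measurable_coord _ _ i' measurableT [set z] (measurable_set1 z)).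
    have at0 z : P [set y : Om | y i' = z] = 0%E by exact: atomless.
    have B0 : P B = 0%E.
      by rewrite /B measureU0; [exact: at0|exact: mB|exact: mB|exact: at0].
    have <- : (\int[P]_y (\1_B y)%:E)%E = 0%E.
      by rewrite integral_indic ?setIT//; exact: measurableU.
    apply: eq_integral => y _; rewrite !indicE; congr (_%:R%:E); congr nat_of_bool.
    apply/idP/idP; rewrite !inE /B /E/= -eq_le.
      move=> /eqP ->; case: (ger0P (y i')) => _; [by left|by right; rewrite opprK].
    by case=> ->; rewrite ?normrN normr_id.
  - by move=> _ /eqP ->; case/andP: (Di c).
  - by move=> _ /eqP ->; case/andP: (Di c').
  - by move=> j /eqP ->; apply: contraNN cc' => /eqP [->].
  - exact/measurable_EFinP/measurable_indic.
  - by move=> y x x' /(_ _ (eqxx _)) xx'; rewrite !indicE;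
      congr (_%:R%:E); congr nat_of_bool; apply/idP/idP; rewrite !inE /E/= xx'.
  - by move=> y x x' /(_ _ (eqxx _)) xx'; rewrite !indicE;
      congr (_%:R%:E); congr nat_of_bool; apply/idP/idP; rewrite !inE /E/= xx'.
have h' c c' : {ae P, forall x, c != c' -> X v 0%N c x != X v 0%N c' x}.
  by have [->|cc'] := eqVneq c c'; [exact: aeW|apply: filterS (h _ _ cc')].
have : {ae P, forall x, forall c c', c != c' -> X v 0%N c x != X v 0%N c' x}.
  apply: (@filter_forall _ _ (fun c x => forall c', c != c' -> X v 0%N c x != X v 0%N c' x)) => c.
  exact: (@filter_forall _ _ (fun c' x => c != c' -> X v 0%N c x != X v 0%N c' x)).
apply: filterS => x h2 c c'; apply: contra_eq; exact: h2.
Qed.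

Lemma Ex_cycle_fun_sum c (F : R -> bool -> R -> R) : (forall c' x, 0 <= cfun c' F 0 x) ->
  (forall c', measurable_fun setT (cfun c' F 0)) -> L1 P (cfun c F 0) ->
  n%:R * Ex P (cfun c F 0) = Ex P (fun x => \sum_(c' < n) cfun c' F 0 x).
Proof.
move=> F0 mF F1; have h c' := L1_cycle_fun_exchange F1 (F0 c) (F0 c') (mF c').
rewrite (Ex_sum_seq (index_enum _) (F := fun c' => cfun c' F 0)); last first.
  by move=> c'; exact: (h c').1.
rewrite (eq_bigr (fun=> Ex P (cfun c F 0))) => [|c' _]; last exact: (h c').2.
by rewrite sumr_const card_ord mulr_natl.
Qed.

Lemma n_gt0 : 0 < n%:R :> R.
Proof. by have /andP[k0 kn] := kv; rewrite ltr0n; exact: leq_trans kn. Qed.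

Lemma measurable_delivered_if c (f : Om -> R) j : measurable_fun setT f ->
  measurable_fun setT (fun x => if delivered k X v c x j then f x else 0).
Proof.
by move=> mf; apply: measurable_fun_ifT => //; exact: measurable_delivered.
Qed.

Lemma sum_delivered x (f : R -> R) : injective (fun c => X v 0%N c x) ->
  \sum_(c < n) (if delivered k X v c x 0 then f (X v 0%N c x) else 0) =
  \sum_(1 <= i < (k (hop v)).+1) f (delay_stat X v 0 i x).
Proof.
move=> inj; rewrite -big_mkcond/=.
exact: (@sum_le_order_stat R n f (k (hop v)) (fun c => X v 0%N c x) inj kv).
Qed.

(* By symmetry of the children, n times the left-hand side is the expectation of
   the sum over all children, exactly k of which receive the update. *)
Lemma Ex_delivered c (h : R -> R) : measurable_fun setT h -> (forall y, 0 <= h y) ->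
  L1 P (fun x => h (cycle_length k X G v 0 x)) ->
  let F (a : R) (b : bool) (y : R) := if b then h y else 0 in
  L1 P (cfun c F 0) /\
  Ex P (cfun c F 0) =
    (k (hop v))%:R / n%:R * Ex P (fun x => h (cycle_length k X G v 0 x)).
Proof.
move=> mh h0 h1 F.
have F0 c' x : 0 <= cfun c' F 0 x by rewrite /cycle_fun /F; case: ifP.
have mF c' : measurable_fun setT (cfun c' F 0).
  by apply: measurable_delivered_if; exact: L1_measurable h1.
have F1 : L1 P (cfun c F 0).
  apply: le_L1 h1 => // x; rewrite ger0_norm// ger0_norm// /cycle_fun /F.
  by case: ifP.
split=> //; apply: (mulfI (lt0r_neq0 n_gt0)).
rewrite mulrCA mulrA divfK ?lt0r_neq0 ?n_gt0//.
rewrite Ex_cycle_fun_sum// -ExZ//; apply: ae_eq_Ex.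
- by apply: measurable_sum => c'; exact: mF.
- by apply: measurable_funM => //; exact: L1_measurable h1.
apply: filterS delays_distinct => x inj.
rewrite /cycle_fun /F (@sum_delivered x (fun=> h (cycle_length k X G v 0 x)))//.
by rewrite sumr_const_nat subn1 mulr_natl.
Qed.

Lemma L1_delay_stat i : (forall c, L1 P (X v 0%N c : Om -> R)) ->
  L1 P (delay_stat X v 0 i).
Proof.
move=> X1; apply: (@le_L1 _ _ _ _ _ (fun x => \sum_(c < n) X v 0%N c x)).
- exact: measurable_delay_stat.
- move=> x; rewrite ger0_norm ?order_stat_ge0// => [|c]; last exact: abs_ge0.
  apply: le_trans (ler_norm _); apply: order_stat_le_sum => c; exact: abs_ge0.
exact: (L1_sum_seq (index_enum _) (F := fun c => X v 0%N c : Om -> R)).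
Qed.

(** With distinct delays, the delivered delays are exactly the k smallest ones, and symmetry spreads
    their sum evenly over the n children. Division by the delivery probability k/n will turn 1/n
    into the 1/k of the theorem. *)
Lemma Ex_delivered_delay c : (forall c, L1 P (X v 0%N c : Om -> R)) ->
  let F (a : R) (b : bool) (y : R) := if b then a else 0 in
  L1 P (cfun c F 0) /\
  Ex P (cfun c F 0) =
    n%:R^-1 * \sum_(1 <= i < (k (hop v)).+1) Ex P (delay_stat X v 0 i).
Proof.
move=> X1 F.
have F0 c' x : 0 <= cfun c' F 0 x.
  by rewrite /cycle_fun /F; case: ifP => // _; exact: abs_ge0.
have mF c' : measurable_fun setT (cfun c' F 0).
  by apply: measurable_delivered_if; exact: measurable_delay.
have F1 : L1 P (cfun c F 0).
  apply: le_L1 (X1 c) => // x; rewrite ger0_norm// ger0_norm ?abs_ge0//.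
  by rewrite /cycle_fun /F; case: ifP => // _; exact: abs_ge0.
split=> //; apply: (mulfI (lt0r_neq0 n_gt0)).
rewrite mulrA mulfV ?lt0r_neq0 ?n_gt0// mul1r Ex_cycle_fun_sum//.
rewrite big_add1/= big_mkord.
rewrite -(@Ex_sum _ _ _ _ _ (fun i => delay_stat X v 0 i.+1)) => [|i _]; last exact: L1_delay_stat.
apply: ae_eq_Ex.
- by apply: measurable_sum => c'; exact: mF.
- by apply: measurable_sum => i; exact: measurable_delay_stat.
apply: filterS delays_distinct => x inj.
by rewrite (@sum_delivered x id)// big_add1/= big_mkord.
Qed.

End Exchangeability.

Lemma Ex_gt0 d (T : measurableType d) (R : realType) (P : probability T R) (f : T -> R) :
  L1 P f -> (forall x, 0 <= f x) -> {ae P, forall x, 0 < f x} -> 0 < Ex P f.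
Proof.
move=> f1 f0 fpos; rewrite lt_neqAle Ex_ge0// andbT; apply/eqP => Ef.
have mf : measurable_fun setT (EFin \o f).
  by apply/measurable_EFinP; exact: L1_measurable f1.
have : (\int[P]_x `|(EFin \o f) x| = 0)%E.
  under eq_integral => x _ do rewrite /= ger0_norm//.
  by rewrite ExE// -Ef.
move/(ae_eq_integral_abs P measurableT mf) => f00.
have : {ae P, forall x, False}.
  apply: filterS2 f00 fpos => x /(_ Logic.I) /= [->].
  by rewrite ltxx.
move=> [N [mN N0 sub]]; have := @probability_setT _ _ _ P.
have -> : setT = N by apply/seteqP; split => // x _; apply: sub.
by rewrite N0 => /esym/eqP; rewrite onee_eq0.
Qed.

Lemma independent_Ex (I : eqType) (R : realType) (P : probability (path_space I R) R)
    (D : pred I) (ind : mutually_independent P D (fun i (x : path_space I R) => x i))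
    (J1 J2 : pred I) (f g : path_space I R -> R) :
  {subset J1 <= D} -> {subset J2 <= D} -> (forall i, J1 i -> ~~ J2 i) ->
  L1 P f -> L1 P g -> (forall x, 0 <= f x) -> (forall x, 0 <= g x) ->
  depends_on J1 f -> depends_on J2 g ->
  L1 P (fun x => f x * g x) /\ Ex P (fun x => f x * g x) = Ex P f * Ex P g.
Proof.
move=> J1D J2D J12 f1 g1 f0 g0 fJ gJ.
have h : (\int[P]_x (f x * g x)%:E)%E = (Ex P f * Ex P g)%:E.
  under eq_integral do rewrite EFinM.
  rewrite (@independent_integralM _ _ _ _ ind J1 J2 (EFin \o f) (EFin \o g))//.
  - by rewrite /= !ExE.
  - by apply/measurable_EFinP; exact: L1_measurable f1.
  - by apply/measurable_EFinP; exact: L1_measurable g1.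
  - by move=> x y xy /=; rewrite (fJ _ _ xy).
  - by move=> x y xy /=; rewrite (gJ _ _ xy).
have fg1 : L1 P (fun x => f x * g x).
  apply: ge0_L1; last by rewrite h ltry.
    by apply: measurable_funM; [exact: L1_measurable f1|exact: L1_measurable g1].
  by move=> x; rewrite mulr_ge0.
by split=> //; apply: EFin_inj; rewrite -ExE.
Qed.

(** * Moments of cycle lengths and success gaps *)

Section Arrivals.
Variables (n : nat) (k : nat -> nat) (R : realType).
Local Notation Om := (path_space (primitive_index n) R).
Variable P : probability Om R.
Variables (L : nat) (e v : node n).
Local Notation D := (primitive_along L e).
Local Notation X := (abs_delay P).
Local Notation G := (abs_interarrival P).
Hypothesis ind : mutually_independent P D (fun i (x : Om) => x i).
Hypotheses (ve : suffix v e) (vL : (size v < L)%N) (v0 : v != [::]).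
Hypothesis idG : forall a a' (A : set R), measurable A ->
  P ((fun x : Om => x (inr (v, a))) @^-1` A) =
  P ((fun x : Om => x (inr (v, a'))) @^-1` A).
Hypothesis posG : {ae P, forall x, 0 < G v 0 x}.

Lemma inr_along b : D (inr (v, b)).
Proof. by rewrite /= ve vL lt0n size_eq0 v0. Qed.

Lemma measurable_interarrival b : measurable_fun setT (G v b : Om -> R).
Proof. exact: measurable_funPT. Qed.

Lemma integral_interarrival b (f : R -> R) : measurable_fun setT f -> (forall y, 0 <= f y) ->
  (\int[P]_x (f (G v b x))%:E = \int[P]_x (f (G v 0 x))%:E)%E.
Proof.
move=> mf f0; pose i0 : primitive_index n := inr (v, 0%N).
have := @reindex_integral _ _ _ _ ind
  (fun i => if i == i0 then inr (v, b) else i) (pred1 i0)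
  (fun x => (f (G v 0 x))%:E).
under eq_integral => x _ do rewrite /= /abs_coordinate eqxx.
apply.
- by move=> _ /eqP ->; exact: inr_along.
- by move=> _ /eqP ->; rewrite eqxx; exact: inr_along.
- by move=> _ _ /eqP -> /eqP ->.
- by move=> _ A /eqP -> mA; rewrite eqxx; exact: idG.
- by apply/measurable_EFinP/measurableT_comp => //; exact: measurable_interarrival.
- by move=> x; rewrite lee_fin.
- by move=> x y /(_ _ (eqxx _)) xy; rewrite /= /abs_coordinate xy.
Qed.

Lemma L1_interarrival b (f : R -> R) : measurable_fun setT f -> (forall y, 0 <= f y) ->
  L1 P (fun x => f (G v 0 x)) ->
  L1 P (fun x => f (G v b x)) /\ Ex P (fun x => f (G v b x)) = Ex P (fun x => f (G v 0 x)).
Proof.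
move=> mf f0 f1; have h := integral_interarrival b mf f0.
have f1' : L1 P (fun x => f (G v b x)).
  apply: ge0_L1 => //; first by apply: measurableT_comp => //; exact: measurable_interarrival.
  by rewrite h ExE// ltry.
by split=> //; apply: EFin_inj; rewrite -!ExE.
Qed.

Variable th : R.
Hypothesis th0 : 0 < th.

Definition laplace := Ex P (fun x => expR (- (th * G v 0 x))).

Lemma measurable_expRN : measurable_fun setT (fun y : R => expR (- (th * y))).
Proof.
apply: measurableT_comp => //; apply: measurable_funN; exact: measurable_funM.
Qed.

Lemma expRN_le1 (y : R) : 0 <= y -> expR (- (th * y)) <= 1.
Proof. by move=> y0; rewrite -expR0 ler_expR oppr_le0 mulr_ge0// ltW. Qed.

Lemma L1_expRN (f : Om -> R) : measurable_fun setT f -> (forall x, 0 <= f x) ->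
  L1 P (fun x => expR (- (th * f x))).
Proof.
move=> mf f0; apply: le_L1 (L1_cst P 1).
  exact: (measurableT_comp measurable_expRN).
by move=> x; rewrite normr1 ger0_norm ?expR_ge0// expRN_le1.
Qed.

Lemma laplace_ge0 : 0 <= laplace.
Proof. by apply: Ex_ge0 => x; exact: expR_ge0. Qed.

Lemma laplace_lt1 : laplace < 1.
Proof.
have L1G := L1_expRN (measurable_interarrival 0) (fun x => abs_ge0 _ x).
rewrite -subr_gt0 -[1](Ex_cst P 1) -ExB//; last exact: L1_cst.
apply: Ex_gt0; first by apply: L1B => //; exact: L1_cst.
  by move=> x; rewrite subr_ge0 expRN_le1// abs_ge0.
apply: filterS posG => x G0; rewrite subr_gt0 -expR0 ltr_expR oppr_lt0.
exact: mulr_gt0.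
Qed.

Lemma arrival_ge0 b x : 0 <= arrival G v b x.
Proof. by apply: sumr_ge0 => i _; exact: abs_ge0. Qed.

Definition first_interarrivals b : pred (primitive_index n) := fun i =>
  if i is inr (u, a) then (u == v) && (a < b)%N else false.

Lemma depends_on_arrival b : depends_on (first_interarrivals b) (arrival G v b).
Proof.
move=> x y xy; apply: eq_arrival => i ib; rewrite /= /abs_coordinate xy//.
by rewrite /= eqxx.
Qed.

Lemma first_interarrivals_sub b : {subset first_interarrivals b <= D}.
Proof. by case=> // -[u a] /andP[/eqP -> _]; exact: inr_along. Qed.

Lemma Ex_expRN_arrival b : Ex P (fun x => expR (- (th * arrival G v b x))) = laplace ^+ b.
Proof.
elim: b => [|b ih].
  rewrite expr0 -[RHS](Ex_cst P); apply: eq_Ex => x.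
  by rewrite /arrival big_ord0 mulr0 oppr0 expR0.
have L1G := L1_expRN (measurable_interarrival 0) (fun x => abs_ge0 _ x).
have [h1 h2] := L1_interarrival b measurable_expRN (fun y => expR_ge0 _) L1G.
have := @independent_Ex _ _ _ _ ind (first_interarrivals b) (pred1 (inr (v, b)))
  (fun x => expR (- (th * arrival G v b x))) (fun x => expR (- (th * G v b x))).
case=> //.
- exact: first_interarrivals_sub.
- by move=> _ /eqP ->; exact: inr_along.
- move=> i hi; apply/negP => /eqP ii; move: hi; rewrite ii /=.
  by rewrite eqxx ltnn.
- by apply: L1_expRN; [exact: measurable_arrival|exact: arrival_ge0].
- by move=> x y xy; rewrite (depends_on_arrival xy).
- by move=> x y /(_ _ (eqxx _)) xy; rewrite /= /abs_coordinate xy.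
move=> _; rewrite ih h2 -exprSr => <-.
by apply: eq_Ex => x; rewrite arrivalS mulrDr opprD expRD.
Qed.

(** The expectations of exp(-th S_b), with S_b the b-th arrival instant, are powers of a number
    below 1, hence summable; so exp(-th S_b) tends to 0 almost surely. Positivity of the
    interarrival times is what makes the ratio smaller than 1. *)
Lemma unbounded_arrivals_ae : {ae P, forall x, unbounded_arrivals G v x}.
Proof.
have mA b : measurable_fun setT (fun x => expR (- (th * arrival G v b x))).
  by apply: (measurableT_comp measurable_expRN); exact: measurable_arrival.
have L2A b : L2 P (fun x => expR (- (th * arrival G v b x))).
  apply: le_L2 (L2_cst P 1) => // x.
  by rewrite normr1 ger0_norm ?expR_ge0// expRN_le1// arrival_ge0.
have l01 : 0 <= laplace < 1 by rewrite laplace_ge0 laplace_lt1.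
have h : {ae P, forall x, (fun b => expR (- (th * arrival G v b x))) @ \oo --> 0}.
  apply: (@ae_cvg0_of_sum_squares _ _ _ _ _ (fun b => laplace ^+ b) (1 - laplace)^-1) => //.
    (* The values lie in [0, 1], so the second moment is at most the first, which is a power of
       [laplace]. *)
    move=> b; rewrite -Ex_expRN_arrival; apply: le_Ex; [exact: (L2A b).2|exact: L2_L1|].
    by move=> x; rewrite expr2 ler_piMl ?expR_ge0// expRN_le1// arrival_ge0.
  by move=> N; exact: geometric_sum_le.
apply: filterS h => x /cvgrPdist_lt hx _ K.
have [N _ /(_ N (leqnn N))] := hx (expR (- (th * K))) (expR_gt0 _).
rewrite /= sub0r normrN ger0_norm ?expR_ge0// ltr_expR ltrN2 ltr_pM2l// => /ltW KN.
by exists N.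
Qed.

End Arrivals.

(** Convexity of exp between 0 and y. After factoring out exp(l y) there remains a combination of
    two exponentials, bounded below by their tangent lines, whose linear parts cancel. *)
Lemma expR_convex_le (R : realType) (l y : R) : 0 <= l <= 1 ->
  expR (l * y) <= 1 - l + l * expR y.
Proof.
move=> /andP[l0 l1].
have -> : 1 - l + l * expR y =
    expR (l * y) * (l * expR ((1 - l) * y) + (1 - l) * expR (- (l * y))).
  rewrite mulrDr !(mulrCA (expR (l * y))) -!expRD subrr expR0.
  have -> : l * y + (1 - l) * y = y by ring.
  by ring.
rewrite -[leLHS]mulr1 ler_wpM2l ?expR_ge0//.
have h1 := ler_wpM2l l0 (expR_ge1Dx ((1 - l) * y)).
have l1' : 0 <= 1 - l by rewrite subr_ge0.
have h2 := ler_wpM2l l1' (expR_ge1Dx (- (l * y))).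
by apply: le_trans (lerD h1 h2); lra.
Qed.

Section CycleMoments.
Variables (n : nat) (k : nat -> nat) (R : realType).
Local Notation Om := (path_space (primitive_index n) R).
Variable P : probability Om R.
Variables (L : nat) (e v : node n).
Local Notation D := (primitive_along L e).
Local Notation X := (abs_delay P).
Local Notation G := (abs_interarrival P).
Hypothesis reg : regular_node P L e v.
Hypothesis atomless : forall j c (y : R), P [set x | x (inl (v, j, c)) = y] = 0%E.
Hypothesis kv : (0 < k (hop v) <= n)%N.
Hypothesis momX : forall c, exp_moment P (X v 0%N c : Om -> R).
Hypothesis posX : {ae P, forall x, forall j c, 0 < X v j c x}.
Hypothesis momG : v != [::] -> exp_moment P (G v 0%N : Om -> R).
Hypothesis posG : v != [::] -> {ae P, forall x, 0 < G v 0%N x}.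
Local Notation cfun := (cycle_fun k P v).
Local Notation service := (service k X v).
Local Notation cycle_length := (cycle_length k X G v).
Local Notation delivered := (delivered k X v).

Lemma exp_moment_service : exp_moment P (service 0).
Proof.
apply: (@le_exp_moment _ _ _ _ _ (fun x => \sum_(c < n) X v 0%N c x)).
- exact: measurable_delay_stat.
- by move=> x; apply: order_stat_le_sum => c; exact: abs_ge0.
have : forall s : seq 'I_n, exp_moment P (fun x => \sum_(c <- s) X v 0%N c x); last exact.
elim=> [|c s ih].
  have -> : (fun x : Om => \sum_(c <- [::]) X v 0%N c x) = fun=> 0.
    by apply/funext => x; rewrite big_nil.
  split; first exact: measurable_cst.
  by exists 1 => //; exact: L1_cst.
have -> : (fun x => \sum_(c <- c :: s) X v 0%N c x) =
        (fun x => X v 0%N c x + \sum_(c <- s) X v 0%N c x).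
  by apply/funext => x; rewrite big_cons.
apply: exp_momentD => // x; first exact: abs_ge0.
by apply: sumr_ge0 => i _; exact: abs_ge0.
Qed.

(** Let N be the number of the update that opens cycle 1. Then Y = S + G with S the arrival instant
    of update N-1, at most the service time s, and G the last gap; so th Y <= 2 th s - th S + th G.
    For each fixed value of N the right-hand side is a sum of independent terms, and the factor
    exp(-th S) makes the expectations geometric. *)
Lemma exp_moment_cycle_length : exp_moment P (cycle_length 0).
Proof.
have [ind ve vL idX idG unb] := reg.
have [v0|v0] := eqVneq v [::].
  have -> : cycle_length 0 = service 0.
    by apply/funext => x; rewrite v0 cycle_length_root.
  exact: exp_moment_service.
have {}idG := idG v0; have posGv := posG v0; have momGv := momG v0.
have [ms [t1 t10 s1]] := exp_moment_service; have [mG [t2 t20 G1]] := momGv.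
have s0 x : 0 <= service 0 x by apply: order_stat_ge0 => c; exact: abs_ge0.
(* The service time enters with exponent 2 th, hence t1/2. *)
pose th := Num.min (t1 / 2) t2.
have th0 : 0 < th by rewrite lt_min t20 divr_gt0.
have {}s1 : L1 P (fun x => expR (2 * th * service 0 x)).
  apply: exp_moment_le_theta s1 => //.
  by rewrite -ler_pdivlMl// mulrC ge_min lexx.
have {}G1 : L1 P (fun x => expR (th * G v 0 x)).
  apply: exp_moment_le_theta G1 => //; first by move=> x; exact: abs_ge0.
  by rewrite ge_min lexx orbT.
have mexp : measurable_fun setT (fun y : R => expR (th * y)).
  by apply: measurable_expRM.
pose phi := laplace P v th.
pose F b x := expR (2 * th * service 0 x) *
  (expR (- (th * arrival G v b x)) * expR (th * G v b x)).
have FE b : L1 P (F b) /\ Ex P (F b) =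
    Ex P (fun x => expR (2 * th * service 0 x)) * Ex P (fun x => expR (th * G v 0 x)) * phi ^+ b.
  have [h1 h2] := @L1_interarrival _ _ P L e v ind ve vL v0 idG b _ mexp (fun y => expR_ge0 _) G1.
  have h3 : L1 P (fun x => expR (- (th * arrival G v b x))).
    by apply: L1_expRN => //; [exact: measurable_arrival|exact: arrival_ge0].
  have [] := @independent_Ex _ _ _ _ ind (first_interarrivals v b) (pred1 (inr (v, b)))
    (fun x => expR (- (th * arrival G v b x))) (fun x => expR (th * G v b x)) => //.
  - exact: first_interarrivals_sub.
  - by move=> _ /eqP ->; exact: inr_along.
  - by move=> i hi; apply/negP => /eqP ii; move: hi; rewrite ii /= eqxx ltnn.
  - by move=> x y xy; rewrite (depends_on_arrival P xy).
  - by move=> x y /(_ _ (eqxx _)) xy; rewrite /= /abs_coordinate xy.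
  rewrite h2 (Ex_expRN_arrival ind ve vL v0 idG th0) => h4 h5.
  have [] := @independent_Ex _ _ _ _ ind
    (fun i => if i is inl (u, j, _) then (u == v) && (j == 0%N) else false)
    (first_interarrivals v b.+1) (fun x => expR (2 * th * service 0 x))
    (fun x => expR (- (th * arrival G v b x)) * expR (th * G v b x)) => //.
  - by move=> [[[u j] c]|[u a]] // /andP[/eqP -> _].
  - exact: first_interarrivals_sub.
  - by move=> [[[u j] c]|[u a]].
  - move=> x y xy; congr (expR (_ * _)); apply: eq_delay_stat => c.
    by rewrite /= /abs_coordinate xy//= !eqxx.
  - move=> x y xy; congr (expR (- (_ * _)) * expR (_ * _)).
      apply: eq_arrival => i ib; rewrite /= /abs_coordinate xy//= eqxx.
      exact: ltnW.
    by rewrite /= /abs_coordinate xy//= eqxx/=.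
  by rewrite h5 -/phi => h6 h7; split=> //; rewrite h7; ring.
have phi01 : 0 <= phi < 1 by rewrite laplace_ge0 laplace_lt1.
set K := Ex P (fun x => expR (2 * th * service 0 x)) * Ex P (fun x => expR (th * G v 0 x)) in FE.
split; first exact: measurable_cycle_length.
exists th => //; apply: (@L1_le_series _ _ _ _ _ F (fun b => K * phi ^+ b) (K * (1 - phi)^-1)).
- by apply: measurable_expRM; exact: measurable_cycle_length.
- by move=> x; exact: expR_ge0.
- by move=> b; exact: (FE b).1.
- by move=> b x; rewrite !mulr_ge0 ?expR_ge0.
- by move=> b; rewrite (FE b).2.
- move=> N; rewrite -mulr_sumr ler_wpM2l ?geometric_sum_le// mulr_ge0//;
    by apply: Ex_ge0 => x; exact: expR_ge0.
apply: filterS unb => x unbx.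
have G0 i : 0 <= G v i x by exact: abs_ge0.
have [_ h2] := @acceptedP _ _ _ P n k X G v 0 x v0 G0 unbx.
pose N := accepted k X G v x 1.
have N0 : (0 < N)%N by exact: (@accepted_ltS _ _ _ P n k X G v x 0).
exists N; rewrite -(prednK N0) big_ord_recr/=.
apply: (@le_trans _ _ (F N.-1 x)); last first.
  by rewrite lerDr; apply: sumr_ge0 => i _; rewrite !mulr_ge0 ?expR_ge0.
rewrite /F -!expRD ler_expR.
have -> : cycle_length 0 x = arrival G v N.-1 x + G v N.-1 x.
  rewrite cycle_lengthE// -arrivalS prednK//.
  have -> : served k X G v 0 x = 0%N by case: (v).
  have -> : served k X G v 1 x = N by rewrite /N; case: (v) v0.
  by rewrite [X in _ - X]/arrival big_ord0 subr0.
have : arrival G v N.-1 x <= service 0 x.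
  have [->|N1] := posnP N.-1; first by rewrite /arrival big_ord0.
  have := h2 N.-1; rewrite /= -/N N1/= prednK// leqnn => /(_ isT)/ltW.
  by rewrite /arrival big_ord0 add0r.
move: (G v N.-1 x) (arrival G v N.-1 x) (service 0 x) => g a s.
by move=> /(ler_wpM2l (ltW th0)); lra.
Qed.

Lemma cycle_length_nonneg j x : 0 <= cycle_length j x.
Proof.
apply: cycle_length_ge0 => [i c|i]; exact: abs_ge0.
Qed.

Lemma probability_delivered c :
  let F (a : R) (b : bool) (y : R) := if b then 1 else 0 : R in
  L1 P (cfun c F 0) /\ Ex P (cfun c F 0) = (k (hop v))%:R / n%:R.
Proof.
have [h1 h2] := @Ex_delivered _ _ _ _ _ _ _ reg atomless kv c (fun=> 1)
   (measurable_cst _) (fun=> ler01) (L1_cst P 1).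
by rewrite Ex_cst mulr1 in h2.
Qed.

(** A weight 1/2 per delivery encodes the number of deliveries as a product over cycles, to which
    regeneration applies. *)
Lemma prod_half (p : pred nat) J :
  \prod_(j < J) (if p j then 2^-1 else 1 : R) = 2^-1 ^+ count_before p J.
Proof.
elim: J => [|J ih]; first by rewrite big_ord0 /count_before big_ord0.
by rewrite big_ord_recr/= ih count_beforeS; case: (p J); rewrite ?addn1 ?addn0 ?exprSr ?mulr1.
Qed.

Lemma Ex_half_delivered c :
  let F (a : R) (b : bool) (y : R) := if b then 2^-1 else 1 : R in
  L1 P (cfun c F 0) /\ 0 <= Ex P (cfun c F 0) < 1.
Proof.
move=> F; have [h1 h2] := probability_delivered c.
have FE : cfun c F 0 = fun x =>
    1 - 2^-1 * cfun c (fun (a : R) (b : bool) (y : R) => if b then 1 else 0 : R) 0 x.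
  by apply/funext => x; rewrite /cycle_fun /F; case: ifP => _; lra.
have F1 : L1 P (cfun c F 0).
  by rewrite FE; apply: L1B; [exact: L1_cst|exact: L1Z].
split=> //; apply/andP; split.
  by apply: Ex_ge0 => x; rewrite /cycle_fun /F; case: ifP; rewrite ?invr_ge0.
rewrite FE ExB; [|exact: L1_cst|exact: L1Z].
rewrite Ex_cst ExZ// h2 ltrBlDr ltrDl mulr_gt0// ?invr_gt0// divr_gt0//.
  by rewrite ltr0n; case/andP: kv.
by rewrite (n_gt0 _ kv).
Qed.

(** The mean of 2^(-c_J), with c_J the number of deliveries before J, is geometric in J, so this
    variable tends to 0 almost surely; after a last delivery it would stay constant and positive. *)
Lemma infinitely_many_deliveries : {ae P, forall x, forall c j,
  exists2 i, (j <= i)%N & delivered c x i}.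
Proof.
apply: (@filter_forall _ _ (fun c x => forall j, exists2 i, (j <= i)%N & delivered c x i)) => c.
have [F1 F01] := Ex_half_delivered c.
set F := (fun (a : R) (b : bool) (y : R) => _) in F1 F01.
have F0 x : 0 <= cfun c F 0 x by rewrite /cycle_fun /F; case: ifP.
have [ind ve vL idX idG unb] := reg.
pose f J x := \prod_(j < J) cfun c F j x.
have fP J := regeneration_prod reg J F1 F0.
have fE J x : f J x = 2^-1 ^+ count_before (delivered c x) J.
  exact: prod_half.
have f01 J x : 0 <= f J x <= 1.
  by rewrite fE exprn_ge0 ?invr_ge0//= exprn_ile1 ?invr_ge0// invf_le1// ler1n.
have f2 J : L2 P (f J).
  apply: le_L2 (L2_cst P 1); first exact: L1_measurable (fP J).1.
  by move=> x; have /andP[h0 h1] := f01 J x; rewrite normr1 ger0_norm.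
have h : {ae P, forall x, (fun J => f J x) @ \oo --> 0}.
  apply: (@ae_cvg0_of_sum_squares _ _ _ _ _ (fun J => Ex P (cfun c F 0) ^+ J)
    (1 - Ex P (cfun c F 0))^-1) => //.
    move=> J; rewrite -(fP J).2; apply: le_Ex; [exact: (f2 J).2|exact: (fP J).1|].
    by move=> x; have /andP[h0 h1] := f01 J x; rewrite expr2 ler_piMl.
  by move=> N; exact: geometric_sum_le.
apply: filterS h => x /cvgrPdist_lt hx j; apply: contrapT => none.
have fc0 : 0 < f j x by rewrite fE exprn_gt0// invr_gt0.
have [N _ /(_ (maxn j N) (leq_maxr _ _))] := hx _ fc0.
rewrite /= sub0r normrN ger0_norm; last by case/andP: (f01 (maxn j N) x).
rewrite !fE (@count_before_const _ j) ?ltxx ?leq_maxl// => l /andP[jl _].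
by apply/negP => dl; apply: none; exists l.
Qed.

(** The delivery indicator and the length of one cycle are dependent, so the number of cycles cannot
    be separated from their lengths. Both enter a single factor per cycle, 1/2 upon delivery times
    exp(l th Y), whose mean g is below 1 for small l; the product over J cycles has mean g^J. *)
Lemma exp_moment_success_gap c : exp_moment P (success_gap k X G v c 0).
Proof.
have [ind ve vL idX idG unb] := reg.
have [H1 H01] := Ex_half_delivered c.
set H := (fun (a : R) (b : bool) (y : R) => _) in H1 H01.
have [mY [th th0 Y1]] := exp_moment_cycle_length.
set B := Ex P (fun x => expR (th * cycle_length 0 x)) in Y1 *.
have B0 : 0 <= B by apply: Ex_ge0 => x; exact: expR_ge0.
set q := Ex P (cfun c H 0) in H01 *; have /andP[q0 q1] := H01.
(* By convexity g <= (1 - l) q + l B, where q is the mean of the weight alone; this l makes the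
   bound at most q + (1 - q)/2. *)
pose l := (1 - q) / (2 * (1 + B)).
have B1 : 0 < 2 * (1 + B) by lra.
have l0 : 0 < l by rewrite divr_gt0// subr_gt0.
have lB : l * (1 + B) = (1 - q) / 2 by rewrite /l; field; rewrite gt_eqF//; lra.
have l1 : l <= 1 by rewrite ler_pdivrMr//; lra.
pose F (a : R) (b : bool) (y : R) := (if b then 2^-1 else 1) * expR (l * (th * y)) : R.
pose Bd x := (1 - l) * cfun c H 0 x + l * expR (th * cycle_length 0 x).
have Bd1 : L1 P Bd by apply: L1D; apply: L1Z.
have F0 x : 0 <= cfun c F 0 x.
  by rewrite /cycle_fun /F mulr_ge0 ?expR_ge0//; case: ifP.
have FBd x : cfun c F 0 x <= Bd x.
  rewrite /cycle_fun /F /Bd /cycle_fun /H.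
  have hc := @expR_convex_le R l (th * cycle_length 0 x).
  have {}hc := hc _; rewrite (ltW l0) l1 in hc; have {}hc := hc isT.
  have e0 := expR_ge0 (th * cycle_length 0 x).
  have lel : 0 <= l * expR (th * cycle_length 0 x) by rewrite mulr_ge0// ltW.
  by case: ifP => _; lra.
have mF : measurable_fun setT (cfun c F 0).
  apply: measurable_funM.
    by apply: measurable_fun_ifT => //; exact: measurable_delivered.
  have -> : (fun x => expR (l * (th * cycle_length 0 x))) =
     (fun x => expR ((l * th) * cycle_length 0 x)) by apply/funext => x; rewrite mulrA.
  exact: measurable_expRM.
have F1 : L1 P (cfun c F 0).
  apply: le_L1 Bd1 => // x; rewrite !ger0_norm//.
  exact: le_trans (F0 x) (FBd x).
set g := Ex P (cfun c F 0).
have g01 : 0 <= g < 1.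
  rewrite Ex_ge0//=; apply: le_lt_trans (le_Ex F1 Bd1 FBd) _.
  rewrite ExD ?ExZ//; [|exact: L1Z|exact: L1Z].
  rewrite -/q -/B.
  have : l * B <= l * (1 + B) by rewrite ler_pM2l//; lra.
  rewrite lB; have : 0 <= l * q by rewrite mulr_ge0// ltW.
  by rewrite mulrBl mul1r; lra.
(* The factor 2 undoes a single weight 1/2: exactly one delivery, the one that opens the gap,
   precedes the cycle that closes it. *)
pose f J x := 2 * \prod_(j < J) cfun c F j x.
have fP J : L1 P (f J) /\ Ex P (f J) = 2 * g ^+ J.
  have [h1 h2] := regeneration_prod reg J F1 F0.
  by split; [exact: L1Z|rewrite ExZ// h2].
have fE J x : f J x = 2 * (2^-1 ^+ count_before (delivered c x) J *
    expR (l * th * \sum_(j < J) cycle_length j x)).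
  rewrite /f /cycle_fun /F big_split/= prod_half; congr (_ * (_ * _)).
  elim: J => [|J ih]; first by rewrite !big_ord0 mulr0 expR0.
  by rewrite !big_ord_recr/= ih -expRD; congr expR; ring.
have f0 J x : 0 <= f J x by rewrite fE !mulr_ge0 ?expR_ge0 ?exprn_ge0 ?invr_ge0.
split; first exact: measurable_success_gap.
exists (l * th); first exact: mulr_gt0.
apply: (@L1_le_series _ _ _ _ _ f (fun J => 2 * g ^+ J) (2 * (1 - g)^-1)).
- by apply: measurable_expRM; exact: measurable_success_gap.
- by move=> x; exact: expR_ge0.
- by move=> J; exact: (fP J).1.
- exact: f0.
- by move=> J; rewrite (fP J).2.
- by move=> N; rewrite -mulr_sumr ler_wpM2l// geometric_sum_le.
apply: filterS infinitely_many_deliveries => x /(_ c) inf.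
pose J := delivery_cycle k X v c 1 x.
have [_ cJ] := nth_indexP 1 inf.
exists J.+1; rewrite big_ord_recr/=; apply: (@le_trans _ _ (f J x)); last first.
  by rewrite lerDr sumr_ge0.
rewrite fE cJ expr1 mulrA mulfV ?mul1r ?pnatr_eq0// ler_expR ler_wpM2l//.
  by rewrite mulr_ge0// ltW.
rewrite /success_gap -/J.
pose J0 := delivery_cycle k X v c 0 x.
have J01 : (J0 <= J)%N by exact/ltnW/nth_index_ltS.
rewrite -(big_mkord xpredT (fun j => cycle_length j x)) [leRHS](@big_cat_nat _ _ _ J0)//.
by rewrite lerDr; apply: sumr_ge0 => i _; exact: cycle_length_nonneg.
Qed.

Lemma service_gt0 j x : (forall i c, 0 < X v i c x) -> 0 < service j x.
Proof.
move=> X0; have [c] := @order_stat_mem _ _ (k (hop v)) (fun c => X v j c x) kv.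
by rewrite /Defs.service /delay_stat => ->.
Qed.

Lemma success_gap_gt0 c : {ae P, forall x, 0 < success_gap k X G v c 0 x}.
Proof.
have [ind ve vL idX idG unb] := reg.
apply: filterS2 unb posX => x unbx X0.
rewrite /success_gap big_ltn; last exact: nth_index_ltS.
apply: ltr_wpDr; first by apply: sumr_ge0 => i _; exact: cycle_length_nonneg.
apply: lt_le_trans (service_gt0 _ X0) _; apply: service_le_cycle_length => // i.
exact: abs_ge0.
Qed.

End CycleMoments.

Lemma same_law_integral d (T : measurableType d) (R : realType) (P : probability T R)
    (X Y : T -> R) (f : R -> R) :
  measurable_fun setT X -> measurable_fun setT Y ->
  (forall A : set R, measurable A -> P (X @^-1` A) = P (Y @^-1` A)) ->
  measurable_fun setT f -> (forall y, 0 <= f y) ->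
  (\int[P]_x (f (X x))%:E = \int[P]_x (f (Y x))%:E)%E.
Proof.
move=> mX mY XY mf f0.
pose X' : {RV P >-> R} := HB.pack X (isMeasurableFun.Build _ _ _ _ X mX).
pose Y' : {RV P >-> R} := HB.pack Y (isMeasurableFun.Build _ _ _ _ Y mY).
have mf' : measurable_fun setT (EFin \o f) by exact/measurable_EFinP.
have f0' y : (0 <= (EFin \o f) y)%E by rewrite lee_fin.
transitivity (\int[distribution P X']_y (f y)%:E)%E.
  by rewrite (ge0_integral_distribution X' mf' f0').
rewrite -[RHS](ge0_integral_distribution Y' mf' f0').
by apply: eq_measure_integral => A mA _; exact: XY.
Qed.

Lemma measure_ae_eq d (T : measurableType d) (R : realType) (P : probability T R)
    (A B : set T) : measurable A -> measurable B ->
  {ae P, forall x, A x <-> B x} -> P A = P B.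
Proof.
move=> mA mB AB; rewrite -[in LHS](setIT A) -[in RHS](setIT B) -!integral_indic//.
apply: (@ge0_ae_eq_integral _ _ _ P setT (fun x => (\1_A x)%:E) (fun x => (\1_B x)%:E)) => //.
- exact/measurable_EFinP/measurable_indic.
- exact/measurable_EFinP/measurable_indic.
apply: filterS AB => x ABx _; rewrite !indicE; congr (_%:R%:E); congr nat_of_bool.
by apply/idP/idP; rewrite !inE => /ABx.
Qed.

Lemma ae_exp_moment d (T : measurableType d) (R : realType) (P : probability T R)
    (f g : T -> R) : measurable_fun setT g -> {ae P, forall x, f x = g x} ->
  exp_moment P f -> exp_moment P g.
Proof.
move=> mg fg [mf [th th0 h]]; split=> //; exists th => //.
apply: ge0_L1; [exact: measurable_expRM|by move=> x; exact: expR_ge0|].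
have <- : (\int[P]_x (expR (th * f x))%:E = \int[P]_x (expR (th * g x))%:E)%E.
  apply: (@ge0_ae_eq_integral _ _ _ P setT (fun x => (expR (th * f x))%:E)
    (fun x => (expR (th * g x))%:E)) => //.
  - by apply/measurable_EFinP/measurable_expRM.
  - by apply/measurable_EFinP/measurable_expRM.
  by apply: filterS fg => x /= -> _.
by rewrite ExE// ltry.
Qed.

(** * Induction along a path of the tree *)

Section EqualSamples.
Context d d' (T : measurableType d) (T' : measurableType d') (R : realType).
Context (P : probability T R) (P' : probability T' R).
Variables (n : nat) (k : nat -> nat).
Variables (X : node n -> nat -> 'I_n -> {RV P >-> R}) (G : node n -> nat -> {RV P >-> R}).
Variables (X' : node n -> nat -> 'I_n -> {RV P' >-> R}) (G' : node n -> nat -> {RV P' >-> R}).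
Variables (w : T) (w' : T').

Section Node.
Variable v : node n.
Hypothesis eqX : forall j c, X v j c w = X' v j c w'.
Hypothesis eqG : v != [::] -> forall a, G v a w = G' v a w'.

(** Two families of variables, possibly on different spaces, are compared at one sample point of
    each. These comparisons serve both to see on which primitives a quantity depends and to pass
    between the given space, the raw coordinates and their absolute values. *)
Lemma eq_service j : service k X v j w = service k X' v j w'.
Proof. by congr (order_stat _ _); apply/funext => c; exact: eqX. Qed.

Lemma eq_served j : served k X G v j w = served k X' G' v j w'.
Proof.
case: (v) eq_service eqG => // c p eqs /(_ isT) eqg.
have eqa a : arrival G (c :: p) a w = arrival G' (c :: p) a w'.
  by apply: eq_bigr => b _; exact: eqg.
elim: j => //= j; rewrite /served => ->.
by apply: eq_next_index => b; rewrite !eqa eqs.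
Qed.

Lemma eq_cycle_length j : cycle_length k X G v j w = cycle_length k X' G' v j w'.
Proof.
have [v0|v0] := eqVneq v [::].
  by have := eq_service j; rewrite v0 !cycle_length_root.
rewrite !cycle_lengthE// !eq_served.
by congr (_ - _); apply: eq_bigr => b _; exact: eqG.
Qed.

Lemma eq_delivery_cycle c m : delivery_cycle k X v c m w = delivery_cycle k X' v c m w'.
Proof.
rewrite /delivery_cycle; congr (Defs.nth_index _ m).
by apply/funext => j; rewrite /delivered eqX eq_service.
Qed.

Lemma eq_success_gap c m : success_gap k X G v c m w = success_gap k X' G' v c m w'.
Proof.
rewrite /success_gap !eq_delivery_cycle.
by apply: eq_bigr => j _; exact: eq_cycle_length.
Qed.

End Node.

Variable e : node n.
Hypothesis eqX : forall v, suffix v e -> (size v < size e)%N ->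
  forall j c, X v j c w = X' v j c w'.
Hypothesis eqG : forall v, suffix v e -> (size v < size e)%N ->
  v != [::] -> forall a, G v a w = G' v a w'.

Lemma suffix_cons_parent c (p : node n) : suffix (c :: p) e ->
  suffix p e /\ (size p < size e)%N.
Proof.
move=> h; split; last exact: size_suffix h.
by apply: suffix_trans h; exact: suffix_cons.
Qed.

Lemma eq_transit v m : suffix v e -> transit k X G v m w = transit k X' G' v m w'.
Proof.
elim: v m => //= c p ih m /suffix_cons_parent[pe pL].
rewrite (eq_delivery_cycle (eqX pe pL)) (eqX pe pL).
by rewrite (eq_served (eqX pe pL) (@eqG p pe pL)) ih.
Qed.

Lemma eq_first_arrival v : suffix v e -> first_arrival k X G v w = first_arrival k X' G' v w'.
Proof.
elim: v => //= c p ih /suffix_cons_parent[pe pL].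
rewrite (eq_delivery_cycle (eqX pe pL)) (eqX pe pL) ih//.
congr (_ + _ + _); apply: eq_bigr => i _.
exact: (eq_cycle_length (eqX pe pL) (@eqG p pe pL)).
Qed.

Lemma eq_receipt v m : suffix v e -> receipt k X G v m w = receipt k X' G' v m w'.
Proof.
case: v => //= c p /suffix_cons_parent[pe pL].
rewrite (eq_delivery_cycle (eqX pe pL)) (eqX pe pL) eq_first_arrival//.
congr (_ + _ + _); apply: eq_bigr => i _.
exact: (eq_cycle_length (eqX pe pL) (@eqG p pe pL)).
Qed.

Lemma eq_age t : age k X G e t w = age k X' G' e t w'.
Proof.
have ee := suffix_refl e.
have luE : last_update k X G e t w = last_update k X' G' e t w'.
  rewrite /last_update; congr (xget _ _); apply/seteqP.
  by split=> m /=; rewrite !eq_receipt.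
by rewrite /age luE eq_receipt// /time_stamp eq_receipt// eq_transit.
Qed.

End EqualSamples.

Section Induction.
Variables (n : nat) (k : nat -> nat) (R : realType).
Local Notation Om := (path_space (primitive_index n) R).
Variable P : probability Om R.

Definition raw_delay (v : node n) (j : nat) (c : 'I_n) : {RV P >-> R} :=
  coordinate (inl (v, j, c)).
Definition raw_interarrival (v : node n) (a : nat) : {RV P >-> R} :=
  coordinate (inr (v, a)).

Variables (L : nat) (shift rate : nat -> R) (e : node n).
Hypothesis k_bounds : forall l : nat, (1 <= l <= L)%N -> (1 <= k l <= n)%N.
Hypothesis shift_ge0 : forall l : nat, (1 <= l <= L)%N -> 0 <= shift l.
Hypothesis rate_gt0 : forall l : nat, (1 <= l <= L)%N -> 0 < rate l.
Hypothesis network : multicast_network k raw_delay raw_interarrival L shift rate.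
Hypothesis e_end : size e = L.

Local Notation X := (abs_delay P).
Local Notation G := (abs_interarrival P).

Lemma success_gap_raw_abs v c m (x : Om) : (forall j d, 0 <= raw_delay v j d x) ->
  (v != [::] -> forall a, 0 <= raw_interarrival v a x) ->
  success_gap k raw_delay raw_interarrival v c m x = success_gap k X G v c m x.
Proof.
move=> X0 G0; apply: eq_success_gap => [j d|v0 a].
  by have := X0 j d; rewrite /raw_delay /= /coordinate /abs_coordinate => /ger0_norm ->.
by have := G0 v0 a; rewrite /raw_interarrival /= /coordinate /abs_coordinate => /ger0_norm ->.
Qed.

Section Node.
Variable v : node n.
Hypothesis vL : (size v < L)%N.

Let hv : (1 <= hop v <= L)%N.
Proof. by rewrite /hop ltnS leq0n. Qed.

Lemma node_k_bounds : (0 < k (hop v) <= n)%N.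
Proof. exact: k_bounds. Qed.

Lemma raw_delay_gt0 : {ae P, forall x, forall j c, 0 < raw_delay v j c x}.
Proof.
apply/ae_foralln => j.
apply: (@filter_forall _ _ (fun c x => 0 < raw_delay v j c x)) => c.
exact: (shifted_exponential_gt0 (shift_ge0 hv) (link_delay_law network j c vL)).
Qed.

Lemma delay_gt0 : {ae P, forall x, forall j c, 0 < X v j c x}.
Proof.
apply: filterS raw_delay_gt0 => x h j c.
by have := h j c; rewrite /= /abs_coordinate normr_gt0 => /gt_eqF ->.
Qed.

Lemma delay_atomless j c (y : R) : P [set x | x (inl (v, j, c)) = y] = 0%E.
Proof. exact: (shifted_exponential_eq0 (link_delay_law network j c vL)). Qed.

Lemma delay_exp_moment c : exp_moment P (X v 0%N c : Om -> R).
Proof.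
apply: (@ae_exp_moment _ _ _ _ (raw_delay v 0%N c)).
- exact: measurable_delay.
- apply: filterS raw_delay_gt0 => x /(_ 0%N c) h.
  by rewrite /= /abs_coordinate gtr0_norm.
exact: (shifted_exponential_exp_moment (rate_gt0 hv)
  (link_delay_law network 0%N c vL)).
Qed.

Lemma delay_same_law j c j' c' (A : set R) : measurable A ->
  P ((fun x : Om => x (inl (v, j, c))) @^-1` A) =
  P ((fun x : Om => x (inl (v, j', c'))) @^-1` A).
Proof.
move=> mA; transitivity (exponential_prob (rate (hop v)) ((fun x => shift (hop v) + x) @^-1` A)).
  exact: (link_delay_law network j c vL mA).
exact/esym/(link_delay_law network j' c' vL mA).
Qed.

End Node.

(** The part of the induction hypothesis handed from a parent to its child. Positivity is stated for
    the raw variables, so that these coincide almost surely with their absolute values. *)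
Definition positive_interarrivals v :=
  v != [::] -> exp_moment P (G v 0%N : Om -> R) /\
    {ae P, forall x, forall a, 0 < raw_interarrival v a x}.

Lemma raw_independent : mutually_independent P (primitive_along L e) (fun i (x : Om) => x i).
Proof.
have -> : (fun i (x : Om) => x i) = primitive raw_delay raw_interarrival.
  by apply/funext => -[[[v j] c]|[v a]].
exact: (independence network e_end).
Qed.

(** The interarrival law at [c :: p] is that of a success gap at p. Exponential moments and
    positivity of the gap, which follow from regularity of p, thus pass to the interarrival times at
    [c :: p]; positivity in turn gives unbounded arrivals there. *)
Theorem path_node_regular v : suffix v e -> (size v < L)%N ->
  regular_node P L e v /\ positive_interarrivals v.
Proof.
elim: v => [|c p ih] ve vL.
  split=> //; split=> //.
  - exact: raw_independent.
  - by move=> *; exact: delay_same_law.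
  - exact: aeW.
have pe : suffix p e by apply: suffix_trans ve; exact: suffix_cons.
have pL : (size p < L)%N by exact: ltn_trans vL.
have [reg pos] := ih pe pL.
have posG : p != [::] -> {ae P, forall x, 0 < G p 0%N x}.
  move=> p0; have [_ h] := pos p0; apply: filterS h => x /(_ 0%N).
  by rewrite /= /abs_coordinate normr_gt0 => /gt_eqF ->.
have momG : p != [::] -> exp_moment P (G p 0%N : Om -> R) by move=> p0; have [] := pos p0.
pose S := success_gap k X G p c 0.
have S_mom : exp_moment P S.
  exact: (exp_moment_success_gap reg (delay_atomless pL) (node_k_bounds pL)
    (delay_exp_moment pL) momG posG).
have S_pos : {ae P, forall x, 0 < S x}.
  exact: (success_gap_gt0 reg (node_k_bounds pL) (delay_gt0 pL)).
(* Every interarrival time is compared with the gap number 0, which makes them identically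
   distributed. *)
have lawS a (A : set R) : measurable A ->
    P (raw_interarrival (c :: p) a @^-1` A) = P (S @^-1` A).
  move=> mA; rewrite (interarrival_law network c a 0 vL mA).
  have SS : {ae P, forall x, success_gap k raw_delay raw_interarrival p c 0 x = S x}.
    have G0 : {ae P, forall x, p != [::] -> forall a, 0 < raw_interarrival p a x}.
      have [p0|p0] := eqVneq p [::]; first by apply: aeW => x; rewrite p0.
      by apply: filterS (pos p0).2.
    apply: filterS2 (raw_delay_gt0 pL) G0 => x X0 {}G0; apply: success_gap_raw_abs.
      by move=> j d; exact/ltW/X0.
    by move=> p0 b; exact/ltW/G0.
  apply: measure_ae_eq => //.
  - by rewrite -[X in measurable X]setTI; apply: measurable_success_gap.
  - by rewrite -[X in measurable X]setTI; apply: measurable_success_gap.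
  by apply: filterS SS => x /= ->; split.
have mS : measurable_fun setT S by exact: measurable_success_gap.
have pos0 a : {ae P, forall x, 0 < raw_interarrival (c :: p) a x}.
  have mle : measurable [set y : R | y <= 0].
    by have := measurable_itv (`]-oo, 0%R] : interval R); rewrite set_itvNyc.
  exists (raw_interarrival (c :: p) a @^-1` [set y | y <= 0]); split.
  - by rewrite -[X in measurable X]setTI; exact: measurable_funPT.
  - rewrite lawS//; have := S_pos; rewrite /almost_everywhere => h.
    apply: measure_negligible; first by rewrite -[X in measurable X]setTI; exact: mS.
    by apply: negligibleS h => x /= h' /(le_lt_trans h'); rewrite ltxx.
  - by move=> x /= /negP; rewrite -leNgt.
have pos0' : {ae P, forall x, forall a, 0 < raw_interarrival (c :: p) a x}.
  exact/ae_foralln.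
have law a a' (A : set R) : measurable A ->
    P ((fun x : Om => x (inr (c :: p, a))) @^-1` A) =
    P ((fun x : Om => x (inr (c :: p, a'))) @^-1` A).
  by move=> mA; transitivity (P (S @^-1` A)); [exact: lawS|exact/esym/lawS].
have posG0 : {ae P, forall x, 0 < G (c :: p) 0%N x}.
  apply: filterS (pos0 0%N) => x h; rewrite /= /abs_coordinate normr_gt0.
  by rewrite gt_eqF.
split.
  split=> //.
  - exact: raw_independent.
  - by move=> *; exact: delay_same_law.
  - exact: (unbounded_arrivals_ae raw_independent ve vL isT law posG0 ltr01).
move=> _; split=> //.
have [_ [th th0 S1]] := S_mom; split; first exact: measurable_interarrival.
exists th => //; apply: ge0_L1.
- by apply: measurable_expRM; exact: measurable_interarrival.
- by move=> x; exact: expR_ge0.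
have mf : measurable_fun setT (fun y : R => expR (th * `|y|)).
  by apply: measurable_expRM; exact: normr_measurable.
have mraw : measurable_fun setT (raw_interarrival (c :: p) 0%N : Om -> R).
  exact: measurable_funPT.
have -> : (\int[P]_x (expR (th * G (c :: p) 0%N x))%:E = \int[P]_x (expR (th * `|S x|))%:E)%E.
  exact: (same_law_integral mraw mS (lawS 0%N) mf (fun y => expR_ge0 _)).
have -> : (\int[P]_x (expR (th * `|S x|))%:E = \int[P]_x (expR (th * S x))%:E)%E.
  apply: eq_integral => x _; rewrite ger0_norm//.
  by apply: sumr_ge0 => i _; exact: cycle_length_nonneg.
by rewrite ExE// ltry.
Qed.

End Induction.

Lemma count_before_gt (p : pred nat) i j : (count_before p i < count_before p j)%N ->
  exists2 l, (i <= l < j)%N & p l.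
Proof.
move=> lt; have ij : (i <= j)%N.
  by rewrite leqNgt; apply/negP => /ltnW /(count_before_mono p); rewrite leqNgt lt.
apply: contrapT => h; move: lt; rewrite (@count_before_const p i j) ?ltnn// => l il.
by apply/negP => pl; apply: h; exists l.
Qed.

(** Once more than m indices below j satisfy p, the m-th one is settled by the values of p below j,
    whatever happens later. An earlier delivery thus belongs to the past of cycle j. *)
Lemma nth_index_prefix (p : pred nat) m j : (m < count_before p j)%N ->
  [/\ (Defs.nth_index p m < j)%N, p (Defs.nth_index p m),
      count_before p (Defs.nth_index p m) = m &
      forall q : pred nat, (forall i, (i < j)%N -> p i = q i) ->
        Defs.nth_index q m = Defs.nth_index p m].
Proof.
have key i0 : (count_before p i0 < count_before p j)%N ->
    [/\ (i0 <= next_index p i0 < j)%N, p (next_index p i0),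
        count_before p (next_index p i0) = count_before p i0 &
        forall q : pred nat, (forall i, (i < j)%N -> p i = q i) ->
          next_index q i0 = next_index p i0].
  move=> /count_before_gt[l /andP[i0l lj] pl].
  have ex : exists i, (i0 <= i)%N && p i by exists l; rewrite i0l.
  have [h1 h2 h3] := next_indexP ex.
  have lt : (next_index p i0 < j)%N.
    rewrite ltnNge; apply/negP => h4; have := h3 l; rewrite i0l pl (leq_trans lj h4).
    by move=> /(_ isT).
  rewrite h1 lt; split=> //; first exact: count_before_const.
  move=> q pq; apply: next_index_eq => //; first by rewrite -pq.
  move=> i /andP[i0i il]; rewrite -pq; last exact: ltn_trans lt.
  by apply: h3; rewrite i0i.
elim: m => [|m ih] mj /=.
  have c0 : count_before p 0 = 0%N by rewrite /count_before big_ord0.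
  have := key 0%N; rewrite c0 => /(_ mj) [/andP[_ k2] k3 k4 k5].
  by split.
have [h1 h2 h3 h4] := ih (ltnW mj).
have cS : count_before p (Defs.nth_index p m).+1 = m.+1.
  by rewrite count_beforeS h2 h3 addn1.
have [] := key (Defs.nth_index p m).+1; first by rewrite cS.
move=> /andP[k1 k2] k3 k4 k5; split=> //; first by rewrite k4.
by move=> q pq /=; rewrite (h4 q pq) k5.
Qed.

(** * Transit times *)

Section Stopping.
Variables (n : nat) (k : nat -> nat) (R : realType).
Local Notation Om := (path_space (primitive_index n) R).
Variable P : probability Om R.
Variables (L : nat) (e v : node n).
Local Notation X := (abs_delay P).
Local Notation G := (abs_interarrival P).
Hypothesis reg : regular_node P L e v.
Hypothesis atomless : forall j c (y : R), P [set x | x (inl (v, j, c)) = y] = 0%E.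
Hypothesis kv : (0 < k (hop v) <= n)%N.
Local Notation cfun := (cycle_fun k P v).
Local Notation delivered := (delivered k X v).
Local Notation delivery_cycle := (delivery_cycle k X v).
Local Notation past := (past k P L e v).

Lemma delivered_past_lt c i j : (i < j)%N -> past j (fun x => delivered c x i).
Proof.
have [ind ve vL _ _ _] := reg.
by move=> ij; apply: (past_le ij); exact: delivered_past.
Qed.

Lemma count_before_past c j : past j (fun x => count_before (delivered c x) j).
Proof.
move=> x y unb h; apply: eq_bigr => i _.
by rewrite (delivered_past_lt c (ltn_ord i) unb h).
Qed.

(* U is known at the start of every cycle preceded by exactly m deliveries to c,
   before it is decided whether that cycle delivers to c. *)
Definition past_delivery (c : 'I_n) m (U : Om -> R) := forall j,
  past j (fun x => if count_before (delivered c x) j == m then U x else 0).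

Lemma past_delivery1 c m : past_delivery c m (fun=> 1).
Proof. by move=> j x y unb h; rewrite (count_before_past c unb h). Qed.

Lemma past_delivery_delay c m m' : (m < m')%N ->
  past_delivery c m' (fun x => X v (delivery_cycle c m x) c x).
Proof.
have [ind ve vL _ _ _] := reg.
move=> mm' j x y unb h; rewrite (count_before_past c unb h).
case: eqP => // cy; rewrite -(count_before_past c unb h) in cy.
have mlt : (m < count_before (delivered c x) j)%N by rewrite cy.
have [h1 h2 h3 h4] := nth_index_prefix mlt.
have -> : delivery_cycle c m y = delivery_cycle c m x.
  by apply: h4 => i ij; exact: (delivered_past_lt c ij unb h).
exact: (past_le h1 (@delay_past _ _ _ P _ _ _ vL _ c) unb h).
Qed.

(** A Wald-type identity. Summing over the cycle j of the m-th delivery, regeneration separates U,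
    on the event of m deliveries before j, from cycle j itself; what remains is a sum over j common
    to all F. The case F = 1 evaluates it as E[U]/p0 with p0 = k/n, so F of the delivered delay
    contributes its mean conditional on delivery. *)
Lemma delivery_cycle_stop c m (U : Om -> R) (F : R -> R) :
  {ae P, forall x, forall c j, exists2 i, (j <= i)%N & delivered c x i} ->
  measurable_fun setT U -> (forall x, 0 <= U x) -> L1 P U -> past_delivery c m U ->
  measurable_fun setT F -> (forall y, 0 <= F y) ->
  let FD (a : R) (b : bool) (y : R) := if b then F a else 0 in
  L1 P (cfun c FD 0) ->
  L1 P (fun x => U x * F (X v (delivery_cycle c m x) c x)) /\
  Ex P (fun x => U x * F (X v (delivery_cycle c m x) c x)) =
    Ex P U * (Ex P (cfun c FD 0) / ((k (hop v))%:R / n%:R)).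
Proof.
move=> inf mU U0 U1 pU mF F0 FD FD1.
have [ind ve vL _ _ unb] := reg.
pose Uj j x := if count_before (delivered c x) j == m then U x else 0.
have mcount j : measurable_fun setT (fun x => count_before (delivered c x) j == m).
  apply: (measurableT_comp (f := fun a => a == m) _ _) => //.
  by apply: measurable_count_before => i; exact: measurable_delivered.
have mUj j : measurable_fun setT (Uj j).
  exact: measurable_fun_ifT.
have Uj1 j : L1 P (Uj j).
  apply: le_L1 U1 => // x; rewrite /Uj; case: ifP => // _.
  by rewrite normr0.
have Uj0 j x : 0 <= Uj j x by rewrite /Uj; case: ifP.
have mN : measurable_fun setT (delivery_cycle c m) by exact: measurable_delivery_cycle.
have n0 := n_gt0 R kv.
have p0 : 0 < (k (hop v))%:R / n%:R :> R.
  by rewrite divr_gt0// ltr0n; case/andP: kv.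
have key (H : R -> R) : measurable_fun setT H -> (forall y, 0 <= H y) ->
    let HD (a : R) (b : bool) (y : R) := if b then H a else 0 in
    L1 P (cfun c HD 0) ->
    (\int[P]_x (U x * H (X v (delivery_cycle c m x) c x))%:E =
     (Ex P (cfun c HD 0))%:E * \sum_(j <oo) (Ex P (Uj j))%:E)%E.
  move=> mH H0 HD HD1.
  have HD0 j x : 0 <= cfun c HD j x.
    by rewrite /cycle_fun /HD; case: ifP.
  have mUH : measurable_fun setT (fun x => U x * H (X v (delivery_cycle c m x) c x)).
    apply: measurable_funM => //; apply: (measurableT_comp mH).
    apply: (measurable_countable_case (f := fun j x => X v j c x)).
      exact: mN.
    by move=> j; exact: measurable_delay.
  rewrite (integral_partition P mN); last 2 first.
  - exact/measurable_EFinP.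
  - by move=> x; rewrite lee_fin mulr_ge0.
  rewrite -nneseriesZl; last by move=> j _; rewrite lee_fin Ex_ge0.
  apply: eq_eseriesr => j _.
  have [h1 h2] := regeneration_Ex reg (Uj1 j) (pU j) HD1 (HD0 0%N).
  rewrite -EFinM mulrC -h2 -ExE// integral_mkcond.
  apply: (@ge0_ae_eq_integral _ _ _ P setT) => //.
  - apply: (iffLR (measurable_restrictT _ (measurable_preimage_nat j mN))).
    by apply: measurable_funTS; exact/measurable_EFinP.
  - by apply/measurable_EFinP; exact: L1_measurable h1.
  - by move=> x _; rewrite patchE; case: ifP => // _; rewrite lee_fin mulr_ge0.
  - by move=> x _; rewrite lee_fin mulr_ge0.
  apply: filterS inf => x /(_ c) infc _; rewrite patchE.
  have := nth_index_eq m j infc; rewrite -/(delivery_cycle c m x).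
  rewrite /Uj /cycle_fun /HD.
  have [dj|dj] := eqVneq (delivery_cycle c m x) j.
    by rewrite mem_set// => /esym/andP[-> ->]; rewrite dj.
  rewrite memNset; last exact/eqP.
  by move=> /esym/negbT; rewrite negb_and => /orP[/negbTE ->|/negbTE ->];
    rewrite ?mulr0 ?mul0r.
have [H1 H2] := probability_delivered reg atomless kv c.
have e1 := key (fun=> 1) (measurable_cst _) (fun=> ler01) H1.
rewrite H2 in e1.
have {}e1 : ((Ex P U)%:E = ((k (hop v))%:R / n%:R)%:E * \sum_(j <oo) (Ex P (Uj j))%:E)%E.
  by rewrite -e1 -ExE//; apply: eq_integral => x _; rewrite mulr1.
have sE : (\sum_(j <oo) (Ex P (Uj j))%:E = (Ex P U / ((k (hop v))%:R / n%:R))%:E)%E.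
  rewrite mulrC EFinM e1 muleA -EFinM mulVf ?mul1e//.
  by rewrite gt_eqF.
have e2 := key F mF F0 FD1.
have e3 : (\int[P]_x (U x * F (X v (delivery_cycle c m x) c x))%:E =
   (Ex P U * (Ex P (cfun c FD 0) / ((k (hop v))%:R / n%:R)))%:E)%E.
  by rewrite e2 sE -EFinM; congr EFin; ring.
have UF1 : L1 P (fun x => U x * F (X v (delivery_cycle c m x) c x)).
  apply: ge0_L1; last by rewrite e3 ltry.
    apply: measurable_funM => //; apply: (measurableT_comp mF).
    apply: (measurable_countable_case (f := fun j x => X v j c x)).
      exact: mN.
    by move=> j; exact: measurable_delay.
  by move=> x; rewrite mulr_ge0.
by split=> //; apply: EFin_inj; rewrite -ExE.
Qed.

End Stopping.

Section TransitStep.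
Variables (n : nat) (k : nat -> nat) (R : realType).
Local Notation Om := (path_space (primitive_index n) R).
Variable P : probability Om R.
Variables (L : nat) (e p : node n).
Local Notation D := (primitive_along L e).
Local Notation X := (abs_delay P).
Local Notation G := (abs_interarrival P).

(** Disjoint from the primitives of p, including its interarrival times. Hence transit times to p
    are independent of the cycles of p and of the numbers of the updates it serves. *)
Definition above (p : node n) : pred (primitive_index n) := fun i =>
  D i && match i with
  | inl (u, _, _) => (size u < size p)%N
  | inr (u, _) => (size u < size p)%N
  end.

(** [transit_ExM] states that distinct updates have uncorrelated transit times, a property that
    passes to the children and suffices for the strong law. *)
Record transit_moments (v : node n) (alpha beta : R) : Prop := {
  transit_L2 : forall m, L2 P (transit k X G v m) ;
  transit_Ex : forall m, Ex P (transit k X G v m) = alpha ;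
  transit_Ex2 : forall m, Ex P (fun x => transit k X G v m x ^+ 2) = beta ;
  transit_ExM : forall m m', (m < m')%N ->
    Ex P (fun x => transit k X G v m x * transit k X G v m' x) = alpha ^+ 2 }.

Hypothesis reg : regular_node P L e p.

(** Freezing: the indices and W depend on the primitives of p, [Phi] on those above, so its mean may
    be taken at fixed indices. Two indices are allowed in view of products of two transit times. *)
Lemma random_index (Phi : nat -> nat -> Om -> R) (N N' : Om -> nat) (W : Om -> R) kappa :
  (forall a b, measurable_fun setT (Phi a b)) -> (forall a b x, 0 <= Phi a b x) ->
  (forall a b, depends_on (above p) (Phi a b)) ->
  measurable_fun setT N -> measurable_fun setT N' -> (forall x, 0 <= W x) ->
  depends_on (future L e p 0 0) N -> depends_on (future L e p 0 0) N' ->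
  depends_on (future L e p 0 0) W ->
  (forall x, L1 P (Phi (N x) (N' x)) /\ Ex P (Phi (N x) (N' x)) = kappa) -> L1 P W ->
  L1 P (fun x => Phi (N x) (N' x) x * W x) /\
  Ex P (fun x => Phi (N x) (N' x) x * W x) = kappa * Ex P W.
Proof.
have [ind pe pL _ _ _] := reg.
move=> mPhi Phi0 dPhi mN mN' W0 dN dN' dW Phik W1.
have mW := L1_measurable W1.
pose f (z : Om * Om) := (Phi (N z.1) (N' z.1) z.2 * W z.1)%:E.
have mf : measurable_fun setT f.
  apply/measurable_EFinP; apply: measurable_funM; last first.
    by apply: (measurableT_comp mW); exact: measurable_fst.
  apply: (measurable_countable_case (N := fun z : Om * Om => N z.1)
     (f := fun a z => Phi a (N' z.1) z.2)).
    by apply: (measurableT_comp mN); exact: measurable_fst.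
  move=> a; apply: (measurable_countable_case (N := fun z : Om * Om => N' z.1)
     (f := fun b z => Phi a b z.2)).
    by apply: (measurableT_comp mN'); exact: measurable_fst.
  by move=> b; apply: (measurableT_comp (mPhi a b)); exact: measurable_snd.
have e1 : (\int[P]_x (Phi (N x) (N' x) x * W x)%:E = (kappa * Ex P W)%:E)%E.
  transitivity (\int[P]_x f (x, x))%E; first by [].
  rewrite (@independent_integral _ _ _ _ ind (future L e p 0 0) (above p))//.
  - transitivity (\int[P]_x (kappa%:E * (W x)%:E))%E.
      apply: eq_integral => x _; rewrite /f/=.
      have [h1 h2] := Phik x.
      transitivity (\int[P]_y ((W x)%:E * (Phi (N x) (N' x) y)%:E))%E.
        by apply: eq_integral => y _; rewrite -EFinM mulrC.
      rewrite ge0_integralZl ?lee_fin//; last 2 first.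
      - exact/measurable_EFinP.
      - by move=> y _; rewrite lee_fin.
      by rewrite ExE// h2 muleC.
    have kappa0 : 0 <= kappa by have [_ <-] := Phik point; apply: Ex_ge0.
    rewrite ge0_integralZl ?lee_fin//; last 2 first.
    - exact/measurable_EFinP.
    - by move=> y _; rewrite lee_fin.
    by rewrite ExE// EFinM.
  - by move=> i /andP[].
  - by move=> i /andP[].
  - move=> [[[u j] c]|[u a]] /andP[_ /andP[/eqP -> _]]; by rewrite /above ltnn andbF.
  - by move=> z; rewrite lee_fin mulr_ge0.
  - by move=> y x x' xx'; rewrite /f/= (dN _ _ xx') (dN' _ _ xx') (dW _ _ xx').
  - by move=> y x x' xx'; rewrite /f/= (dPhi _ _ _ _ xx').
have F1 : L1 P (fun x => Phi (N x) (N' x) x * W x).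
  apply: ge0_L1; last by rewrite e1 ltry.
    apply: measurable_funM => //.
    apply: (measurable_countable_case (f := fun a z => Phi a (N' z) z)) => // a.
    exact: (measurable_countable_case (f := fun b z => Phi a b z)).
  by move=> x; rewrite mulr_ge0.
by split=> //; apply: EFin_inj; rewrite -ExE.
Qed.

Hypothesis atomless : forall j c (y : R), P [set x | x (inl (p, j, c)) = y] = 0%E.
Hypothesis kv : (0 < k (hop p) <= n)%N.
Hypothesis X2 : forall c, L2 P (X p 0%N c : Om -> R).
Hypothesis inf : {ae P, forall x, forall c j,
  exists2 i, (j <= i)%N & delivered k X p c x i}.
Local Notation tau := (transit k X G p).
Hypothesis tau_dep : forall m, depends_on (above p) (tau m).
Variables (alpha beta : R).
Hypothesis tauP : transit_moments p alpha beta.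
Variable c : 'I_n.

Lemma transit_ge0 v m x : 0 <= transit k X G v m x.
Proof.
elim: v m => //= d v ih m; rewrite addr_ge0//; exact: abs_ge0.
Qed.

Definition accepted_delivery m (x : Om) := served k X G p (delivery_cycle k X p c m x) x.
Definition delivery_delay m (x : Om) := X p (delivery_cycle k X p c m x) c x.

Let xbar := (k (hop p))%:R^-1 * \sum_(1 <= i < (k (hop p)).+1) Ex P (delay_stat X p 0 i).

Lemma measurable_accepted_delivery m : measurable_fun setT (accepted_delivery m).
Proof.
apply: (measurable_countable_case (f := served k X G p)).
  exact: measurable_delivery_cycle.
by move=> j; exact: measurable_served.
Qed.

Lemma measurable_delivery_delay m : measurable_fun setT (delivery_delay m).
Proof.
apply: (measurable_countable_case (f := fun j x => X p j c x)).
  exact: measurable_delivery_cycle.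
by move=> j; exact: measurable_delay.
Qed.

Lemma accepted_delivery_dep m : depends_on (future L e p 0 0) (accepted_delivery m).
Proof.
have [ind pe pL _ _ _] := reg.
apply: (depends_on_future0 (P := P)) => // x y eX eG.
by rewrite /accepted_delivery (eq_delivery_cycle _ eX) (eq_served _ eX eG).
Qed.

Lemma delivery_delay_dep m : depends_on (future L e p 0 0) (delivery_delay m).
Proof.
have [ind pe pL _ _ _] := reg.
apply: (depends_on_future0 (P := P)) => // x y eX eG.
by rewrite /delivery_delay (eq_delivery_cycle _ eX) eX.
Qed.

Lemma delivery_delay_ge0 m x : 0 <= delivery_delay m x.
Proof. exact: abs_ge0. Qed.

Lemma delivered_delay_ratio :
  let F (a : R) (b : bool) (y : R) := if b then a else 0 in
  L1 P (cycle_fun k P p c F 0) /\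
  Ex P (cycle_fun k P p c F 0) / ((k (hop p))%:R / n%:R) = xbar.
Proof.
have [h1 h2] := @Ex_delivered_delay _ k _ _ _ _ _ reg atomless kv c (fun c => L2_L1 (X2 c)).
split=> //; rewrite h2 /xbar; set S := \sum_(1 <= i < _) _.
have n0 := n_gt0 R kv; have k0 : 0 < (k (hop p))%:R :> R by rewrite ltr0n; case/andP: kv.
by field; rewrite !gt_eqF.
Qed.

Lemma stopped_delay m (U : Om -> R) :
  measurable_fun setT U -> (forall x, 0 <= U x) -> L1 P U -> past_delivery k P L e p c m U ->
  L1 P (fun x => U x * delivery_delay m x) /\
  Ex P (fun x => U x * delivery_delay m x) = Ex P U * xbar.
Proof.
move=> mU U0 U1 pU; have [h1 h2] := delivered_delay_ratio.
set F := (fun (a : R) (b : bool) (y : R) => _) in h1 h2.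
(* [delivery_cycle_stop] asks for a function that is nonnegative on all of R; on the delays, which
   are absolute values, this one is the identity. *)
pose F' (a : R) (b : bool) (y : R) := if b then `|a| else 0.
have FE : cycle_fun k P p c F' 0 = cycle_fun k P p c F 0.
  by apply/funext => x; rewrite /cycle_fun /F' /F /= /abs_coordinate normr_id.
have [] := @delivery_cycle_stop _ k _ P L e p reg atomless kv c m U (fun y => `|y|) inf => //.
- by rewrite -/F' FE.
- rewrite -/F' FE h2.
  have -> : (fun x => U x * `|X p (delivery_cycle k X p c m x) c x|) =
     (fun x => U x * delivery_delay m x).
    by apply/funext => x; rewrite /delivery_delay /= /abs_coordinate normr_id.
  by [].
Qed.

Lemma delivery_delay_Ex m : L1 P (delivery_delay m) /\ Ex P (delivery_delay m) = xbar.
Proof.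
have [] := @stopped_delay m (fun=> 1) (measurable_cst _) (fun=> ler01) (L1_cst P 1)
  (past_delivery1 reg c m).
have -> : (fun x => 1 * delivery_delay m x) = delivery_delay m.
  by apply/funext => x; rewrite mul1r.
by rewrite Ex_cst mul1r.
Qed.

Lemma delivery_delay_ExM m m' : (m < m')%N ->
  Ex P (fun x => delivery_delay m x * delivery_delay m' x) = xbar ^+ 2.
Proof.
move=> mm'; have [h1 h2] := delivery_delay_Ex m.
have [_ ->] := stopped_delay (measurable_delivery_delay m) (delivery_delay_ge0 m) h1
  (past_delivery_delay reg c mm').
by rewrite h2 expr2.
Qed.

Let xi := Ex P (cycle_fun k P p c (fun (a : R) (b : bool) (y : R) => if b then a ^+ 2 else 0) 0)
  / ((k (hop p))%:R / n%:R).

Lemma delivery_delay_Ex2 m :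
  L2 P (delivery_delay m) /\ Ex P (fun x => delivery_delay m x ^+ 2) = xi.
Proof.
have [] := @delivery_cycle_stop _ k _ P L e p reg atomless kv c m (fun=> 1)
  (fun y => y ^+ 2) inf (measurable_cst _) (fun=> ler01) (L1_cst P 1) (past_delivery1 reg c m).
- exact: measurable_funX.
- by move=> y; exact: sqr_ge0.
- apply: le_L1 (X2 c).2.
    by apply: measurable_delivered_if; apply: measurable_funX; exact: measurable_delay.
  by move=> x; rewrite /cycle_fun; case: ifP => // _; rewrite normr0.
have -> : (fun x => 1 * X p (delivery_cycle k X p c m x) c x ^+ 2) =
   (fun x => delivery_delay m x ^+ 2).
  by apply/funext => x; rewrite mul1r.
rewrite Ex_cst mul1r => h1 h2; split=> //; split=> //.
exact: measurable_delivery_delay.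
Qed.

Lemma random_transit_Ex (N : Om -> nat) (W : Om -> R) :
  measurable_fun setT N -> depends_on (future L e p 0 0) N ->
  (forall x, 0 <= W x) -> depends_on (future L e p 0 0) W -> L1 P W ->
  L1 P (fun x => tau (N x) x * W x) /\ Ex P (fun x => tau (N x) x * W x) = alpha * Ex P W.
Proof.
move=> mN dN W0 dW W1.
apply: (@random_index (fun a _ => tau a) N N) => //.
- by move=> a b; exact: measurable_transit.
- by move=> a b x; exact: transit_ge0.
by move=> x; split; [exact/L2_L1/(transit_L2 tauP)|exact: (transit_Ex tauP)].
Qed.

Lemma random_transit_Ex1 (N : Om -> nat) :
  measurable_fun setT N -> depends_on (future L e p 0 0) N ->
  Ex P (fun x => tau (N x) x) = alpha.
Proof.
move=> mN dN.
have [_] := @random_transit_Ex N (fun=> 1) mN dN (fun=> ler01) (fun _ _ _ => erefl) (L1_cst P 1).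
by rewrite Ex_cst mulr1 => <-; apply: eq_Ex => x; rewrite mulr1.
Qed.

Lemma random_transit_Ex2 (N : Om -> nat) :
  measurable_fun setT N -> depends_on (future L e p 0 0) N ->
  L2 P (fun x => tau (N x) x) /\ Ex P (fun x => tau (N x) x ^+ 2) = beta.
Proof.
move=> mN dN.
have [] := @random_index (fun a _ x => tau a x ^+ 2) N N (fun=> 1) beta => //.
- by move=> a b; apply: measurable_funX; exact: measurable_transit.
- by move=> a b x; exact: sqr_ge0.
- by move=> a b x y xy; rewrite (tau_dep _ xy).
- by move=> x; split; [exact: (transit_L2 tauP _).2|exact: (transit_Ex2 tauP)].
- exact: L1_cst.
have -> : (fun x => tau (N x) x ^+ 2 * 1) = (fun x => tau (N x) x ^+ 2).
  by apply/funext => x; rewrite mulr1.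
rewrite Ex_cst mulr1 => h1 h2; split=> //; split=> //.
apply: (measurable_countable_case (f := tau)) => // a; exact: measurable_transit.
Qed.

Lemma random_transit_ExM (N N' : Om -> nat) :
  measurable_fun setT N -> depends_on (future L e p 0 0) N ->
  measurable_fun setT N' -> depends_on (future L e p 0 0) N' ->
  (forall x, (N x < N' x)%N) ->
  Ex P (fun x => tau (N x) x * tau (N' x) x) = alpha ^+ 2.
Proof.
move=> mN dN mN' dN' lt.
have [] := @random_index (fun a b x => if (a < b)%N then tau a x * tau b x else 0)
  N N' (fun=> 1) (alpha ^+ 2) => //.
- move=> a b; case: (a < b)%N; last exact: measurable_cst.
  by apply: measurable_funM; exact: measurable_transit.
- by move=> a b x; case: ifP => // _; rewrite mulr_ge0 ?transit_ge0.
- by move=> a b x y xy; rewrite (tau_dep _ xy) (tau_dep _ xy).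
- move=> x; rewrite lt; split; first by apply: L2M; exact: (transit_L2 tauP).
  exact: (transit_ExM tauP).
- exact: L1_cst.
move=> _; rewrite Ex_cst mulr1 => <-; apply: eq_Ex => x.
by rewrite lt mulr1.
Qed.

(** The transit time to the child is that of the update served at p plus the delay of its delivery.
    The two involve disjoint primitives, and different deliveries carry different updates, so the
    mixed expectations factor; for two delivery delays this is the stopping identity. *)
Theorem transit_moments_child :
  transit_moments (c :: p) (alpha + xbar) (beta + 2 * (alpha * xbar) + xi).
Proof.
pose A m x := tau (accepted_delivery m x) x.
have tE m : transit k X G (c :: p) m = fun x => A m x + delivery_delay m x.
  by apply/funext.
have mN m := measurable_accepted_delivery m.
have dN m := accepted_delivery_dep m.
have A2 m := random_transit_Ex2 (mN m) (@dN m).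
have x2 m := delivery_delay_Ex2 m.
have A1 m : Ex P (A m) = alpha by exact: random_transit_Ex1 (mN m) (@dN m).
have Ax m m' := random_transit_Ex (mN m) (@dN m) (delivery_delay_ge0 m') (@delivery_delay_dep m')
  (delivery_delay_Ex m').1.
split.
- by move=> m; rewrite tE; apply: L2D; [exact: (A2 m).1|exact: (x2 m).1].
- move=> m; rewrite tE.
  have -> : Ex P (fun x => A m x + delivery_delay m x) =
      Ex P (A m) + Ex P (delivery_delay m).
    by apply: ExD; [exact: L2_L1 (A2 m).1|exact: L2_L1 (x2 m).1].
  by rewrite A1 (delivery_delay_Ex m).2.
- move=> m; rewrite tE.
  have -> : (fun x => (A m x + delivery_delay m x) ^+ 2) =
     (fun x => (A m x ^+ 2 + 2 * (A m x * delivery_delay m x)) + delivery_delay m x ^+ 2).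
    by apply/funext => x; ring.
  have [a1 a2] := A2 m; have [b1 b2] := x2 m; have [c1 c2] := Ax m m.
  rewrite ExD; [|by apply: L1D; [exact: a1.2|exact: L1Z]|exact: b1.2].
  rewrite ExD; [|exact: a1.2|exact: L1Z].
  by rewrite ExZ// a2 b2 c2 (delivery_delay_Ex m).2.
move=> m m' mm'; rewrite !tE.
have -> : (fun x => (A m x + delivery_delay m x) * (A m' x + delivery_delay m' x)) =
   (fun x => (A m x * A m' x + A m x * delivery_delay m' x) +
      (A m' x * delivery_delay m x + delivery_delay m x * delivery_delay m' x)).
  by apply/funext => x; ring.
have lt x : (accepted_delivery m x < accepted_delivery m' x)%N.
  by apply: served_lt; exact: nth_index_lt.
have AA := random_transit_ExM (mN m) (@dN m) (mN m') (@dN m') lt; have xx := delivery_delay_ExM mm'.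
have [c1 c2] := Ax m m'; have [d1 d2] := Ax m' m.
have AA1 : L1 P (fun x => A m x * A m' x) by apply: L2M; [exact: (A2 m).1|exact: (A2 m').1].
have xx1 : L1 P (fun x => delivery_delay m x * delivery_delay m' x).
  by apply: L2M; [exact: (x2 m).1|exact: (x2 m').1].
rewrite ExD; [|exact: L1D|exact: L1D].
rewrite ExD// ExD// AA xx c2 d2 !(delivery_delay_Ex _).2; ring.
Qed.

End TransitStep.

Section TransitMean.
Variables (n : nat) (k : nat -> nat) (R : realType).
Local Notation Om := (path_space (primitive_index n) R).
Variable P : probability Om R.
Local Notation X := (abs_delay P).
Local Notation G := (abs_interarrival P).

(** Mean delay of a link given that it delivers; it produces one term of the sum over hops. *)
Definition hop_mean (p : node n) : R :=
  (k (hop p))%:R^-1 * \sum_(1 <= i < (k (hop p)).+1) Ex P (delay_stat X p 0 i).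

Fixpoint transit_mean (v : node n) : R :=
  if v is _ :: p then transit_mean p + hop_mean p else 0.

Lemma ancestor_cons c (p : node n) l : (l <= size p)%N ->
  ancestor (c :: p) l = ancestor p l.
Proof. by move=> lp; rewrite /ancestor /= subSn. Qed.

Lemma transit_meanE (v : node n) :
  transit_mean v = \sum_(1 <= l < (size v).+1) hop_mean (ancestor v l.-1).
Proof.
rewrite big_add1/=; elim: v => [|c p ih]; first by rewrite /= big_geq.
rewrite /= ih big_nat_recr//=; congr (_ + _).
  rewrite big_nat [RHS]big_nat; apply: eq_bigr => l /andP[_ lp].
  by rewrite ancestor_cons// ltnW.
by rewrite ancestor_cons// /ancestor subnn drop0.
Qed.

Variables (L : nat) (shift rate : nat -> R) (e : node n).
Hypothesis k_bounds : forall l : nat, (1 <= l <= L)%N -> (1 <= k l <= n)%N.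
Hypothesis shift_ge0 : forall l : nat, (1 <= l <= L)%N -> 0 <= shift l.
Hypothesis rate_gt0 : forall l : nat, (1 <= l <= L)%N -> 0 < rate l.
Hypothesis network : multicast_network k (raw_delay P) (raw_interarrival P) L shift rate.
Hypothesis e_end : size e = L.

Record path_node (v : node n) : Prop := PathNode {
  node_regular : regular_node P L e v ;
  node_atomless : forall j c (y : R), P [set x | x (inl (v, j, c)) = y] = 0%E ;
  node_k : (0 < k (hop v) <= n)%N ;
  node_delay_moment : forall c, exp_moment P (X v 0%N c : Om -> R) ;
  node_delay_pos : {ae P, forall x, forall j c, 0 < X v j c x} ;
  node_cycle_moment : exp_moment P (cycle_length k X G v 0) ;
  node_deliveries : {ae P, forall x, forall c j,
    exists2 i, (j <= i)%N & delivered k X v c x i } }.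

Lemma path_nodeP v : suffix v e -> (size v < L)%N -> path_node v.
Proof.
move=> ve vL.
have [reg pos] := path_node_regular k_bounds shift_ge0 rate_gt0 network e_end ve vL.
have atl := delay_atomless network vL; have kv := node_k_bounds k_bounds vL.
have mom := delay_exp_moment shift_ge0 rate_gt0 network vL.
have posG : v != [::] -> {ae P, forall x, 0 < G v 0%N x}.
  move=> v0; have [_ h] := pos v0; apply: filterS h => x /(_ 0%N) h.
  by rewrite /= /abs_coordinate normr_gt0 gt_eqF.
have momG : v != [::] -> exp_moment P (G v 0%N : Om -> R) by move=> v0; have [] := pos v0.
split=> //.
- exact: (delay_gt0 shift_ge0 network vL).
- exact: (exp_moment_cycle_length k reg mom momG posG).
- exact: (infinitely_many_deliveries reg atl kv).
Qed.

Lemma transit_depends_on v m : suffix v e -> (size v <= L)%N ->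
  depends_on (above L e v) (transit k X G v m).
Proof.
elim: v m => [|c p ih] m ve vL; first by [].
have pe : suffix p e by apply: suffix_trans ve; exact: suffix_cons.
move=> x y xy /=.
have eX j d : X p j d x = X p j d y.
  by rewrite /= /abs_coordinate xy// /above /= vL ltnS leqnn.
have eG : p != [::] -> forall a, G p a x = G p a y.
  move=> p0 a; rewrite /= /abs_coordinate xy// /above /= vL pe ltnS leqnn.
  by rewrite lt0n size_eq0 p0.
rewrite (eq_delivery_cycle _ eX) (eq_served _ eX eG) eX; congr (_ + _).
apply: ih => //; first exact: ltnW.
move=> i ai; apply: xy; move: ai; rewrite /above => /andP[-> /=].
by case: i => [[[u j] d]|[u a]] h; exact: ltnW.
Qed.

Theorem transit_momentsP v : suffix v e -> (size v <= L)%N ->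
  exists beta, transit_moments k P v (transit_mean v) beta.
Proof.
elim: v => [|c p ih] ve vL.
  exists 0; split=> [m|m|m|m m' _].
  - exact: L2_cst.
  - by rewrite -[RHS](Ex_cst P 0); exact: eq_Ex.
  - by rewrite -[RHS](Ex_cst P 0); apply: eq_Ex => x; rewrite /= expr0n.
  - by rewrite expr0n/= -[RHS](Ex_cst P 0); apply: eq_Ex => x; rewrite /= mulr0.
have pe : suffix p e by apply: suffix_trans ve; exact: suffix_cons.
have pL : (size p <= L)%N by exact: ltnW.
have [beta mom] := ih pe pL.
have [reg atl kv momX posX momY inf] := path_nodeP pe vL.
have X2 d : L2 P (X p 0%N d : Om -> R).
  by apply: exp_moment_L2 => // x; exact: abs_ge0.
have tdep m : depends_on (above L e p) (transit k X G p m) by exact: transit_depends_on.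
by eexists; exact: (transit_moments_child reg atl kv X2 inf tdep mom).
Qed.

End TransitMean.

(* The age at the start of cycle j: a delivery in cycle j of an update of age
   A j at the start of the cycle resets the age. *)
Fixpoint cycle_age (R : realType) (h : R) (Y A : nat -> R) (D : pred nat) (j : nat) : R :=
  if j is j'.+1 then Y j' + (if D j' then A j' else cycle_age h Y A D j') else h.

(* integral of the age over cycle j, x j being the delay of the delivery *)
Definition cycle_area (R : realType) (h : R) (Y A x : nat -> R) (D : pred nat) (j : nat) : R :=
  cycle_age h Y A D j * Y j + Y j ^+ 2 / 2 +
  (if D j then (A j - cycle_age h Y A D j) * (Y j - x j) else 0).

Definition average (R : realType) (f : nat -> R) (N : nat) : R :=
  N%:R^-1 * \sum_(j < N) f j.

(** * Long-run averages of the age recursion *)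

Section CesaroAlgebra.
Variable R : realType.
Implicit Types (f g : nat -> R) (a b : R).

Lemma average_cst a : average (fun=> a) @ \oo --> a.
Proof.
apply: (@cvg_trans _ ((fun=> a) @ \oo)); last exact: cvg_cst.
apply: near_eq_cvg; exists 1%N => // N /= N1.
by rewrite /average sumr_const card_ord mulrnAr -mulrnAl -mulr_natr mulVf ?mul1r// pnatr_eq0 -lt0n.
Qed.

Lemma average_D f g a b : average f @ \oo --> a -> average g @ \oo --> b ->
  average (fun j => f j + g j) @ \oo --> a + b.
Proof.
move=> fa gb; have -> : average (fun j => f j + g j) = (fun N => average f N + average g N).
  by apply/funext => N; rewrite /average big_split mulrDr.
exact: cvgD.
Qed.

Lemma average_Z f a c : average f @ \oo --> a -> average (fun j => c * f j) @ \oo --> c * a.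
Proof.
move=> fa; have -> : average (fun j => c * f j) = (fun N => c * average f N).
  by apply/funext => N; rewrite /average -mulr_sumr mulrCA.
exact: cvgMr.
Qed.

Lemma eq_average f g a : average f @ \oo --> a -> f =1 g -> average g @ \oo --> a.
Proof. by move=> fa /funext <-. Qed.

Lemma average_B f g a b : average f @ \oo --> a -> average g @ \oo --> b ->
  average (fun j => f j - g j) @ \oo --> a - b.
Proof.
move=> fa gb; have := average_D fa (average_Z (c := -1) gb).
rewrite mulN1r; move=> /eq_average; apply => j; by rewrite mulN1r.
Qed.

(* The recursion for H telescopes: the averages of D H and of Y + D A have the
   same limit since H N = o(N); as D decouples from H on average, this gives the
   average of H, and then that of the areas. *)
Lemma average_cycle_area (Y A x : nat -> R) (D : pred nat) (p0 mu s2 alpha xbar : R) :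
  let H := cycle_age 0 Y A D in
  let DY j := if D j then Y j else 0 in
  let Dx j := if D j then x j else 0 in
  let D1 j := if D j then 1 else 0 in
  0 < p0 ->
  average (fun j => 1 * (Y j - mu)) @ \oo --> (0 : R) ->
  average (fun j => 1 * (Y j ^+ 2 - s2)) @ \oo --> (0 : R) ->
  average (fun j => A j * (D1 j - p0)) @ \oo --> (0 : R) ->
  average (fun j => H j * (D1 j - p0)) @ \oo --> (0 : R) ->
  average (fun j => H j * (Y j - mu)) @ \oo --> (0 : R) ->
  average (fun j => (A j - H j) * (DY j - p0 * mu)) @ \oo --> (0 : R) ->
  average (fun j => (A j - H j) * (Dx j - p0 * xbar)) @ \oo --> (0 : R) ->
  average (fun j => A j - alpha) @ \oo --> (0 : R) ->
  (fun N => N%:R^-1 * H N) @ \oo --> (0 : R) ->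
  average Y @ \oo --> mu /\
  average (cycle_area 0 Y A x D) @ \oo -->
    mu ^+ 2 / p0 + mu * alpha + s2 / 2 - mu ^+ 2 + xbar * mu.
Proof.
move=> H DY Dx D1 p00 l1 l2 l3 l4 l5 l6 l7 l8 l9.
have aY : average Y @ \oo --> mu.
  have := average_D l1 (average_cst (a := mu)); rewrite add0r; move=> /eq_average; apply => j.
  by rewrite mul1r subrK.
have aY2 : average (fun j => Y j ^+ 2) @ \oo --> s2.
  have := average_D l2 (average_cst (a := s2)); rewrite add0r; move=> /eq_average; apply => j.
  by rewrite mul1r subrK.
have aA : average A @ \oo --> alpha.
  have := average_D l8 (average_cst (a := alpha)); rewrite add0r; move=> /eq_average; apply => j.
  by rewrite subrK.
have aDA : average (fun j => D1 j * A j) @ \oo --> p0 * alpha.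
  have := average_D l3 (average_Z (c := p0) aA); rewrite add0r; move=> /eq_average; apply => j.
  by ring.
have aDH : average (fun j => D1 j * H j) @ \oo --> mu + p0 * alpha.
  have -> : average (fun j => D1 j * H j) = (fun N =>
      average (fun j => Y j + D1 j * A j) N - N%:R^-1 * H N).
    apply/funext => N; rewrite /average -mulrBr; congr (_ * _).
    elim: N => [|N ih]; first by rewrite !big_ord0 subr0.
    rewrite !big_ord_recr/= ih /H /= -/H /D1; case: ifP => _; ring.
  have := cvgB (average_D aY aDA) l9; rewrite subr0; exact.
have aH : average H @ \oo --> mu / p0 + alpha.
  have := average_Z (c := p0^-1) (average_B aDH l4); rewrite subr0.
  have -> : p0^-1 * (mu + p0 * alpha) = mu / p0 + alpha by field; rewrite gt_eqF.
  by move=> /eq_average; apply => j; field; rewrite gt_eqF.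
have aK : average (fun j => A j - H j) @ \oo --> - (mu / p0).
  have := average_B aA aH.
  by have -> : alpha - (mu / p0 + alpha) = - (mu / p0) by ring.
split=> //.
(* Each product in the area is replaced by its mean given the start of the cycle: H Y by mu H, and
   (A - H)(D Y - D x) by (p0 mu - p0 xbar)(A - H), where A - H averages to -mu/p0. *)
have := average_D (average_D (average_D l5 (average_Z (c := mu) aH)) (average_Z (c := 2^-1) aY2))
  (average_D (average_B l6 l7) (average_Z (c := p0 * mu - p0 * xbar) aK)).
have -> : 0 + mu * (mu / p0 + alpha) + 2^-1 * s2 + (0 - 0 + (p0 * mu - p0 * xbar) * - (mu / p0)) =
    mu ^+ 2 / p0 + mu * alpha + s2 / 2 - mu ^+ 2 + xbar * mu.
  by field; rewrite gt_eqF.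
move=> /eq_average; apply => j; rewrite /cycle_area -/H /DY /Dx.
by case: ifP => _; field.
Qed.

End CesaroAlgebra.

(** * Averages over the cycles of the last transmitter *)

Section Averages.
Variables (n : nat) (k : nat -> nat) (R : realType).
Local Notation Om := (path_space (primitive_index n) R).
Variable P : probability Om R.
Local Notation X := (abs_delay P).
Local Notation G := (abs_interarrival P).
Variables (L : nat) (e p : node n).
Hypothesis pnode : path_node k P L e p.
Variables (alpha beta : R).
Hypothesis tau_dep : forall m, depends_on (above L e p) (transit k X G p m).
Hypothesis tauP : transit_moments k P p alpha beta.
Variable c : 'I_n.

Local Notation reg := (node_regular pnode).
Local Notation atl := (node_atomless pnode).
Local Notation kp := (node_k pnode).
Local Notation cfun := (cycle_fun k P p c).
Local Notation past := (past k P L e p).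

Definition cycle_transit j (x : Om) : R := transit k X G p (served k X G p j x) x.

Local Notation Y := (cycle_length k X G p).
Local Notation A := cycle_transit.
Local Notation del x := (delivered k X p c x).

(** Started at 0 rather than at the true initial age. The first delivery erases the initial value,
    so the long-run averages are the same. *)
Definition start_age j (x : Om) : R :=
  cycle_age 0 (Y ^~ x) (A ^~ x) (del x) j.

Lemma start_ageS j x : start_age j.+1 x = Y j x + (if del x j then A j x else start_age j x).
Proof. by []. Qed.

Lemma served_dep j : depends_on (future L e p 0 0) (served k X G p j).
Proof.
have [ind pe pL _ _ _] := reg.
apply: (depends_on_future0 (P := P)) => // x y eX eG.
by rewrite (eq_served _ eX eG).
Qed.

Lemma cycle_transit_L2 j : L2 P (A j) /\ Ex P (fun x => A j x ^+ 2) = beta.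
Proof.
apply: (random_transit_Ex2 reg tau_dep tauP); first exact: measurable_served.
exact: served_dep.
Qed.

Lemma cycle_transit_Ex j : Ex P (A j) = alpha.
Proof.
apply: (random_transit_Ex1 reg tau_dep tauP); first exact: measurable_served.
exact: served_dep.
Qed.

Lemma cycle_transit_ExM i j : (i < j)%N -> Ex P (fun x => A i x * A j x) = alpha ^+ 2.
Proof.
move=> ij; apply: (random_transit_ExM reg tau_dep tauP).
- exact: measurable_served.
- exact: served_dep.
- exact: measurable_served.
- exact: served_dep.
by move=> x; exact: served_lt.
Qed.

(** The number of the update served is known when the cycle starts, and its transit time involves
    only nodes above p, which belong to every history. *)
Lemma cycle_transit_past j : past j (A j).
Proof.
have [ind pe pL _ _ _] := reg.
move=> x y unb h; rewrite /cycle_transit.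
have -> : served k X G p j y = served k X G p j x.
  by apply/esym/(@served_past _ k _ P L e p pe pL j x y unb h).
apply: tau_dep => i ai; apply: h; move: ai; rewrite /above /history => /andP[-> /=].
by case: i => [[[u a] b]|[u a]] lt; apply/orP; left; apply: contraTneq lt => ->; rewrite ltnn.
Qed.

Lemma cycle_transit_ge0 j x : 0 <= A j x.
Proof. exact: transit_ge0. Qed.

Lemma cycle_ge0 j x : 0 <= Y j x.
Proof. exact: cycle_length_nonneg. Qed.

Lemma start_age_ge0 j x : 0 <= start_age j x.
Proof.
elim: j => // j ih; rewrite start_ageS addr_ge0 ?cycle_ge0//.
by case: ifP => // _; exact: cycle_transit_ge0.
Qed.

Lemma start_age_past j : past j (start_age j).
Proof.
have [ind pe pL _ _ _] := reg.
elim: j => // j ih x y unb h; rewrite !start_ageS.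
rewrite (@cycle_length_past _ k _ P L e p pe pL j x y unb h).
rewrite (@delivered_past _ k _ P L e p pL j c x y unb h).
by rewrite (pastS (@cycle_transit_past j) unb h) (pastS ih unb h).
Qed.

Lemma measurable_start_age j : measurable_fun setT (start_age j).
Proof.
elim: j => [|j ih]; first exact: measurable_cst.
apply: measurable_funD; first exact: measurable_cycle_length.
apply: measurable_fun_ifT => //; first exact: measurable_delivered.
exact: L2_measurable (cycle_transit_L2 j).1.
Qed.

Let p0 : R := (k (hop p))%:R / n%:R.

Lemma delivery_rate_gt0 : 0 < p0.
Proof. by rewrite divr_gt0 ?(n_gt0 R kp)// ltr0n; case/andP: kp. Qed.

Lemma delivery_rate_le1 : p0 <= 1.
Proof.
by rewrite ler_pdivrMr ?(n_gt0 R kp)// mul1r ler_nat; case/andP: kp.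
Qed.

Let mu : R := Ex P (Y 0).
Let s2 : R := Ex P (fun x => Y 0 x ^+ 2).

Lemma first_cycle_L2 : L2 P (Y 0).
Proof. by apply: exp_moment_L2; [exact: cycle_ge0|exact: node_cycle_moment pnode]. Qed.

Lemma first_cycle_sqr_L2 : L2 P (fun x => Y 0 x ^+ 2).
Proof. by apply: exp_moment_L2_sqr; [exact: cycle_ge0|exact: node_cycle_moment pnode]. Qed.

Lemma cycle_length_Ex_sqr j : L2 P (Y j) /\ Ex P (fun x => Y j x ^+ 2) = s2.
Proof.
have [h1 h2] := @Ex_cycle_fun _ k _ P L e p reg j c (fun _ _ y => y ^+ 2) first_cycle_L2.2
  (fun x => sqr_ge0 _).
by split=> //; split=> //; exact: measurable_cycle_length.
Qed.

(* H (j+1) = Y j + D j A j + (1 - D j) H j, where D j is independent of H j: the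
   second moment contracts by a factor (1 + p0) (1 - p0) < 1. *)
Lemma start_age_L2 : exists C, forall j, L2 P (start_age j) /\
  Ex P (fun x => start_age j x ^+ 2) <= C.
Proof.
pose K := 2 * s2 + 2 * beta.
have s20 : 0 <= s2 by apply: Ex_ge0 => x; exact: sqr_ge0.
have b0 : 0 <= beta by rewrite -(cycle_transit_L2 0).2; apply: Ex_ge0 => x; exact: sqr_ge0.
have K0 : 0 <= K by rewrite addr_ge0// mulr_ge0.
have p00 := delivery_rate_gt0; have p01 := delivery_rate_le1.
(* C is the fixed point of C = (1 + 1/p0) K + (1 + p0)(1 - p0) C. *)
pose C := (1 + p0^-1) * K / p0 ^+ 2.
exists C; have C0 : 0 <= C.
  by rewrite !mulr_ge0 ?invr_ge0 ?sqr_ge0// addr_ge0// invr_ge0 ltW.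
elim=> [|j [ih1 ih2]].
  split; first exact: L2_cst.
  by under eq_Ex do rewrite /start_age /= expr0n; rewrite Ex_cst.
pose F (a : R) (b : bool) (y : R) := if b then 0 else 1 : R.
have [d1 d2] := probability_delivered reg atl kp c.
have FE : cfun F 0 = (fun x => 1 -
    cfun (fun (a : R) (b : bool) (y : R) => if b then 1 else 0 : R) 0 x).
  by apply/funext => x; rewrite /cycle_fun /F; case: ifP => _; rewrite ?subrr ?subr0.
have F1 : L1 P (cfun F 0) by rewrite FE; apply: L1B => //; exact: L1_cst.
have FEx : Ex P (cfun F 0) = 1 - p0.
  by rewrite FE ExB//; [rewrite Ex_cst d2|exact: L1_cst].
have F0 x : 0 <= cfun F 0 x by rewrite /cycle_fun /F; case: ifP.
have [r1 r2] := regeneration_Ex reg ih1.2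
  (past_comp (fun t => t ^+ 2) (@start_age_past j)) F1 F0.
have [y1 y2] := cycle_length_Ex_sqr j; have [a1 a2] := cycle_transit_L2 j.
(* Without delivery, (Y + H)^2 <= (1 + 1/p0) Y^2 + (1 + p0) H^2; with delivery, (Y + A)^2 <= 2 Y^2 +
   2 A^2. [Bd] dominates both. *)
pose Bd x := (1 + p0^-1) * (2 * Y j x ^+ 2 + 2 * A j x ^+ 2) +
  (1 + p0) * (start_age j x ^+ 2 * cfun F j x).
have Y1 : L1 P (fun x => 2 * Y j x ^+ 2) by apply: L1Z; exact: y1.2.
have A1 : L1 P (fun x => 2 * A j x ^+ 2) by apply: L1Z; exact: a1.2.
have YA1 : L1 P (fun x => 2 * Y j x ^+ 2 + 2 * A j x ^+ 2) by exact: L1D.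
have Bd1 : L1 P Bd by apply: L1D; exact: L1Z.
have HBd x : start_age j.+1 x ^+ 2 <= Bd x.
  rewrite start_ageS /Bd /cycle_fun /F.
  have Yx := cycle_ge0 j x; have Ax := cycle_transit_ge0 j x; have Hx := start_age_ge0 j x.
  move: (Y j x) (A j x) (start_age j x) Yx Ax Hx => y a h y0 a0 h0.
  have ip0 : 0 < p0^-1 by rewrite invr_gt0.
  case: ifP => _.
    rewrite mulr0 mulr0 addr0.
    have : 0 <= p0^-1 * (2 * y ^+ 2 + 2 * a ^+ 2).
      by rewrite mulr_ge0 ?(ltW ip0)// addr_ge0 ?mulr_ge0 ?sqr_ge0.
    by have := sqr_ge0 (y - a); nra.
  rewrite mulr1.
  have e1 : p0^-1 * (y - p0 * h) ^+ 2 = p0^-1 * y ^+ 2 - 2 * (y * h) + p0 * h ^+ 2.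
    by field; rewrite gt_eqF.
  have e2 : 0 <= p0^-1 * (y - p0 * h) ^+ 2 by rewrite mulr_ge0 ?sqr_ge0// ltW.
  have e3 : 0 <= (1 + p0^-1) * (y ^+ 2 + 2 * a ^+ 2).
    by rewrite mulr_ge0 ?addr_ge0 ?mulr_ge0 ?sqr_ge0// ltW.
  rewrite e1 in e2; move: e2 e3; move: (p0^-1) => ip; nra.
have Hm := measurable_start_age j.+1.
have H1 : L1 P (fun x => start_age j.+1 x ^+ 2).
  apply: le_L1 Bd1; first exact: measurable_funX.
  move=> x; rewrite ger0_norm ?sqr_ge0//; apply: le_trans (ler_norm _); exact: HBd.
split; first by split.
apply: (le_trans (le_Ex H1 Bd1 HBd)).
have -> : Ex P Bd = (1 + p0^-1) * K + (1 + p0) * (Ex P (fun x => start_age j x ^+ 2) * (1 - p0)).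
  transitivity (Ex P (fun x => (1 + p0^-1) * (2 * Y j x ^+ 2 + 2 * A j x ^+ 2)) +
     Ex P (fun x => (1 + p0) * (start_age j x ^+ 2 * cfun F j x))).
    by apply: ExD; exact: L1Z.
  congr (_ + _); last by rewrite ExZ// r2 FEx.
  rewrite ExZ//; congr (_ * _); transitivity (Ex P (fun x => 2 * Y j x ^+ 2) +
     Ex P (fun x => 2 * A j x ^+ 2)); first exact: ExD.
  by rewrite !ExZ ?y2 ?a2//; [exact: a1.2|exact: y1.2].
have ip : 0 <= 1 - p0 by rewrite subr_ge0.
have h3 : (1 + p0) * (Ex P (fun x => start_age j x ^+ 2) * (1 - p0)) <=
   (1 + p0) * (C * (1 - p0)).
  by rewrite ler_wpM2l ?addr_ge0 ?(ltW p00)// ler_wpM2r.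
apply: le_trans (lerD (lexx _) h3) _.
rewrite le_eqVlt; apply/orP; left; apply/eqP; rewrite /C; field.
by rewrite gt_eqF.
Qed.

Lemma start_age_div : {ae P, forall x, (fun N => N%:R^-1 * start_age N x) @ \oo --> (0 : R)}.
Proof.
have [C HC] := start_age_L2.
have C0 : 0 <= C by apply: le_trans (HC 0%N).2; apply: Ex_ge0 => x; exact: sqr_ge0.
have := @ae_cvg0_of_sum_squares _ _ _ P (fun N x => N.+1%:R^-1 * start_age N.+1 x)
  (fun N => C * N.+1%:R ^- 2) (C * 2).
move=> h; have {}h : {ae P, forall x, (fun N => N.+1%:R^-1 * start_age N.+1 x) @ \oo --> (0 : R)}.
  apply: h.
  - by move=> N; apply: L2Z; exact: (HC N.+1).1.
  - move=> N; under eq_Ex do rewrite exprMn.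
    rewrite ExZ; last exact: (HC N.+1).1.2.
    by rewrite exprVn mulrC ler_wpM2r ?invr_ge0 ?exprn_ge0//; exact: (HC N.+1).2.
  - by move=> N; rewrite -mulr_sumr ler_wpM2l// sum_inv_squares_le2.
by apply: filterS h => x; rewrite -(cvg_shiftS (fun N => N%:R^-1 * start_age N x)).
Qed.

(** Regeneration is not the tool here: the ages of distinct updates are known only to be
    uncorrelated with equal means, which makes the centred ages orthogonal, as [orthogonal_slln]
    requires. *)
Lemma cycle_transit_average :
  {ae P, forall x, average (fun j => A j x - alpha) @ \oo --> (0 : R)}.
Proof.
have A2 j := cycle_transit_L2 j.
have Ac2 j : L2 P (fun x => A j x - alpha) by apply: L2B; [exact: (A2 j).1|exact: L2_cst].
have AA j i : L1 P (fun x => A i x * A j x) by apply: L2M; [exact: (A2 i).1|exact: (A2 j).1].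
have A1 j : L1 P (A j) by exact: L2_L1 (A2 j).1.
have cov i j : Ex P (fun x => (A i x - alpha) * (A j x - alpha)) =
    Ex P (fun x => A i x * A j x) - alpha ^+ 2.
  have -> : (fun x => (A i x - alpha) * (A j x - alpha)) =
    (fun x => A i x * A j x - (alpha * A i x + (alpha * A j x - alpha ^+ 2))).
    by apply/funext => x; ring.
  have L3 : L1 P (fun x => alpha * A j x - alpha ^+ 2).
    by apply: L1B; [exact: L1Z|exact: L1_cst].
  have L4 : L1 P (fun x => alpha * A i x + (alpha * A j x - alpha ^+ 2)).
    by apply: L1D => //; exact: L1Z.
  rewrite ExB// ExD//; last exact: L1Z.
  rewrite ExB//; [|exact: L1Z|exact: L1_cst].
  by rewrite !ExZ//; [rewrite !cycle_transit_Ex Ex_cst; ring|exact: L1_cst].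
apply: (@orthogonal_slln _ _ _ P (fun j x => A j x - alpha) (beta - alpha ^+ 2)) => //.
  move=> j; under eq_Ex do rewrite expr2.
  rewrite cov; have -> : Ex P (fun x => A j x * A j x) = beta.
    by rewrite -(A2 j).2; apply: eq_Ex => x; rewrite expr2.
  by [].
move=> N; under eq_Ex do rewrite mulr_suml.
rewrite (@Ex_sum _ _ _ P _ (fun i x => (A i x - alpha) * (A N x - alpha))); last first.
  by move=> i _; exact: L2M.
by rewrite big1// => i _; rewrite cov cycle_transit_ExM// subrr.
Qed.

(** All but the last two limits required by [average_cycle_area] are instances of
    [martingale_average], with weights 1, A, H and A - H and observables Y, Y^2, D, D Y and D x. *)
Theorem cycle_averages : {ae P, forall x,
  average (Y ^~ x) @ \oo --> mu /\
  average (cycle_area 0 (Y ^~ x) (A ^~ x) (fun j => X p j c x) (del x)) @ \oo -->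
    mu ^+ 2 / p0 + mu * alpha + s2 / 2 - mu ^+ 2 + hop_mean k P p * mu}.
Proof.
have [C HC] := start_age_L2.
have C0 : 0 <= C by apply: le_trans (HC 0%N).2; apply: Ex_ge0 => x; exact: sqr_ge0.
have b0 : 0 <= beta by rewrite -(cycle_transit_L2 0).2; apply: Ex_ge0 => x; exact: sqr_ge0.
have X1 d : L1 P (X p 0%N d : Om -> R).
  by apply/L2_L1/exp_moment_L2; [move=> x; exact: abs_ge0|exact: (node_delay_moment pnode)].
have A2 j := cycle_transit_L2 j.
have oneL2 (j : nat) : L2 P (fun=> 1 : R) by exact: L2_cst.
have oneEx (j : nat) : Ex P (fun=> 1 ^+ 2 : R) <= 1 by rewrite Ex_cst expr1n.
have onep j : past j (fun=> 1 : R) by [].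
pose U j x := A j x - start_age j x.
have U2 j : L2 P (U j) by apply: L2B; [exact: (A2 j).1|exact: (HC j).1].
have UC j : Ex P (fun x => U j x ^+ 2) <= 2 * beta + 2 * C.
  have L3 : L1 P (fun x => 2 * A j x ^+ 2) by apply: L1Z; exact: (A2 j).1.2.
  have L4 : L1 P (fun x => 2 * start_age j x ^+ 2) by apply: L1Z; exact: (HC j).1.2.
  apply: (@le_trans _ _ (Ex P (fun x => 2 * A j x ^+ 2 + 2 * start_age j x ^+ 2))).
    apply: le_Ex; [exact: (U2 j).2|exact: L1D|].
    move=> x; rewrite /U -subr_ge0.
    have -> : 2 * A j x ^+ 2 + 2 * start_age j x ^+ 2 - (A j x - start_age j x) ^+ 2 =
      (A j x + start_age j x) ^+ 2 by ring.
    exact: sqr_ge0.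
  rewrite ExD// !ExZ; [|exact: (HC j).1.2|exact: (A2 j).1.2].
  by rewrite (A2 j).2 lerD2l ler_wpM2l//; exact: (HC j).2.
have pU j : past j (U j).
  by move=> x y unb h; rewrite /U (cycle_transit_past unb h) (start_age_past unb h).
have [d1 d2] := probability_delivered reg atl kp c.
have [x1 x2] := Ex_delivered_delay reg atl kp c X1.
have X2 : L2 P (X p 0%N c : Om -> R).
  by apply: exp_moment_L2; [move=> x; exact: abs_ge0|exact: (node_delay_moment pnode)].
have absY x : `|Y 0%N x| = Y 0%N x by rewrite ger0_norm// cycle_ge0.
(* The absolute value provides [Ex_delivered] with a function nonnegative on all of R; cycle lengths
   are nonnegative. *)
have [y1 y2] := @Ex_delivered _ _ _ _ _ _ _ reg atl kp c (fun y => `|y|)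
  (@normr_measurable R setT) (@normr_ge0 _ _) (L2_L1 (L2_norm first_cycle_L2)).
set Fy := (fun (a : R) (b : bool) (y : R) => _) in y1 y2.
set Fx := (fun (a : R) (b : bool) (y : R) => _) in x1 x2.
set F1 := (fun (a : R) (b : bool) (y : R) => _) in d1 d2.
have F1_2 : L2 P (cfun F1 0).
  apply: le_L2 (L2_cst P 1); first exact: L1_measurable d1.
  by move=> x; rewrite /cycle_fun /F1; case: ifP => _; rewrite ?normr1 ?normr0.
have Fy_2 : L2 P (cfun Fy 0).
  apply: le_L2 first_cycle_L2; first exact: L1_measurable y1.
  by move=> x; rewrite /cycle_fun /Fy; case: ifP => _; rewrite ?normr_id ?normr0.
have Fx_2 : L2 P (cfun Fx 0).
  apply: le_L2 X2; first exact: L1_measurable x1.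
  by move=> x; rewrite /cycle_fun /Fx; case: ifP => _; rewrite ?normr0.
have F10 x : 0 <= cfun F1 0 x by rewrite /cycle_fun /F1; case: ifP.
have Fy0 x : 0 <= cfun Fy 0 x by rewrite /cycle_fun /Fy; case: ifP.
have Fx0 x : 0 <= cfun Fx 0 x.
  by rewrite /cycle_fun /Fx; case: ifP => // _; exact: abs_ge0.
have H2 j := (HC j).1; have HC2 j := (HC j).2; have A21 j := (A2 j).1.
have AC j : Ex P (fun x => A j x ^+ 2) <= beta by rewrite (A2 j).2.
have sY0 x : 0 <= Y 0%N x ^+ 2 by exact: sqr_ge0.
have m1 := martingale_average reg (c := c) (F := fun _ _ y => y) oneL2 oneEx onep
  first_cycle_L2 (cycle_ge0 0).
have m2 := martingale_average reg (c := c) (F := fun _ _ y => y ^+ 2) oneL2 oneEx onep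
  first_cycle_sqr_L2 sY0.
have m3 := martingale_average reg A21 AC cycle_transit_past F1_2 F10.
have m4 := martingale_average reg H2 HC2 start_age_past F1_2 F10.
have m5 := martingale_average reg (c := c) (F := fun _ _ y => y) H2 HC2 start_age_past
  first_cycle_L2 (cycle_ge0 0).
have m6 := martingale_average reg U2 UC pU Fy_2 Fy0.
have m7 := martingale_average reg U2 UC pU Fx_2 Fx0.
have k0 : 0 < (k (hop p))%:R :> R by rewrite ltr0n; case/andP: kp.
have n0 := n_gt0 R kp.
have exx : Ex P (cfun Fx 0) = p0 * hop_mean k P p.
  rewrite x2 /p0 /hop_mean; set S := \sum_(1 <= i < _) _; field.
  by rewrite !gt_eqF.
have exy : Ex P (cfun Fy 0) = p0 * mu.
  by rewrite y2; congr (_ * _); apply: eq_Ex => x; exact: absY.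
rewrite d2 in m3 m4; rewrite exy in m6; rewrite exx in m7.
apply: filterS3 (filterI (filterI m1 m2) m3) (filterI (filterI m4 m5) (filterI m6 m7))
  (filterI cycle_transit_average start_age_div) => x [[l1 l2] l3] [[l4 l5] [l6 l7]] [l8 l9].
apply: (@average_cycle_area R _ _ _ _ p0 mu s2 alpha (hop_mean k P p) delivery_rate_gt0) => //.
apply: (@eq_average R (fun j => U j x * (cfun Fy j x - p0 * mu)) _ _ l6) => j.
by rewrite /cycle_fun /Fy /U /start_age; case: ifP => // _; rewrite (ger0_norm (cycle_ge0 _ _)).
Qed.

End Averages.

Section EventualAverage.
Variable R : realType.

Lemma cycle_age_eventually (h : R) (Y A : nat -> R) (D : pred nat) :
  (exists i, D i) -> \forall j \near \oo, cycle_age h Y A D j = cycle_age 0 Y A D j.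
Proof.
move=> [i Di]; exists i.+1 => // j /=.
elim: j => // j ih; rewrite ltnS leq_eqVlt => /predU1P[<-|/ih h'] /=.
  by rewrite Di.
by rewrite h'.
Qed.

Lemma average_cvg (f : nat -> R) (a : R) : f @ \oo --> a -> average f @ \oo --> a.
Proof.
move=> /cesaro; rewrite /arithmetic_mean => h.
rewrite -(cvg_shiftS (average f)); apply: cvg_trans h.
apply: near_eq_cvg; near=> N.
by rewrite /average /series /= big_mkord.
Unshelve. all: by end_near. Qed.

Lemma average_near (f g : nat -> R) (a : R) : average f @ \oo --> a ->
  (\forall j \near \oo, g j = f j) -> average g @ \oo --> a.
Proof.
move=> fa gf; have h : average (fun j => g j - f j) @ \oo --> (0 : R).
  apply: average_cvg; apply: (@cvg_trans _ ((fun=> 0) @ \oo)); last exact: cvg_cst.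
  by apply: near_eq_cvg; apply: filterS gf => j ->; rewrite subrr.
have := average_D h fa; rewrite add0r => /eq_average; apply => j.
by rewrite subrK.
Qed.

Lemma average_cycle_area_start (h : R) (Y A x : nat -> R) (D : pred nat) (a : R) :
  (exists i, D i) -> average (cycle_area 0 Y A x D) @ \oo --> a ->
  average (cycle_area h Y A x D) @ \oo --> a.
Proof.
move=> /(cycle_age_eventually h Y A) H /average_near; apply.
by apply: filterS H => j; rewrite /cycle_area => ->.
Qed.

End EventualAverage.

(** * Integrals of functions that are piecewise of slope one *)

Section LinearIntegral.
Variable R : realType.
Local Notation leb := (@lebesgue_measure R).

Lemma integral_line (a b u : R) : a <= b ->
  (\int[leb]_(t in `[a, b[) (t - u)%:E = (((b - u) ^+ 2 - (a - u) ^+ 2) / 2)%:E)%E.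
Proof.
rewrite le_eqVlt => /predU1P[->|ab].
  by rewrite set_itvco0 integral_set0 subrr mul0r.
have cl : continuous (fun t : R => t - u).
  by move=> t; apply: cvgB; [exact: cvg_id|exact: cvg_cst].
rewrite integral_itv_bndo_bndc; last first.
  by apply/measurable_EFinP; apply: measurable_funB.
have dF (t : R) : is_derive t 1 (fun t : R => (t - u) ^+ 2 / 2) (t - u).
  apply: is_derive_eq.
  by rewrite /GRing.scale /=; field.
have cF : continuous (fun t : R => (t - u) ^+ 2 / 2).
  by move=> t; apply/differentiable_continuous/derivable1_diffP; have [] := dF t.
rewrite (@continuous_FTC2 _ (fun t => t - u) (fun t => (t - u) ^+ 2 / 2))//.
- by rewrite -EFinB mulrBl.
- exact: continuous_subspaceT.
- split.
  + by move=> t _; have [] := dF t.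
  + by apply: cvg_at_right_filter; exact: cF.
  + by apply: cvg_at_left_filter; exact: cF.
- by move=> t _; rewrite derive1E; have [_ ->] := dF t.
Qed.

(** Half-open intervals make consecutive pieces disjoint, so that areas add. Measurability and
    nonnegativity travel with the value because the gluing of integrals asks for them. *)
Definition area_upto (f : R -> R) (b V : R) :=
  [/\ measurable_fun `[0, b[ (fun t => (f t)%:E), (forall t, 0 <= t < b -> 0 <= f t) &
      (\int[leb]_(t in `[0%R, b[) (f t)%:E = V%:E)%E].

Lemma area_upto0 f : area_upto f 0 0.
Proof.
split; rewrite ?set_itvco0; [exact: measurable_fun_set0| |by rewrite integral_set0].
by move=> t /andP[t0]; rewrite ltNge t0.
Qed.

Lemma area_upto_line f (b b' u V : R) : area_upto f b V -> 0 <= b -> b <= b' -> u <= b ->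
  (forall t, b <= t < b' -> f t = t - u) ->
  area_upto f b' (V + ((b' - u) ^+ 2 - (b - u) ^+ 2) / 2).
Proof.
move=> [mf f0 iV] b0 bb' ub fE.
have split_itv : `[0, b'[%classic = `[0, b[ `|` `[b, b'[ :> set R.
  by rewrite -itv_bndbnd_setU// bnd_simp.
have ml : measurable_fun `[b, b'[ (fun t => (f t)%:E).
  apply: (@eq_measurable_fun _ _ _ _ _ (fun t : R => (t - u)%:E)).
    by move=> t; rewrite inE/= in_itv/= => tb; rewrite fE.
  by apply/measurable_EFinP; apply: measurable_funB.
have f0' t : 0 <= t < b' -> 0 <= f t.
  move=> /andP[t0 tb']; have [tb|bt] := ltP t b; first by rewrite f0// t0.
  by rewrite fE ?bt// subr_ge0 (le_trans ub).
have mU : measurable_fun (`[0, b[ `|` `[b, b'[) (fun t => (f t)%:E).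
  by apply/measurable_funU.
split=> //; rewrite split_itv// ge0_integral_setU//.
- rewrite iV EFinD; congr (_ + _)%E; rewrite -integral_line//.
  by apply: eq_integral => t; rewrite inE/= in_itv/= => tb; rewrite fE.
- by rewrite -split_itv => t /=; rewrite in_itv/= lee_fin; exact: f0'.
- apply/disj_setPS => t [] /=; rewrite !in_itv/= => /andP[_ h1] /andP[h2 _].
  by move: (lt_le_trans h1 h2); rewrite ltxx.
Qed.

End LinearIntegral.

(** * Integral of the age along a sample path *)

Section Pathwise.
Variables (R : realType) (B0 : R) (Y A x : nat -> R) (D : pred nat).
Hypothesis B0_ge0 : 0 <= B0.
Hypothesis Y_ge0 : forall j, 0 <= Y j.
Hypothesis A_ge0 : forall j, 0 <= A j.
Hypothesis x_ge0 : forall j, 0 <= x j.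
Hypothesis x_le : forall j, D j -> x j <= Y j.
Hypothesis D_inf : forall j, exists2 i, (j <= i)%N & D i.

Definition cycle_start j := B0 + \sum_(i < j) Y i.
Local Notation B := cycle_start.
Local Notation J := (Defs.nth_index D).
Definition reception m := B (J m) + x (J m).
Local Notation r := reception.
(** [age] in terms of cycles: update m is received at [r m], in cycle [J m], with transit time A +
    x. The agreement with [age] holds by unfolding. *)
Definition held_age t := t - (if t < r 0 then 0
  else r (xget 0%N [set m | r m <= t < r m.+1]) -
    (A (J (xget 0%N [set m | r m <= t < r m.+1])) +
     x (J (xget 0%N [set m | r m <= t < r m.+1])))).

(** Time-stamp held when cycle j starts. [B j' - A j'] is the generation time of the update served
    in cycle j', and 0 the time-stamp assumed before the first receipt. *)
Fixpoint stamp j := if j is j'.+1 then if D j' then B j' - A j' else stamp j' else 0.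

Lemma cycle_startS j : B j.+1 = B j + Y j.
Proof. by rewrite /B big_ord_recr/= addrA. Qed.

Lemma le_cycle_start i j : (i <= j)%N -> B i <= B j.
Proof.
move=> ij; rewrite -(subnKC ij); elim: (j - i)%N => [|d ih]; first by rewrite addn0.
by rewrite addnS cycle_startS (le_trans ih)// lerDl.
Qed.

Lemma stampE j : B j - stamp j = cycle_age B0 Y A D j.
Proof.
elim: j => [|j ih] /=; first by rewrite /B big_ord0 addr0 subr0.
by rewrite cycle_startS; case: ifP => _; rewrite -?ih; ring.
Qed.

Lemma cycle_age_ge0 j : 0 <= cycle_age B0 Y A D j.
Proof. by elim: j => //= j ih; rewrite addr_ge0//; case: ifP. Qed.

Lemma D_nth_index m : D (J m). Proof. by have [] := nth_indexP m D_inf. Qed.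

Lemma nth_index_next m j : (J m < j <= J m.+1)%N -> D j -> J m.+1 = j.
Proof.
move=> /andP[h1 h2] Dj; have [i ji Di] := D_inf (J m).+1.
have [|g1 g2 g3] := @next_indexP D (J m).+1; first by exists i; rewrite ji.
apply/eqP; rewrite eqn_leq h2 andbT leqNgt; apply/negP => h3.
by have := g3 j; rewrite h1 h3 Dj => /(_ isT).
Qed.

Lemma nth_index_first j : (j <= J 0)%N -> D j -> J 0 = j.
Proof.
move=> h2 Dj; have [i ji Di] := D_inf 0%N.
have [|g1 g2 g3] := @next_indexP D 0%N; first by exists i; rewrite ji.
apply/eqP; rewrite eqn_leq h2 andbT leqNgt; apply/negP => h3.
by have := g3 j; rewrite h3 Dj => /(_ isT).
Qed.

(** Matches the recursive time-stamp with the enumeration of deliveries: it is 0 as long as none has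
    occurred, and otherwise comes from the last delivering cycle strictly before j. *)
Lemma stamp_cases j : (stamp j = 0 /\ (j <= J 0)%N) \/
  exists m, (J m < j <= J m.+1)%N /\ stamp j = B (J m) - A (J m).
Proof.
elim: j => [|j [[ih1 ih2]|[m [ih1 ih2]]]]; rewrite ?[stamp j.+1]/=; first by left.
  case: ifP => Dj.
    right; exists 0%N; have h := nth_index_ltS D 0; move: h.
    by rewrite (nth_index_first ih2 Dj) ltnSn => ->.
  left; split=> //; rewrite ltn_neqAle ih2 andbT; apply: contraFN Dj => /eqP ->.
  exact: D_nth_index.
case: ifP => Dj.
  right; exists m.+1; have h := nth_index_ltS D m.+1; move: h.
  by rewrite (nth_index_next ih1 Dj) ltnSn => ->.
right; exists m; split=> //; move: ih1 => /andP[h1 h2].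
rewrite ltnS (ltnW h1)/= ltn_neqAle h2 andbT; apply: contraFN Dj => /eqP ->.
exact: (D_nth_index m.+1).
Qed.

Lemma reception_le m : r m <= B (J m).+1.
Proof. by rewrite cycle_startS /r lerD2l x_le// D_nth_index. Qed.

Lemma le_reception m m' : (m <= m')%N -> r m <= r m'.
Proof.
move=> mm'; rewrite -(subnKC mm'); elim: (m' - m)%N => [|d ih]; first by rewrite addn0.
rewrite addnS (le_trans ih)// (le_trans (reception_le _))//.
by rewrite (le_trans (le_cycle_start (nth_index_ltS _ _)))// /r lerDl.
Qed.

Lemma held_age_before t : t < r 0 -> held_age t = t.
Proof. by rewrite /held_age => ->; rewrite subr0. Qed.

Lemma held_age_between m t : r m <= t < r m.+1 -> held_age t = t - (B (J m) - A (J m)).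
Proof.
move=> /andP[h1 h2]; rewrite /held_age ifF; last first.
  by apply/negbTE; rewrite -leNgt (le_trans _ h1)// le_reception.
set S := [set m | _].
have -> : xget 0%N S = m.
  apply: xget_unique; first by rewrite /S /= h1 h2.
  move=> m' /andP[g1 g2]; apply/eqP; rewrite eqn_leq; apply/andP; split.
    by rewrite leqNgt; apply/negP => /le_reception; rewrite leNgt (le_lt_trans g1 h2).
  by rewrite leqNgt; apply/negP => /le_reception; rewrite leNgt (le_lt_trans h1 g2).
by congr (_ - _); rewrite /r opprD addrACA subrr addr0.
Qed.

(** The time-stamp changes at most once within a cycle, at the instant [B j + x j] of the delivery,
    if there is one. *)
Lemma held_age_cycle j t : B j <= t < B j.+1 ->
  held_age t = t - (if D j && (B j + x j <= t) then B j - A j else stamp j).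
Proof.
move=> /andP[h1 h2]; have [[-> g2]|[m [/andP[g1 g2] ->]]] := stamp_cases j.
  case: ifP => [/andP[Dj h3]|].
    rewrite -(nth_index_first g2 Dj); apply: held_age_between.
    rewrite {1}/r (nth_index_first g2 Dj) h3/= (lt_le_trans h2)//.
    apply: (@le_trans _ _ (B (J 1))); last by rewrite /r lerDl.
    by apply: le_cycle_start; rewrite -{1}(nth_index_first g2 Dj) nth_index_ltS.
  move=> h3; rewrite subr0; apply: held_age_before; have [Dj|Dj] := boolP (D j).
    by rewrite /r (nth_index_first g2 Dj) ltNge; move: h3; rewrite Dj => /= ->.
  apply: (lt_le_trans h2); apply: (@le_trans _ _ (B (J 0))); last by rewrite /r lerDl.
  apply: le_cycle_start; rewrite ltn_neqAle g2 andbT; apply: contraNN Dj => /eqP ->.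
  exact: D_nth_index.
have rm : r m <= t.
  by apply: le_trans h1; apply: le_trans (reception_le m) _; exact: le_cycle_start.
case: ifP => [/andP[Dj h3]|h3].
  have JE : J m.+1 = j by apply: nth_index_next => //; rewrite g1.
  rewrite -JE; apply: held_age_between.
  rewrite {1}/r JE h3/= (lt_le_trans h2)//.
  apply: (@le_trans _ _ (B (J m.+2))); last by rewrite /r lerDl.
  by apply: le_cycle_start; rewrite -{1}JE nth_index_ltS.
apply: held_age_between; rewrite rm/=; have [Dj|Dj] := boolP (D j).
  have JE : J m.+1 = j by apply: nth_index_next => //; rewrite g1.
  by rewrite /r JE ltNge; move: h3; rewrite Dj => /= ->.
apply: (lt_le_trans h2); apply: (@le_trans _ _ (B (J m.+1))); last by rewrite /r lerDl.
apply: le_cycle_start; rewrite ltn_neqAle g2 andbT; apply: contraNN Dj => /eqP ->.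
exact: (D_nth_index m.+1).
Qed.

(** A cycle with delivery contributes two pieces of slope one, meeting at the delivery; one without
    contributes a single piece. Differences of squares add up to [cycle_area]. *)
Lemma area_cycle j V : area_upto held_age (B j) V ->
  area_upto held_age (B j.+1) (V + cycle_area B0 Y A x D j).
Proof.
move=> hV; have Bj : 0 <= B j.
  by apply: le_trans (le_cycle_start (leq0n j)); rewrite /B big_ord0 addr0.
have sB : stamp j <= B j by rewrite -subr_ge0 stampE cycle_age_ge0.
rewrite /cycle_area -stampE; have [Dj|Dj] := boolP (D j).
  have s1 : area_upto held_age (B j + x j)
      (V + ((B j + x j - stamp j) ^+ 2 - (B j - stamp j) ^+ 2) / 2).
    apply: area_upto_line => //; first by rewrite lerDl.
    move=> t /andP[t1 t2]; rewrite (@held_age_cycle j) ?Dj ?leNgt ?t2//=.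
    by rewrite -leNgt t1 (lt_le_trans t2)// cycle_startS lerD2l x_le.
  have := area_upto_line (b' := B j.+1) (u := B j - A j) s1.
  have -> : V + ((B j + x j - stamp j) ^+ 2 - (B j - stamp j) ^+ 2) / 2 +
    ((B j.+1 - (B j - A j)) ^+ 2 - (B j + x j - (B j - A j)) ^+ 2) / 2 =
    V + ((B j - stamp j) * Y j + Y j ^+ 2 / 2 + (A j - (B j - stamp j)) * (Y j - x j)).
    by rewrite cycle_startS; field.
  apply; first by rewrite addr_ge0.
  - by rewrite cycle_startS lerD2l x_le.
  - by rewrite lerD// (le_trans _ (x_ge0 j))// oppr_le0.
  - move=> t /andP[t1 t2]; rewrite (@held_age_cycle j) ?Dj ?t1//=.
    by rewrite t2 (le_trans _ t1)// lerDl.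
have := area_upto_line (b' := B j.+1) (u := stamp j) hV.
have -> : ((B j.+1 - stamp j) ^+ 2 - (B j - stamp j) ^+ 2) / 2 =
    (B j - stamp j) * Y j + Y j ^+ 2 / 2 + 0 by rewrite cycle_startS; field.
apply=> //; first by rewrite cycle_startS lerDl.
by move=> t /held_age_cycle ->; rewrite (negbTE Dj).
Qed.

Lemma area_cycles N :
  area_upto held_age (B N) (B0 ^+ 2 / 2 + \sum_(j < N) cycle_area B0 Y A x D j).
Proof.
elim: N => [|N ih]; last by rewrite big_ord_recr/= addrA; exact: area_cycle.
rewrite /B !big_ord0 !addr0.
(* Until the first cycle starts the age is t itself, hence the triangle of area [B0 ^+ 2 / 2]. *)
have := area_upto_line (b' := B0) (u := 0) (area_upto0 held_age).
rewrite !subr0 expr0n/= subr0 add0r; apply=> // t /andP[_ tB]; rewrite subr0.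
apply: held_age_before; apply: (lt_le_trans tB); rewrite /r /B -addrA lerDl addr_ge0//.
by apply: sumr_ge0.
Qed.

End Pathwise.

(** * From averages over cycles to averages over time *)

Section AreaRate.
Variable R : realType.
Local Notation leb := (@lebesgue_measure R).

Lemma area_upto_le (f : R -> R) (b V t : R) : area_upto f b V -> 0 <= t -> t < b ->
  (\int[leb]_(s in `[0%R, t]) (f s)%:E <= V%:E)%E.
Proof.
move=> [mf f0 iV] t0 tb; rewrite -iV; apply: ge0_subset_integral => //.
by apply: subset_itvl; rewrite bnd_simp.
Qed.

Lemma le_area_upto (f : R -> R) (b V b' V' t : R) : area_upto f b V -> area_upto f b' V' ->
  b <= t -> t < b' -> (V%:E <= \int[leb]_(s in `[0%R, t]) (f s)%:E)%E.
Proof.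
move=> [mf f0 iV] [mf' f0' iV'] bt tb'; rewrite -iV; apply: ge0_subset_integral => //.
- apply: measurable_funS mf' => //; by apply: subset_itvl; rewrite bnd_simp.
- move=> s /=; rewrite in_itv/= lee_fin => /andP[s0 st].
  by rewrite f0'// s0 (le_lt_trans st).
- by apply: subset_itvl; rewrite bnd_simp.
Qed.

Lemma area_upto_ge0 (f : R -> R) (b V : R) : area_upto f b V -> 0 <= V.
Proof.
move=> [mf f0 iV]; rewrite -lee_fin -iV; apply: integral_ge0 => t /=.
by rewrite in_itv/= lee_fin; exact: f0.
Qed.

Lemma cvg_succ_ratio : (fun N : nat => N%:R / N.+1%:R : R) @ \oo --> (1 : R).
Proof.
have -> : (fun N : nat => N%:R / N.+1%:R : R) = (fun N => 1 - N.+1%:R^-1).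
  apply/funext => N; rewrite -natr1; field.
  by rewrite natr1 pnatr_eq0.
rewrite -[X in _ --> X]subr0; apply: cvgB; [exact: cvg_cst|exact: cvg_harmonic].
Qed.

Lemma cvg_rate_ratio (u v : nat -> R) (a b : R) : b != 0 ->
  (fun N => N%:R^-1 * u N) @ \oo --> a -> (fun N => N%:R^-1 * v N) @ \oo --> b ->
  (fun N => u N / v N.+1) @ \oo --> a / b /\ (fun N => u N.+1 / v N) @ \oo --> a / b.
Proof.
move=> b0 ua vb; have r1 := cvg_succ_ratio.
have v1 : (fun N => N.+1%:R^-1 * v N.+1) @ \oo --> b.
  by move: vb; rewrite -(cvg_shiftS (fun N => N%:R^-1 * v N)).
have u1 : (fun N => N.+1%:R^-1 * u N.+1) @ \oo --> a.
  by move: ua; rewrite -(cvg_shiftS (fun N => N%:R^-1 * u N)).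
have r2 : (fun N : nat => (N%:R / N.+1%:R : R)^-1) @ \oo --> (1 : R).
  rewrite -[X in _ --> X]invr1; exact: (@cvgV _ _ _ _ _ _ (oner_neq0 R) r1).
have neq0 N : N.+1%:R != 0 :> R by rewrite pnatr_eq0.
split; rewrite -[X in _ --> X]mulr1.
  have h : (fun N => N%:R^-1 * u N * (N.+1%:R^-1 * v N.+1)^-1 * (N%:R / N.+1%:R))
      @ \oo --> a / b * 1.
    by apply: cvgM r1; apply: cvgM => //; exact: (@cvgV _ _ _ _ _ _ b0 v1).
  apply: cvg_trans h; apply: near_eq_cvg; exists 1%N => // -[//|N] _ /=.
  rewrite invfM invrK; move: (u _) ((v _)^-1) (neq0 N) (neq0 N.+1) => p q.
  by move: (N.+1%:R : R) (N.+2%:R : R) => a1 b1 n1 n2; field; rewrite ?n1 ?n2.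
have h : (fun N => N.+1%:R^-1 * u N.+1 * (N%:R^-1 * v N)^-1 * (N%:R / N.+1%:R)^-1)
    @ \oo --> a / b * 1.
  by apply: cvgM r2; apply: cvgM => //; exact: (@cvgV _ _ _ _ _ _ b0 vb).
apply: cvg_trans h; apply: near_eq_cvg; exists 1%N => // -[//|N] _ /=.
rewrite !invfM !invrK; move: (u _) ((v _)^-1) (neq0 N) (neq0 N.+1) => p q.
by move: (N.+1%:R : R) (N.+2%:R : R) => a1 b1 n1 n2; field; rewrite ?n1 ?n2.
Qed.

(** For [B N <= tau < B N.+1] the time average lies between [V N / B N.+1] and [V N.+1 / B N]; both
    ratios tend to Lam/mu because N/(N+1) tends to 1. *)
Lemma area_rate (f : R -> R) (B V : nat -> R) (mu Lam : R) : 0 < mu ->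
  {homo B : i j / (i <= j)%N >-> i <= j} -> 0 <= B 0 ->
  (forall N, area_upto f (B N) (V N)) ->
  (fun N => N%:R^-1 * B N) @ \oo --> mu -> (fun N => N%:R^-1 * V N) @ \oo --> Lam ->
  (fun tau : R => tau^-1%:E * \int[leb]_(t in `[0%R, tau]) (f t)%:E)%E @ +oo%R -->
    (Lam / mu)%:E.
Proof.
move=> mu0 homB B0 fV Bmu VLam; pose I tau := (\int[leb]_(t in `[0%R, tau]) (f t)%:E)%E.
have V0 N : 0 <= V N := area_upto_ge0 (fV N).
(* Eventually [B N] exceeds (mu/2) N, hence every bound. *)
have unb b : exists N, b < B N.
  have /cvgrPdist_lt/(_ (mu / 2)) [|K _ hK] := Bmu; first by rewrite divr_gt0.
  have [M hM] : exists M : nat, `|b| / (mu / 2) < M%:R.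
    by exists (Num.bound (`|b| / (mu / 2))); apply: archi_boundP; rewrite divr_ge0// divr_ge0// ltW.
  exists (maxn K M.+1); set N := maxn K M.+1.
  have N0 : 0 < N%:R :> R by rewrite ltr0n /N leq_max orbT.
  have := hK N; rewrite /= /N leq_maxl => /(_ isT); rewrite ltr_norml => /andP[_].
  rewrite -/N => h; have {}h : mu / 2 < N%:R^-1 * B N by move: h; lra.
  rewrite ltr_pdivlMl// in h; apply: le_lt_trans h.
  apply: le_trans (ler_norm b) _; rewrite -ler_pdivrMr ?divr_gt0//.
  by apply: le_trans (ltW hM) _; rewrite ler_nat /N leq_max leqnSn orbT.
have cycle N1 tau : B N1 <= tau -> exists2 N, (N1 <= N)%N & B N <= tau < B N.+1.
  move=> h; have ex := unb tau; case: (ex_minnP ex) => M hM minM.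
  case: M hM minM => [|N] hM minM.
    by have := homB _ _ (leq0n N1); rewrite leNgt (le_lt_trans h hM).
  exists N.
    rewrite leqNgt; apply/negP => /homB; rewrite leNgt (le_lt_trans h hM)//.
  by rewrite hM andbT leNgt; apply/negP => /minM; rewrite ltnn.
have bounds N tau : 0 < B N -> B N <= tau < B N.+1 ->
    exists2 y, (tau^-1%:E * I tau)%E = y%:E & V N / B N.+1 <= y <= V N.+1 / B N.
  move=> BN /andP[h1 h2]; have tau0 : 0 < tau by exact: lt_le_trans h1.
  have g1 := le_area_upto (fV N) (fV N.+1) h1 h2.
  have g2 := area_upto_le (fV N.+1) (ltW tau0) h2.
  rewrite -/(I tau) in g1 g2; have BN' : 0 < B N.+1 by exact: lt_trans h2.
  (* The two bounds also exclude infinite values of the integral. *)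
  move: g1 g2; case: (I tau) => [y| |] //; rewrite ?lee_fin => g1 g2.
  exists (tau^-1 * y) => //; apply/andP; split.
    rewrite [leRHS]mulrC; apply: ler_pM => //; first by rewrite invr_ge0 ltW.
    by rewrite lef_pV2 ?posrE// ltW.
  rewrite mulrC; apply: ler_pM => //; first exact: le_trans (V0 N) g1.
    by rewrite invr_ge0 ltW.
  by rewrite lef_pV2 ?posrE.
have [lo hi] := cvg_rate_ratio (lt0r_neq0 mu0) VLam Bmu.
apply/fine_cvgP; split.
  have [N1 hN1] := unb 0.
  near=> tau.
  have [|N g1 g2] := @cycle N1 tau; first by near: tau; exact: nbhs_pinfty_ge (num_real _).
  by have [|y ->] := bounds N tau _ g2; first exact: lt_le_trans hN1 (homB _ _ g1).
apply/cvgrPdist_le => eps eps0.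
have /cvgrPdist_le/(_ eps eps0) [K1 _ hK1] := lo.
have /cvgrPdist_le/(_ eps eps0) [K2 _ hK2] := hi.
have [N1 hN1] := unb 0.
near=> tau.
have [|N g1 g2] := @cycle (maxn N1 (maxn K1 K2)) tau.
  by near: tau; exact: nbhs_pinfty_ge (num_real _).
move: g1; rewrite !geq_max => /and3P[n1 n2 n3].
have [|y yE /andP[y1 y2]] := bounds N tau _ g2; first exact: lt_le_trans hN1 (homB _ _ n1).
rewrite /= -/(I tau) yE /=.
have := hK1 N n2; have := hK2 N n3; rewrite /= !ler_norml => /andP[a1 a2] /andP[a3 a4].
by apply/andP; split; move: y1 y2 a1 a2 a3 a4;
  move: (V N / _) (V N.+1 / _) (Lam / mu) => p q s; lra.
Unshelve. all: by end_near. Qed.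

End AreaRate.

(** * Average age *)

Section CanonicalAverageAge.
Variables (n : nat) (k : nat -> nat) (R : realType).
Local Notation Om := (path_space (primitive_index n) R).
Variable P : probability Om R.
Local Notation X := (abs_delay P).
Local Notation G := (abs_interarrival P).
Variables (L : nat) (shift rate : nat -> R) (e : node n).
Hypothesis k_bounds : forall l : nat, (1 <= l <= L)%N -> (1 <= k l <= n)%N.
Hypothesis shift_ge0 : forall l : nat, (1 <= l <= L)%N -> 0 <= shift l.
Hypothesis rate_gt0 : forall l : nat, (1 <= l <= L)%N -> 0 < rate l.
Hypothesis network : multicast_network k (raw_delay P) (raw_interarrival P) L shift rate.
Hypothesis e_end : size e = L.

(** The suffixes of e are the lists [drop i e], so the quantification over nodes is a countable
    intersection of events of probability 1. *)
Lemma ae_path_nodes (Q : node n -> Om -> Prop) :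
  (forall v, suffix v e -> (size v < L)%N -> {ae P, forall x, Q v x}) ->
  {ae P, forall x, forall v, suffix v e -> (size v < L)%N -> Q v x}.
Proof.
move=> h; have : {ae P, forall x, forall i : nat,
    suffix (drop i e) e -> (size (drop i e) < L)%N -> Q (drop i e) x}.
  apply/ae_foralln => i.
  have [se|se] := boolP (suffix (drop i e) e); last by apply: filterE.
  have [sz|sz] := boolP (size (drop i e) < L)%N; last by apply: filterE.
  by apply: filterS (h _ se sz).
apply: filterS => x hx v ve; have := hx (size e - size v)%N.
by move: (ve); rewrite suffixE => /eqP ->; apply.
Qed.

Lemma raw_positive : {ae P, forall x, forall v, suffix v e -> (size v < L)%N ->
  (forall j c, 0 < raw_delay P v j c x) /\
  (v != [::] -> forall a, 0 < raw_interarrival P v a x)}.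
Proof.
apply: ae_path_nodes => v ve vL.
have h1 := raw_delay_gt0 shift_ge0 network vL.
have [_ h2] := path_node_regular k_bounds shift_ge0 rate_gt0 network e_end ve vL.
have [v0|v0] := eqVneq v [::].
  by apply: filterS h1 => x ?; split.
by have [_ h3] := h2 v0; apply: filterS2 h1 h3 => x.
Qed.

(** Relabels cycle 0 as cycle j, since the expectations of the theorem are taken in an arbitrary
    cycle. *)
Lemma Ex_delay_stat v j i : suffix v e -> (size v < L)%N ->
  L1 P (delay_stat X v j i) /\ Ex P (delay_stat X v j i) = Ex P (delay_stat X v 0 i).
Proof.
move=> ve vL.
have [reg atl kv momX _ _ _] := path_nodeP k_bounds shift_ge0 rate_gt0 network e_end ve vL.
have X1 c : L1 P (X v 0%N c : Om -> R).
  by apply/L2_L1/exp_moment_L2; [move=> x; exact: abs_ge0|exact: momX].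
have D0 := L1_delay_stat i X1.
have D_ge0 j' x : 0 <= delay_stat X v j' i x.
  by apply: order_stat_ge0 => c; exact: abs_ge0.
pose s (u : primitive_index n) : primitive_index n := match u with
  | inl (v, b, c) => inl (v, (b + j)%N, c)
  | inr a => inr a
  end.
pose J : pred (primitive_index n) := fun u =>
  if u is inl (v', b, c) then (v' == v) && (b == 0)%N else false.
have [ind _ _ idX _ _] := reg.
have e1 : (\int[P]_x (delay_stat X v j i x)%:E = \int[P]_x (delay_stat X v 0 i x)%:E)%E.
  have <- := @reindex_integral _ _ P _ ind s J
    (fun x => (delay_stat X v 0 i x)%:E).
  - by [].
  - by move=> [[[v' b] c]|u] // /andP[/eqP -> _].
  - by move=> [[[v' b] c]|u]//= /andP[/eqP -> _].
  - move=> [[[v1 b1] c1]|u1] [[[v2 b2] c2]|u2] _ _ //= [-> /addIn -> ->] //.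
  - by move=> [[[v' b] c]|u]// A /andP[/eqP -> _] mA; exact: idX.
  - by apply/measurable_EFinP; exact: measurable_delay_stat.
  - by move=> x; rewrite lee_fin.
  - move=> x y xy; congr (_%:E); congr (order_stat _ _); apply/funext => c.
    by rewrite /= /abs_coordinate xy// /J/= eqxx.
have Dj : L1 P (delay_stat X v j i).
  apply: ge0_L1 => //; first exact: measurable_delay_stat.
  by rewrite e1 ExE// ltry.
by split=> //; apply: EFin_inj; rewrite -!ExE.
Qed.

Variables (c : 'I_n) (p : node n).
Hypothesis e_cons : e = c :: p.
Local Notation Y := (cycle_length k X G p).

Lemma last_suffix : suffix p e /\ (size p < L)%N.
Proof. by split; [rewrite e_cons; exact: suffix_cons|rewrite -e_end e_cons]. Qed.

Let pnode : path_node k P L e p.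
Proof.
have [pe pL] := last_suffix.
exact: (path_nodeP k_bounds shift_ge0 rate_gt0 network e_end pe pL).
Qed.

Lemma cycle_length_L2 j : L2 P (Y j) /\ Ex P (Y j) = Ex P (Y 0) /\
  Ex P (fun x => Y j x ^+ 2) = Ex P (fun x => Y 0 x ^+ 2).
Proof.
have [Yj Yj2] := cycle_length_Ex_sqr pnode c j; split=> //; split=> //.
have [_ //] := @Ex_cycle_fun _ k _ P L e p (node_regular pnode) j c (fun _ _ y => y)
  (L2_L1 (first_cycle_L2 pnode)) (cycle_ge0 k P p 0).
Qed.

Lemma cycle_length_Ex_gt0 : 0 < Ex P (Y 0).
Proof.
apply: Ex_gt0; [exact: L2_L1 (first_cycle_L2 pnode)|exact: (cycle_ge0 k P p)|].
have [ind pe pL _ _ unb] := node_regular pnode.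
apply: filterS2 unb (node_delay_pos pnode) => x unbx X0.
apply: lt_le_trans (service_gt0 (node_k pnode) 0 X0) _.
by apply: service_le_cycle_length => // i; exact: abs_ge0.
Qed.

(** The limit of the theorem in terms of the first two moments of a cycle length;
    [transit_mean k P e] collects the sum over all hops, the last one included. *)
Definition average_age : R :=
  let mu := Ex P (Y 0) in let s2 := Ex P (fun x => Y 0 x ^+ 2) in
  transit_mean k P e + (2 * n%:R - (k L)%:R) / (2 * (k L)%:R) * mu + (s2 - mu ^+ 2) / (2 * mu).

Lemma first_arrival_ge0 v x : 0 <= first_arrival k X G v x.
Proof.
elim: v => //= d v ih; rewrite !addr_ge0 ?abs_ge0//.
by apply: sumr_ge0 => i _; exact: cycle_length_nonneg.
Qed.

Theorem canonical_average_age : {ae P, forall x,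
  (fun tau : R => tau^-1%:E *
    \int[lebesgue_measure]_(t in `[0%R, tau]) (age k X G e t x)%:E)%E @ +oo%R -->
  average_age%:E}.
Proof.
have [pe pL] := last_suffix.
have [beta tauP] := transit_momentsP k_bounds shift_ge0 rate_gt0 network e_end pe (ltnW pL).
have tau_dep m : depends_on (above L e p) (transit k X G p m).
  by apply: transit_depends_on => //; exact: ltnW.
have avg := cycle_averages pnode tau_dep tauP c.
have [ind _ _ _ _ unb] := node_regular pnode.
apply: filterS3 avg unb (node_deliveries pnode) => x [avgY avgA] unbx inf.
have kp := node_k pnode; have k0 : 0 < (k L)%:R :> R.
  by have := @k_bounds L; rewrite leqnn andbT -e_end e_cons /= => /(_ isT)/andP[]; rewrite ltr0n.
have hopL : hop p = L by rewrite /hop -e_end e_cons.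
have n0 := n_gt0 R kp.
set B0 := first_arrival k X G p x.
pose Yx j := Y j x; pose A j := cycle_transit k P p j x.
pose xs j := X p j c x; pose D := delivered k X p c x.
have Y0 j : 0 <= Yx j by exact: cycle_length_nonneg.
have A0 j : 0 <= A j by exact: cycle_transit_ge0.
have xs0 j : 0 <= xs j by exact: abs_ge0.
have xsY j : D j -> xs j <= Yx j.
  move=> Dj; apply: le_trans Dj _; apply: service_le_cycle_length => // i; exact: abs_ge0.
have B00 : 0 <= B0 by exact: first_arrival_ge0.
have ageE t : age k X G e t x = held_age B0 Yx A xs D t by rewrite e_cons.
have := area_cycles B00 Y0 A0 xs0 xsY (inf c).
have mu0 := cycle_length_Ex_gt0; set mu := Ex P (Y 0) in mu0 avgY avgA.
set Lam := (X in _ --> X) in avgA.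
move=> areas; have h := area_rate mu0 _ _ areas.
(* The [hop_mean] in Lam completes the transit mean from p to e, and mu/p0 - mu + s2/(2 mu) with p0
   = k/n yields the other two terms. *)
have -> : average_age = Lam / mu.
  rewrite /average_age /Lam -/mu e_cons /= hopL; set s2 := Ex P _.
  by field; rewrite !gt_eqF.
rewrite (_ : (fun tau : R => _) = (fun tau : R => tau^-1%:E *
    \int[lebesgue_measure]_(t in `[0%R, tau]) (held_age B0 Yx A xs D t)%:E)%E); last first.
  by apply/funext => tau; congr (_ * _)%E; apply: eq_integral => t _; rewrite ageE.
have Ninv : (fun N => N%:R^-1) @ \oo --> (0 : R).
  by rewrite -(cvg_shiftS (fun N => N%:R^-1 : R)); exact: cvg_harmonic.
apply: h.
- by move=> i j ij; exact: le_cycle_start.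
- by rewrite /cycle_start big_ord0 addr0.
- rewrite (_ : (fun N => _) = (fun N => N%:R^-1 * B0 + average Yx N)); last first.
    by apply/funext => N; rewrite /cycle_start mulrDr.
  rewrite -[X in _ --> X]add0r -[X in _ --> X + _](mul0r B0).
  by apply: cvgD avgY; apply: cvgMl.
- rewrite (_ : (fun N => _) = (fun N => N%:R^-1 * (B0 ^+ 2 / 2) +
      average (cycle_area B0 Yx A xs D) N)); last first.
    by apply/funext => N; rewrite mulrDr.
  rewrite -[X in _ --> X]add0r -[X in _ --> X + _](mul0r (B0 ^+ 2 / 2)).
  apply: cvgD; first exact: cvgMl.
  by apply: average_cycle_area_start avgA; have [i _ Di] := inf c 0%N; exists i.
Qed.

End CanonicalAverageAge.

(** * Transfer from sample paths to the given probability space *)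

Section Transfer.
Context d (T : measurableType d) (R : realType) (P : probability T R).
Variables (n : nat) (k : nat -> nat).
Variables (X : node n -> nat -> 'I_n -> {RV P >-> R}) (G : node n -> nat -> {RV P >-> R}).
Local Notation Om := (path_space (primitive_index n) R).

Definition sample_path (w : T) : Om := fun i => primitive X G i w.

Lemma measurable_sample_path : measurable_fun setT sample_path.
Proof.
apply: measurable_to_path => -[[[v j] c]|[v a]]; exact: measurable_funPT.
Qed.

HB.instance Definition _ := isMeasurableFun.Build _ _ _ _ sample_path measurable_sample_path.

Definition path_law : probability Om R := distribution P sample_path.

Lemma ae_path_law (Q : Om -> Prop) :
  {ae path_law, forall x, Q x} -> {ae P, forall w, Q (sample_path w)}.
Proof.
move=> [N [mN N0 QN]]; exists (sample_path @^-1` N); split=> //.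
- by rewrite -[X in measurable X]setTI; exact: measurable_sample_path.
- by move=> w Qw; exact: QN.
Qed.

Local Notation X' := (abs_delay path_law).
Local Notation G' := (abs_interarrival path_law).
Variables (L : nat) (shift rate : nat -> R).
Hypothesis network : multicast_network k X G L shift rate.

(** The fields of the network speak only of laws of primitives and of functions of them, so they
    survive the passage to the image measure. *)
Lemma path_network :
  multicast_network k (raw_delay path_law) (raw_interarrival path_law) L shift rate.
Proof.
split.
- move=> v j c vL A mA; exact: (link_delay_law network j c vL mA).
- move=> p c a m A pL mA; rewrite /= /path_law /distribution /pushforward.
  transitivity (P (G (c :: p) a @^-1` A)); first by [].
  rewrite (interarrival_law network c a m pL mA); congr (P _).
  by apply/seteqP; split=> w /=; rewrite (@eq_success_gap _ _ _ _ _ P path_law _ _ X G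
    (raw_delay path_law) (raw_interarrival path_law) w (sample_path w)).
- move=> e eL s A us sD mA.
  have := independence network eL us sD mA.
  rewrite /path_law /distribution /pushforward /=.
  have -> : (\prod_(i <- s) P (sample_path @^-1`
      (primitive (raw_delay path_law) (raw_interarrival path_law) i @^-1` A i)) =
    \prod_(i <- s) P (primitive X G i @^-1` A i))%E.
    by apply: eq_bigr => -[[[v j] c]|[v a]] _.
  move=> <-; congr (P _); apply/seteqP.
  by split=> w /= h i si; have := h i si; case: i {si} => [[[v j] c]|[v a]].
Qed.

Hypothesis k_bounds : forall l : nat, (1 <= l <= L)%N -> (1 <= k l <= n)%N.
Hypothesis shift_ge0 : forall l : nat, (1 <= l <= L)%N -> 0 <= shift l.
Hypothesis rate_gt0 : forall l : nat, (1 <= l <= L)%N -> 0 < rate l.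
Variable e : node n.
Hypothesis e_end : size e = L.

(** Delays and interarrival times on the way to e are almost surely positive, so taking absolute
    values alters nothing there. *)
Lemma sample_path_abs : {ae P, forall w, forall v, suffix v e -> (size v < size e)%N ->
  (forall j c, X v j c w = X' v j c (sample_path w)) /\
  (v != [::] -> forall a, G v a w = G' v a (sample_path w))}.
Proof.
have := ae_path_law (raw_positive k_bounds shift_ge0 rate_gt0 path_network e_end).
apply: filterS => w h v ve; rewrite e_end => vL; have [h1 h2] := h v ve vL.
split=> [j c|v0 a]; first by have := h1 j c; rewrite /= /abs_coordinate => /gtr0_norm ->.
by have := h2 v0 a; rewrite /= /abs_coordinate => /gtr0_norm ->.
Qed.

Lemma expectation_path_law (f : T -> R) (g : Om -> R) : measurable_fun setT f ->
  L1 path_law g -> {ae P, forall w, f w = g (sample_path w)} ->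
  ('E_P[f] = (Ex path_law g)%:E)%E.
Proof.
move=> mf g1 fg; have mg := L1_measurable g1; have mF := measurable_sample_path.
have mgF : measurable_fun setT (fun w => (g (sample_path w))%:E).
  by apply/measurable_EFinP; exact: measurableT_comp mg mF.
have gF : P.-integrable setT (fun w => (g (sample_path w))%:E).
  apply/integrableP; split=> //; have /integrableP[_] := g1.
  by rewrite ge0_integral_pushforward//; apply: measurableT_comp => //; exact/measurable_EFinP.
rewrite unlock -ExE// integral_pushforward//; last exact/measurable_EFinP.
apply: ae_eq_integral => //; first exact/measurable_EFinP.
by apply: filterS fg => w -> _.
Qed.

Variables (c : 'I_n) (p : node n).
Hypothesis e_cons : e = c :: p.
Local Notation Y := (cycle_length k X' G' p).

Lemma last_hop_suffix : suffix p e /\ (size p < size e)%N.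
Proof. by rewrite e_cons; split => //; exact: suffix_cons. Qed.

Lemma expectation_delay_stat v j i : suffix v e -> (size v < L)%N ->
  ('E_P[delay_stat X v j i] = (Ex path_law (delay_stat X' v 0 i))%:E)%E.
Proof.
move=> ve vL.
have [d1 <-] := Ex_delay_stat k_bounds shift_ge0 rate_gt0 path_network e_end j i ve vL.
apply: expectation_path_law => //; first exact: measurable_delay_stat.
rewrite -e_end in vL; apply: filterS sample_path_abs => w /(_ v ve vL)[h _].
by congr (order_stat _ _); apply/funext => b; exact: h.
Qed.

Lemma expectation_sum_hops j :
  (\sum_(1 <= l < L.+1) (((k l)%:R^-1)%:E *
     \sum_(1 <= i < (k l).+1) 'E_P[delay_stat X (ancestor e l.-1) j i]) =
   (transit_mean k path_law e)%:E)%E.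
Proof.
rewrite transit_meanE e_end -sumEFin big_nat [RHS]big_nat.
apply: eq_bigr => l /andP[l1 lL]; set v := ancestor e l.-1.
have vl : size v = l.-1 by rewrite size_drop e_end; lia.
have vL : (size v < L)%N by rewrite vl; lia.
have hopv : hop v = l by rewrite /hop vl prednK.
rewrite /hop_mean hopv EFinM -sumEFin; congr (_ * _)%E; apply: eq_bigr => i _.
by apply: expectation_delay_stat => //; exact: suffix_drop.
Qed.

Let mu : R := Ex path_law (Y 0).
Let s2 : R := Ex path_law (fun x => Y 0 x ^+ 2).

Lemma sample_path_cycle : {ae P, forall w, forall j,
  service k X p j w = service k X' p j (sample_path w) /\
  cycle_length k X G p j w = Y j (sample_path w)}.
Proof.
have [pe pL] := last_hop_suffix.
apply: filterS sample_path_abs => w /(_ p pe pL)[h1 h2] j.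
by split; [exact: eq_service|exact: eq_cycle_length].
Qed.

(** The waiting time is integrated as the difference of cycle length and service time, both of which
    are integrable. *)
Lemma expectation_cycle j :
  ('E_P[service k X p j] + 'E_P[waiting k X G p j] = mu%:E)%E.
Proof.
have [pe pL] := last_hop_suffix; rewrite e_end in pL.
have [s1 _] := Ex_delay_stat k_bounds shift_ge0 rate_gt0 path_network e_end j (k (hop p)) pe pL.
have [Y2 [YE _]] := cycle_length_L2 k_bounds shift_ge0 rate_gt0 path_network e_end e_cons j.
have W1 : L1 path_law (fun x => Y j x - service k X' p j x) by apply: L1B => //; exact: L2_L1.
rewrite (expectation_path_law (g := service k X' p j)) => //; last 2 first.
- exact: measurable_delay_stat.
- by apply: filterS sample_path_cycle => w /(_ j)[].
rewrite (expectation_path_law (g := fun x => Y j x - service k X' p j x)) => //; last 2 first.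
- exact: measurable_waiting.
- apply: filterS sample_path_cycle => w /(_ j)[<- <-].
  by rewrite /cycle_length addrC addKr.
by rewrite -EFinD -ExD// /mu -YE; congr (_%:E); apply: eq_Ex => x; rewrite addrC subrK.
Qed.

Lemma expectation_cycle_length j : ('E_P[cycle_length k X G p j] = mu%:E)%E.
Proof.
have [Y2 [YE _]] := cycle_length_L2 k_bounds shift_ge0 rate_gt0 path_network e_end e_cons j.
rewrite (expectation_path_law (g := Y j)) ?YE//; first exact: measurable_cycle_length.
- exact: L2_L1.
- by apply: filterS sample_path_cycle => w /(_ j)[].
Qed.

Lemma variance_cycle_length j : ('V_P[cycle_length k X G p j] = (s2 - mu ^+ 2)%:E)%E.
Proof.
have [Y2 [YE YE2]] := cycle_length_L2 k_bounds shift_ge0 rate_gt0 path_network e_end e_cons j.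
rewrite /variance unlock expectation_cycle_length /=.
have Yc2 : L2 path_law (fun x => Y j x - mu) by apply: L2B => //; exact: L2_cst.
have Y1 : L1 path_law (Y j) by exact: L2_L1.
rewrite (expectation_path_law (g := fun x => (Y j x - mu) ^+ 2)); last 3 first.
- apply: measurable_funM; apply: measurable_funB => //; exact: measurable_cycle_length.
- exact: Yc2.2.
- by apply: filterS sample_path_cycle => w /(_ j)[_ h]; by rewrite expr2 -h.
congr (_%:E).
have -> : (fun x => (Y j x - mu) ^+ 2) = (fun x => Y j x ^+ 2 + (mu ^+ 2 - 2 * mu * Y j x)).
  by apply/funext => x; ring.
have L3 : L1 path_law (fun x => 2 * mu * Y j x) by exact: L1Z.
have L4 : L1 path_law (fun x => mu ^+ 2 - 2 * mu * Y j x) by apply: L1B => //; exact: L1_cst.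
rewrite ExD//; last exact: Y2.2.
rewrite ExB//; last exact: L1_cst.
by rewrite ExZ// Ex_cst YE YE2 -/mu -/s2; ring.
Qed.

End Transfer.

Local Open Scope ereal_scope.

(** The limit holds almost surely along sample paths. The cycle j in the expectations and the
    variance is arbitrary because their values are the same in every cycle. *)
Theorem theorem3 (d : measure_display) (T : measurableType d) (R : realType)
    (P : probability T R) (L n : nat) (k : nat -> nat) (shift rate : nat -> R)
    (X : node n -> nat -> 'I_n -> {RV P >-> R})
    (G : node n -> nat -> {RV P >-> R})
    (L_gt0 : (0 < L)%N)
    (k_bounds : forall l : nat, (1 <= l <= L)%N -> (1 <= k l <= n)%N)
    (shift_ge0 : forall l : nat, (1 <= l <= L)%N -> (0 <= shift l)%R)
    (rate_gt0 : forall l : nat, (1 <= l <= L)%N -> (0 < rate l)%R)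
    (network : multicast_network k X G L shift rate)
    (e : node n) (e_end : size e = L) (j : nat) :
  let v := fun l : nat => ancestor e l.-1 in
  let EX := 'E_P[service k X (v L) j] in
  let EZ := 'E_P[waiting k X G (v L) j] in
  {ae P, forall w : T,
    (fun tau : R => tau^-1%:E *
       \int[lebesgue_measure]_(t in `[0%R, tau]) (age k X G e t w)%:E)
      @ +oo%R -->
    \sum_(1 <= l < L.+1) (((k l)%:R^-1)%:E *
        \sum_(1 <= i < (k l).+1) 'E_P[delay_stat X (v l) j i])
    + ((2 * n%:R - (k L)%:R) / (2 * (k L)%:R))%:E * (EX + EZ)
    + 'V_P[fun w => service k X (v L) j w + waiting k X G (v L) j w]%R
        / (2%:E * (EX + EZ))}.
Proof.
case: e e_end => [|c p] e_end v EX EZ; first by move: L_gt0; rewrite -e_end.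
have vL : v L = p by rewrite /v -e_end /= ancestor_cons// /ancestor subnn drop0.
have mu0 := cycle_length_Ex_gt0 k_bounds shift_ge0 rate_gt0 (path_network network) e_end erefl.
set mu := Ex _ _ in mu0.
have EXZ : (EX + EZ = mu%:E)%E.
  by rewrite /EX /EZ vL (expectation_cycle network k_bounds shift_ge0 rate_gt0 e_end erefl).
have lim := ae_path_law (canonical_average_age k_bounds shift_ge0 rate_gt0
  (path_network network) e_end erefl).
have eqA := sample_path_abs network k_bounds shift_ge0 rate_gt0 e_end.
apply: filterS2 lim eqA => w h eqw.
rewrite EXZ vL (variance_cycle_length network k_bounds shift_ge0 rate_gt0 e_end erefl).
rewrite (expectation_sum_hops network k_bounds shift_ge0 rate_gt0 e_end).
(* The inverse of 2 mu in the extended reals is the real one since mu > 0. *)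
rewrite -!EFinM inver mulf_eq0 pnatr_eq0/= gt_eqF// -EFinM -!EFinD.
rewrite (_ : (fun tau : R => _) = (fun tau : R => tau^-1%:E *
  \int[lebesgue_measure]_(t in `[0%R, tau])
    (age k (abs_delay (path_law X G)) (abs_interarrival (path_law X G)) (c :: p) t
      (sample_path X G w))%:E)%E); first exact: h.
apply/funext => tau; congr (_ * _)%E; apply: eq_integral => t _; congr (_%:E).
by apply: eq_age => u ue ul; have [] := eqw u ue ul.
Qed.
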